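(* Let $V$ be a complex Hilbert space and let $g$ be an antisymplectic automorphism of $V$. Let $Z:V\oplus V\to V\oplus V$ be the (symmetric antilinear) map given by the rule that for $v\in V$ $$Z(v_1)=(Z_gv)_1+(A_{g^{-1}}^{-1}v)_2,\qquad Z(v_2)=(A_g^{-1}v)_1+(Z_{g^{-1}}v)_2.$$ Then the antilinear map $U_g:SV\to SV'$ with kernel $u_g=e^Z\in S(V\oplus V)'$, that is, $[U_g\phi](\psi)=e^Z(\phi_1\psi_2)$ for $\phi,\psi\in SV$, is a weak metaplectic operator implementing $g$. Every weak metaplectic operator implementing $g$ is a scalar multiple of $U_g$. Moreover, $U_g$ may be rescaled so as to be antiunitary (that is, $U_g$ maps $SV$ into $S[V]$ and some nonzero scalar multiple of $U_g$ extends to an antiunitary operator on $S[V]$) if and only if $C_g$ is of Hilbert-Schmidt class.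
   Context: Inner products are antilinear in the first slot and linear in the second. For a complex Hilbert space $W$, $SW=\bigoplus_{n\ge0}S^nW$ is the (algebraic) symmetric algebra and $SW'$ is the full antidual, i.e. all antilinear functionals $SW\to\mathbf{C}$. $SW'$ is a commutative algebra under $[\Phi\Psi](\theta)=[\Phi\otimes\Psi](\Delta\theta)$, where $\Delta:SW\to SW\otimes SW$ is the algebra homomorphism with $\Delta w=w\otimes1+1\otimes w$ for $w\in W$. $SW$ has the inner product for which the $S^nW$ are mutually perpendicular and $\langle x_1\cdots x_n|y_1\cdots y_n\rangle=\sum_p\prod_j\langle x_j|y_{p(j)}\rangle$ ($p$ over permutations of $\{1,\dots,n\}$). Fock space $S[W]$ is the Hilbert space completion of $SW$, identified with the subspace of $SW'$ of all bounded antilinear functionals via $\phi\mapsto\langle\cdot|\phi\rangle$. Creators and annihilators: for $v\in W$, on $SW$, $c(v)\phi=v\phi$ and $a(v)$ is the linear derivation with $a(v)\mathbf{1}=0$, $a(v)w=\langle v|w\rangle\mathbf{1}$ for $w\in W$. They act on $SW'$ by $[c(v)\Phi](\psi)=\Phi(a(v)\psi)$, $[a(v)\Phi](\psi)=\Phi(c(v)\psi)$. Gaussians: for $Z:W\to W$ antilinear and symmetric ($\langle y|Zx\rangle=\langle x|Zy\rangle$ for all $x,y$), let $\zeta\in SW'$ vanish on $S^nW$ for $n\neq2$ with $\zeta(xy)=\langle y|Zx\rangle$ for $x,y \in W$, and put $e^Z=\sum_{n\ge0}\frac1{n!}\zeta^n\in SW'$ (pointwise convergent). $V\oplus V$ is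 the Hilbert space direct sum; for $v\in V$, $v_1=(v,0)$ and $v_2=(0,v)$. The maps $v\mapsto v_1$, $v\mapsto v_2$ extend to algebra homomorphisms $\phi\mapsto\phi_1$, $\psi\mapsto\psi_2$ from $SV$ to $S(V\oplus V)$. Let $J$ be multiplication by $i$ on $V$ (as a real-linear operator) and $\Omega=\mathrm{Im}\langle\cdot|\cdot\rangle$. An antisymplectic automorphism of $V$ is a real-linear automorphism $g$ with $\Omega(gx,gy)=-\Omega(x,y)$ for all $x,y\in V$. Put $C_g=\frac12(g-JgJ)$ (complex-linear part) and $A_g=\frac12(g+JgJ)$ (antilinear part). It is known that, for $g$ antisymplectic, $A_g$ is invertible and $Z_g=A_g^{-1}C_g$ is symmetric antilinear with operator norm strictly less than $1$. A weak metaplectic operator implementing the antisymplectic $g$ is a nonzero antilinear map $U:SV\to SV'$ such that for all $v\in V$ $$Uc(v)=\{a(C_gv)+c(A_gv)\}U,\qquad Ua(v)=\{a(A_gv)+c(C_gv)\}U.$$ *)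

(* Defs.v *)
From HB Require Import structures.
From mathcomp Require Import all_boot all_order all_algebra perm.
From mathcomp Require Import all_classical all_reals all_analysis.
From mathcomp Require Import complex ring.

Set Implicit Arguments.
Unset Strict Implicit.
Unset Printing Implicit Defensive.

Import Order.TTheory GRing.Theory Num.Theory.
Import numFieldNormedType.Exports.

Local Open Scope classical_set_scope.
Local Open Scope ring_scope.
Local Open Scope quotient_scope.

(* The symmetric algebra Sym W: formal polynomial expressions in the vectors
   of W, modulo the least congruence that makes them a commutative K-algebra
   and makes the inclusion of W linear. *)

Section SymDef.
Context {K : fieldType} (W : lmodType K).

Inductive sym_expr : Type :=
  | SGen of W
  | SConst of K
  | SAdd of sym_expr & sym_expr
  | SMul of sym_expr & sym_expr.

HB.instance Definition _ := gen_eqMixin sym_expr.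
HB.instance Definition _ := gen_choiceMixin sym_expr.

Inductive sym_cong : sym_expr -> sym_expr -> Prop :=
  | SCrefl e : sym_cong e e
  | SCsym e1 e2 : sym_cong e1 e2 -> sym_cong e2 e1
  | SCtrans e1 e2 e3 : sym_cong e1 e2 -> sym_cong e2 e3 -> sym_cong e1 e3
  | SCadd e1 e2 d1 d2 : sym_cong e1 e2 -> sym_cong d1 d2 ->
      sym_cong (SAdd e1 d1) (SAdd e2 d2)
  | SCmul e1 e2 d1 d2 : sym_cong e1 e2 -> sym_cong d1 d2 ->
      sym_cong (SMul e1 d1) (SMul e2 d2)
  | SCaddA e1 e2 e3 : sym_cong (SAdd e1 (SAdd e2 e3)) (SAdd (SAdd e1 e2) e3)
  | SCaddC e1 e2 : sym_cong (SAdd e1 e2) (SAdd e2 e1)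
  | SCadd0 e : sym_cong (SAdd (SConst 0) e) e
  | SCmulA e1 e2 e3 : sym_cong (SMul e1 (SMul e2 e3)) (SMul (SMul e1 e2) e3)
  | SCmulC e1 e2 : sym_cong (SMul e1 e2) (SMul e2 e1)
  | SCmul1 e : sym_cong (SMul (SConst 1) e) e
  | SCmul0 e : sym_cong (SMul (SConst 0) e) (SConst 0)
  | SCmulD e1 e2 e3 :
      sym_cong (SMul (SAdd e1 e2) e3) (SAdd (SMul e1 e3) (SMul e2 e3))
  | SCconstD a b : sym_cong (SConst (a + b)) (SAdd (SConst a) (SConst b))
  | SCconstM a b : sym_cong (SConst (a * b)) (SMul (SConst a) (SConst b))
  | SCgenD u v : sym_cong (SGen (u + v)) (SAdd (SGen u) (SGen v))
  | SCgenZ a v : sym_cong (SGen (a *: v)) (SMul (SConst a) (SGen v)).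

Definition sym_congb (e1 e2 : sym_expr) : bool := `[< sym_cong e1 e2 >].

Lemma sym_congb_equiv : equiv_class_of sym_congb.
Proof.
split=> [e|e1 e2|e2 e1 e3]; first exact/asboolP/SCrefl.
  by apply/asboolP/asboolP; apply: SCsym.
by move=> /asboolP h1 /asboolP h2; apply/asboolP; apply: SCtrans h1 h2.
Qed.

Canonical sym_congb_equiv_rel := EquivRelPack sym_congb_equiv.

Definition Sym : Type := {eq_quot sym_congb}.
HB.instance Definition _ := Quotient.on Sym.
HB.instance Definition _ := Choice.on Sym.

Lemma sym_piP e1 e2 : (\pi_Sym e1 = \pi_Sym e2) <-> sym_cong e1 e2.
Proof.
by split=> [/eqmodP/asboolP//|h]; apply/eqmodP/asboolP.
Qed.

Lemma sym_reprK (e : sym_expr) : sym_cong (repr (\pi_Sym e)) e.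
Proof. by apply/sym_piP; rewrite reprK. Qed.

Lemma sym_quotP (x : Sym) : exists e, x = \pi_Sym e.
Proof. by exists (repr x); rewrite reprK. Qed.

Definition sym_const (a : K) : Sym := \pi_Sym (SConst a).
Definition sym_add (x y : Sym) : Sym := \pi_Sym (SAdd (repr x) (repr y)).
Definition sym_mul (x y : Sym) : Sym := \pi_Sym (SMul (repr x) (repr y)).
Definition sym_opp (x : Sym) : Sym := sym_mul (sym_const (-1)) x.
Definition sym_scale (a : K) (x : Sym) : Sym := sym_mul (sym_const a) x.
(* the inclusion of W in Sym W *)
Definition sym_gen (w : W) : Sym := \pi_Sym (SGen w).

Lemma sym_addE e1 e2 :
  sym_add (\pi_Sym e1) (\pi_Sym e2) = \pi_Sym (SAdd e1 e2).
Proof. by apply/sym_piP; apply: SCadd; apply: sym_reprK. Qed.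

Lemma sym_mulE e1 e2 :
  sym_mul (\pi_Sym e1) (\pi_Sym e2) = \pi_Sym (SMul e1 e2).
Proof. by apply/sym_piP; apply: SCmul; apply: sym_reprK. Qed.

Lemma sym_addA : associative sym_add.
Proof.
move=> x y z; have [[? ->] [? ->] [? ->]] :=
  And3 (sym_quotP x) (sym_quotP y) (sym_quotP z).
by rewrite !sym_addE; apply/sym_piP; apply: SCaddA.
Qed.

Lemma sym_addC : commutative sym_add.
Proof.
move=> x y; have [[? ->] [? ->]] := conj (sym_quotP x) (sym_quotP y).
by rewrite !sym_addE; apply/sym_piP; apply: SCaddC.
Qed.

Lemma sym_add0 : left_id (sym_const 0) sym_add.
Proof.
move=> x; have [? ->] := sym_quotP x.
by rewrite !sym_addE; apply/sym_piP; apply: SCadd0.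
Qed.

Lemma sym_mulA : associative sym_mul.
Proof.
move=> x y z; have [[? ->] [? ->] [? ->]] :=
  And3 (sym_quotP x) (sym_quotP y) (sym_quotP z).
by rewrite !sym_mulE; apply/sym_piP; apply: SCmulA.
Qed.

Lemma sym_mulC : commutative sym_mul.
Proof.
move=> x y; have [[? ->] [? ->]] := conj (sym_quotP x) (sym_quotP y).
by rewrite !sym_mulE; apply/sym_piP; apply: SCmulC.
Qed.

Lemma sym_mul1 : left_id (sym_const 1) sym_mul.
Proof.
move=> x; have [? ->] := sym_quotP x.
by rewrite !sym_mulE; apply/sym_piP; apply: SCmul1.
Qed.

Lemma sym_mulDl : left_distributive sym_mul sym_add.
Proof.
move=> x y z; have [[? ->] [? ->] [? ->]] :=
  And3 (sym_quotP x) (sym_quotP y) (sym_quotP z).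
by rewrite !(sym_mulE, sym_addE); apply/sym_piP; apply: SCmulD.
Qed.

Lemma sym_constD a b : sym_const (a + b) = sym_add (sym_const a) (sym_const b).
Proof. by rewrite sym_addE; apply/sym_piP; apply: SCconstD. Qed.

Lemma sym_constM a b : sym_const (a * b) = sym_mul (sym_const a) (sym_const b).
Proof. by rewrite sym_mulE; apply/sym_piP; apply: SCconstM. Qed.

Lemma sym_addN : left_inverse (sym_const 0) sym_opp sym_add.
Proof.
move=> x; rewrite /sym_opp -{2}[x]sym_mul1 -sym_mulDl -sym_constD addNr.
have [? ->] := sym_quotP x.
by rewrite sym_mulE; apply/sym_piP; apply: SCmul0.
Qed.

Fixpoint sym_eval (A : comPzRingType) (c : K -> A) (f : W -> A)
    (e : sym_expr) : A :=
  match e with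
  | SGen w => f w
  | SConst a => c a
  | SAdd e1 e2 => sym_eval c f e1 + sym_eval c f e2
  | SMul e1 e2 => sym_eval c f e1 * sym_eval c f e2
  end.

Lemma sym_eval_cong (A : comPzRingType) (c : {rmorphism K -> A}) (f : W -> A) :
  (forall u v, f (u + v) = f u + f v) -> (forall a v, f (a *: v) = c a * f v) ->
  forall e1 e2, sym_cong e1 e2 -> sym_eval c f e1 = sym_eval c f e2.
Proof.
move=> fD fZ e1 e2; elim=> //=.
- by move=> ? ? ? _ -> _ ->.
- by move=> ? ? ? ? _ -> _ ->.
- by move=> ? ? ? ? _ -> _ ->.
- by move=> *; rewrite addrA.
- by move=> *; rewrite addrC.
- by move=> *; rewrite rmorph0 add0r.
- by move=> *; rewrite mulrA.
- by move=> *; rewrite mulrC.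
- by move=> *; rewrite rmorph1 mul1r.
- by move=> *; rewrite rmorph0 mul0r.
- by move=> *; rewrite mulrDl.
- by move=> *; rewrite rmorphD.
- by move=> *; rewrite rmorphM.
Qed.

Lemma sym_const1_neq0 : sym_const 1 != sym_const 0.
Proof.
apply/eqP => /sym_piP.
have f0D (u v : W) : 0 = 0 + 0 :> K by rewrite addr0.
have f0Z (a : K) (v : W) : 0 = idfun a * 0 :> K by rewrite mulr0.
move=> /(sym_eval_cong (c := idfun) f0D f0Z) /= /eqP.
by rewrite oner_eq0.
Qed.

HB.instance Definition _ := GRing.isZmodule.Build Sym
  sym_addA sym_addC sym_add0 sym_addN.
HB.instance Definition _ := GRing.Zmodule_isComNzRing.Build Sym
  sym_mulA sym_mulC sym_mul1 sym_mulDl sym_const1_neq0.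

Lemma sym_scaleA a b (x : Sym) : sym_scale a (sym_scale b x) = sym_scale (a * b) x.
Proof. by rewrite /sym_scale sym_mulA -sym_constM. Qed.

Lemma sym_scaleDr : right_distributive sym_scale +%R.
Proof. by move=> a x y; exact: (mulrDr (sym_const a)). Qed.

Lemma sym_scaleDl (x : Sym) : {morph sym_scale^~ x : a b / a + b}.
Proof. by move=> a b; rewrite /sym_scale sym_constD; exact: mulrDl. Qed.

HB.instance Definition _ := GRing.Zmodule_isLmodule.Build K Sym
  sym_scaleA sym_mul1 sym_scaleDr sym_scaleDl.
HB.instance Definition _ := GRing.Lmodule_isLalgebra.Build K Sym
  (fun a x y => sym_mulA (sym_const a) x y).
HB.instance Definition _ := GRing.Lalgebra_isComAlgebra.Build K Sym.

Lemma sym_gen_is_linear : linear sym_gen.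
Proof.
move=> a u v.
transitivity (sym_add (sym_gen (a *: u)) (sym_gen v)).
  by rewrite sym_addE; apply/sym_piP; apply: SCgenD.
congr (sym_add _ _); rewrite -[RHS]/(sym_mul (sym_const a) (sym_gen u)).
by rewrite sym_mulE; apply/sym_piP; apply: SCgenZ.
Qed.
HB.instance Definition _ := GRing.isLinear.Build K W Sym _ sym_gen sym_gen_is_linear.

Lemma sym_piD e1 e2 : \pi_Sym (SAdd e1 e2) = \pi_Sym e1 + \pi_Sym e2.
Proof. by rewrite -[RHS]/(sym_add _ _) sym_addE. Qed.
Lemma sym_piM e1 e2 : \pi_Sym (SMul e1 e2) = \pi_Sym e1 * \pi_Sym e2.
Proof. by rewrite -[RHS]/(sym_mul _ _) sym_mulE. Qed.
Lemma sym_piC a : \pi_Sym (SConst a) = a%:A.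
Proof. exact/esym/(mulr1 (sym_const a)). Qed.

Lemma Sym_ind (P : Sym -> Prop) :
  (forall w, P (sym_gen w)) -> (forall a, P a%:A) ->
  (forall x y, P x -> P y -> P (x + y)) ->
  (forall x y, P x -> P y -> P (x * y)) -> forall x, P x.
Proof.
move=> Pg Pc PD PM x; have [e ->] := sym_quotP x.
elim: e => [w|a|e1 h1 e2 h2|e1 h1 e2 h2]; rewrite ?sym_piC ?sym_piD ?sym_piM.
- exact: Pg.
- exact: Pc.
- exact: PD.
- exact: PM.
Qed.

End SymDef.
Arguments sym_gen {K W} w.

Section SymMaps.
Context {K : fieldType} {W : lmodType K}.

(* the algebra homomorphism Sym W -> A extending the linear map f : W -> A *)
Definition sym_lift (A : comAlgType K) (f : {linear W -> A}) (x : Sym W) : A :=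
  sym_eval (in_alg A) f (repr x).

Section Lift.
Variables (A : comAlgType K) (f : {linear W -> A}).

Lemma sym_liftE e : sym_lift f (\pi_(Sym W) e) = sym_eval (in_alg A) f e.
Proof.
apply: (sym_eval_cong (c := in_alg A)); last exact: sym_reprK.
  by move=> u v; rewrite linearD.
by move=> a v; rewrite linearZ /= -scalerAl mul1r.
Qed.

Lemma sym_liftD : {morph sym_lift f : x y / x + y}.
Proof.
move=> x y; have [[e1 ->] [e2 ->]] := conj (sym_quotP x) (sym_quotP y).
by rewrite -sym_piD !sym_liftE.
Qed.

Lemma sym_lift_scale a (x : Sym W) : sym_lift f (a *: x) = a *: sym_lift f x.
Proof.
have [e ->] := sym_quotP x.
rewrite -[_ *: _]/(sym_mul (sym_const W a) _) sym_mulE !sym_liftE /=.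
by rewrite -scalerAl mul1r.
Qed.

Lemma sym_lift_is_linear : linear (sym_lift f).
Proof. by move=> a x y; rewrite sym_liftD sym_lift_scale. Qed.

Lemma sym_lift_is_multiplicative : multiplicative (sym_lift f).
Proof.
split=> [x y|]; last first.
  by rewrite -[1]/(sym_const W 1) sym_liftE /= scale1r.
have [[e1 ->] [e2 ->]] := conj (sym_quotP x) (sym_quotP y).
by rewrite -sym_piM !sym_liftE.
Qed.

HB.instance Definition _ :=
  GRing.isLinear.Build K (Sym W) A _ (sym_lift f) sym_lift_is_linear.
HB.instance Definition _ :=
  GRing.isMultiplicative.Build (Sym W) A (sym_lift f) sym_lift_is_multiplicative.

Lemma sym_lift_gen w : sym_lift f (sym_gen w) = f w.
Proof. by rewrite sym_liftE. Qed.

End Lift.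

(* the component in S^0 W = K *)
Definition sym_eps : Sym W -> K := @sym_lift K^o (\0 : {linear W -> K^o}).
HB.instance Definition _ := GRing.LRMorphism.copy sym_eps
  (@sym_lift K^o (\0 : {linear W -> K^o})).

Lemma sym_eps_gen w : sym_eps (sym_gen w) = 0.
Proof. exact: (@sym_lift_gen K^o \0 w). Qed.

Definition is_derivation (A : algType K) (d : A -> A) : Prop :=
  linear d /\ forall x y, d (x * y) = d x * y + x * d y.

Section Derivation.
Variable l : {scalar W}.

Fixpoint sym_der_expr (e : sym_expr W) : Sym W :=
  match e with
  | SGen w => (l w)%:A
  | SConst _ => 0
  | SAdd e1 e2 => sym_der_expr e1 + sym_der_expr e2
  | SMul e1 e2 => sym_der_expr e1 * \pi_(Sym W) e2 +
                  \pi_(Sym W) e1 * sym_der_expr e2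
  end.

Lemma sym_der_cong e1 e2 :
  sym_cong e1 e2 -> sym_der_expr e1 = sym_der_expr e2.
Proof.
elim=> //=.
- by move=> ? ? ? _ -> _ ->.
- by move=> ? ? ? ? _ -> _ ->.
- by move=> ? ? ? ? /sym_piP-> -> /sym_piP-> ->.
- by move=> *; rewrite addrA.
- by move=> *; rewrite addrC.
- by move=> *; rewrite add0r.
- by move=> *; rewrite !sym_piM !mulrDl !mulrDr !mulrA addrA.
- by move=> *; rewrite addrC ![_ * sym_der_expr _]mulrC
    ![sym_der_expr _ * _]mulrC.
- by move=> *; rewrite mul0r add0r sym_piC scale1r mul1r.
- by move=> *; rewrite mul0r add0r sym_piC scale0r mul0r.
- by move=> *; rewrite sym_piD !mulrDl addrACA.
- by move=> *; rewrite addr0.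
- by move=> *; rewrite mul0r mulr0 addr0.
- by move=> *; rewrite linearD scalerDl.
- by move=> a v; rewrite linearZ mul0r add0r sym_piC -scalerAl mul1r scalerA.
Qed.

(* the derivation of Sym W extending the linear functional l on W *)
Definition sym_der (x : Sym W) : Sym W := sym_der_expr (repr x).

Lemma sym_derE e : sym_der (\pi_(Sym W) e) = sym_der_expr e.
Proof. by apply: sym_der_cong; apply: sym_reprK. Qed.

Lemma sym_der_gen w : sym_der (sym_gen w) = (l w)%:A.
Proof. by rewrite sym_derE. Qed.

Lemma sym_derM x y : sym_der (x * y) = sym_der x * y + x * sym_der y.
Proof.
have [[e1 ->] [e2 ->]] := conj (sym_quotP x) (sym_quotP y).
by rewrite -sym_piM !sym_derE.
Qed.

Lemma sym_der_const a : sym_der a%:A = 0.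
Proof. by rewrite -sym_piC sym_derE. Qed.

Lemma sym_der_is_linear : linear sym_der.
Proof.
move=> a x y.
have D u v : sym_der (u + v) = sym_der u + sym_der v.
  have [[e1 ->] [e2 ->]] := conj (sym_quotP u) (sym_quotP v).
  by rewrite -sym_piD !sym_derE.
by rewrite D -mulr_algl sym_derM sym_der_const mul0r add0r mulr_algl.
Qed.
HB.instance Definition _ :=
  GRing.isLinear.Build K (Sym W) (Sym W) _ sym_der sym_der_is_linear.

Lemma sym_der_is_derivation : is_derivation sym_der.
Proof. by split; [exact: sym_der_is_linear | exact: sym_derM]. Qed.

End Derivation.

Lemma sym_der_comm (l m : {scalar W}) x :
  sym_der l (sym_der m x) = sym_der m (sym_der l x).
Proof.
move: x; apply: Sym_ind => [w|a|x y hx hy|x y hx hy].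
- by rewrite !sym_der_gen !sym_der_const.
- by rewrite !sym_der_const !linear0.
- by rewrite !linearD /= hx hy.
- rewrite !sym_derM !linearD /= !sym_derM hx hy -!addrA; congr (_ + _).
  by rewrite addrCA.
Qed.

End SymMaps.

Definition sym_prod {K : fieldType} {W : lmodType K} (s : seq W) : Sym W :=
  \prod_(w <- s) sym_gen w.

(* The tensor product of two K-vector spaces: formal finite sums of pairs
   (a, b), representing a (x) b, two of which are identified when no bilinear
   form separates them. *)

Section Tensor.
Context {K : fieldType} (A B : lmodType K).

Definition bilinear_form (f : A -> B -> K) : Prop :=
  (forall a, scalar (f a)) /\ (forall b, scalar (f^~ b)).

Definition tens_cong (s t : seq (A * B)) : Prop :=
  forall f, bilinear_form f ->
    \sum_(p <- s) f p.1 p.2 = \sum_(p <- t) f p.1 p.2.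

Definition tens_congb (s t : seq (A * B)) : bool := `[< tens_cong s t >].

Lemma tens_congb_equiv : equiv_class_of tens_congb.
Proof.
split=> [s|s t|s t u]; first exact/asboolP.
  by apply/asboolP/asboolP => h f bf; rewrite h.
by move=> /asboolP h1 /asboolP h2; apply/asboolP => f bf; rewrite h1 ?h2.
Qed.

Canonical tens_congb_equiv_rel := EquivRelPack tens_congb_equiv.

Definition tensor : Type := {eq_quot tens_congb}.
HB.instance Definition _ := Quotient.on tensor.
HB.instance Definition _ := Choice.on tensor.

Lemma tens_piP s t : (\pi_tensor s = \pi_tensor t) <-> tens_cong s t.
Proof. by split=> [/eqmodP/asboolP//|h]; apply/eqmodP/asboolP. Qed.

Lemma tens_reprK s : tens_cong (repr (\pi_tensor s)) s.
Proof. by apply/tens_piP; rewrite reprK. Qed.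

Lemma tens_quotP (x : tensor) : exists s, x = \pi_tensor s.
Proof. by exists (repr x); rewrite reprK. Qed.

Definition pure_tensor (a : A) (b : B) : tensor := \pi_tensor [:: (a, b)].

Definition tens_zero : tensor := \pi_tensor [::].
Definition tens_add (x y : tensor) : tensor := \pi_tensor (repr x ++ repr y).
Definition tens_scale (c : K) (x : tensor) : tensor :=
  \pi_tensor [seq (c *: p.1, p.2) | p <- repr x].
Definition tens_opp (x : tensor) : tensor := tens_scale (-1) x.

Lemma tens_addE s t : tens_add (\pi_tensor s) (\pi_tensor t) = \pi_tensor (s ++ t).
Proof.
by apply/tens_piP => f bf; rewrite !big_cat /= !tens_reprK.
Qed.

Lemma bilinear_formZl f c a b : bilinear_form f -> f (c *: a) b = c * f a b.
Proof.
case=> _ /(_ b) h; have f0 : f 0 b = 0.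
  by have /= := h (-1) 0 0; rewrite scaler0 addr0 mulN1r addNr.
by have /= := h c a 0; rewrite f0 !addr0.
Qed.

Lemma tens_scaleE c s : tens_scale c (\pi_tensor s) =
  \pi_tensor [seq (c *: p.1, p.2) | p <- s].
Proof.
apply/tens_piP => f bf; rewrite !big_map /=.
under eq_bigr do rewrite bilinear_formZl //.
under [RHS]eq_bigr do rewrite bilinear_formZl //.
by rewrite -!mulr_sumr tens_reprK.
Qed.

Lemma tens_addA : associative tens_add.
Proof.
move=> x y z; have [[? ->] [? ->] [? ->]] :=
  And3 (tens_quotP x) (tens_quotP y) (tens_quotP z).
by rewrite !tens_addE catA.
Qed.

Lemma tens_addC : commutative tens_add.
Proof.
move=> x y; have [[? ->] [? ->]] := conj (tens_quotP x) (tens_quotP y).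
by rewrite !tens_addE; apply/tens_piP => f bf; rewrite !big_cat /= addrC.
Qed.

Lemma tens_add0 : left_id tens_zero tens_add.
Proof. by move=> x; have [? ->] := tens_quotP x; rewrite tens_addE. Qed.

Lemma tens_addN : left_inverse tens_zero tens_opp tens_add.
Proof.
move=> x; have [s ->] := tens_quotP x.
rewrite /tens_opp tens_scaleE tens_addE; apply/tens_piP => f bf.
rewrite big_cat big_map big_nil /= -big_split /=.
by apply: big1_seq => p _; rewrite bilinear_formZl // mulN1r addNr.
Qed.

HB.instance Definition _ := GRing.isZmodule.Build tensor
  tens_addA tens_addC tens_add0 tens_addN.

Lemma tens_scaleA a b (x : tensor) :
  tens_scale a (tens_scale b x) = tens_scale (a * b) x.
Proof.
have [s ->] := tens_quotP x; rewrite !tens_scaleE -map_comp.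
by congr (\pi_tensor _); apply: eq_map => p /=; rewrite scalerA.
Qed.

Lemma tens_scale1 : left_id 1 tens_scale.
Proof.
move=> x; have [s ->] := tens_quotP x; rewrite !tens_scaleE.
by congr (\pi_tensor _); rewrite -[RHS]map_id; apply: eq_map => -[a b] /=;
  rewrite scale1r.
Qed.

Lemma tens_piD s t : \pi_tensor (s ++ t) = \pi_tensor s + \pi_tensor t.
Proof. by rewrite -[RHS]/(tens_add _ _) tens_addE. Qed.

Lemma tens_scaleDr : right_distributive tens_scale +%R.
Proof.
move=> c x y; have [[s ->] [t ->]] := conj (tens_quotP x) (tens_quotP y).
by rewrite -tens_piD !tens_scaleE -tens_piD map_cat.
Qed.

Lemma tens_scaleDl (x : tensor) : {morph tens_scale^~ x : a b / a + b}.
Proof.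
move=> a b; have [s ->] := tens_quotP x.
rewrite !tens_scaleE -tens_piD; apply/tens_piP => f bf.
rewrite big_cat !big_map /= -big_split /=; apply: eq_bigr => p _.
by rewrite !bilinear_formZl // mulrDl.
Qed.

HB.instance Definition _ := GRing.Zmodule_isLmodule.Build K tensor
  tens_scaleA tens_scale1 tens_scaleDr tens_scaleDl.

Lemma pure_tensor_linearl b : linear (pure_tensor^~ b).
Proof.
move=> c u v /=; transitivity (\pi_tensor ([:: (c *: u, b)] ++ [:: (v, b)])).
  apply/tens_piP => f bf; rewrite !big_cons !big_nil /= !addr0.
  by case: (bf) => _ /(_ b c) /= ->; rewrite bilinear_formZl.
by rewrite tens_piD; congr (_ + _); exact/esym/tens_scaleE.
Qed.

Lemma pure_tensor_linearr a : linear (pure_tensor a).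
Proof.
move=> c u v /=; transitivity (\pi_tensor ([:: (c *: a, u)] ++ [:: (a, v)])).
  apply/tens_piP => f bf; rewrite !big_cons !big_nil /= !addr0.
  by rewrite bilinear_formZl //; case: bf => /(_ a c u v).
by rewrite tens_piD; congr (_ + _); exact/esym/tens_scaleE.
Qed.

End Tensor.

Section TensorAlgebra.
Context {K : fieldType} {A B : comAlgType K}.
Local Notation T := (tensor A B).

Definition tens_seqmul (s t : seq (A * B)) : seq (A * B) :=
  [seq (p.1 * q.1, p.2 * q.2) | p <- s, q <- t].

(* (a (x) b) (a' (x) b') = a a' (x) b b' *)
Definition tens_mul (x y : T) : T := \pi_T (tens_seqmul (repr x) (repr y)).

Lemma bilinear_form_mul (f : A -> B -> K) a b : bilinear_form f ->
  bilinear_form (fun a' b' => f (a' * a) (b' * b)).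
Proof.
case=> f1 f2; split=> [a'|b'] c u v /=; rewrite mulrDl -scalerAl; first exact: f1.
exact: (f2 (b' * b) c).
Qed.

Lemma big_seqmul (f : A -> B -> K) s t :
  \sum_(p <- tens_seqmul s t) f p.1 p.2 =
  \sum_(p <- s) \sum_(q <- t) f (p.1 * q.1) (p.2 * q.2).
Proof. by rewrite big_allpairs_dep. Qed.

Lemma big_seqmulC (f : A -> B -> K) s t :
  \sum_(p <- tens_seqmul s t) f p.1 p.2 =
  \sum_(p <- tens_seqmul t s) f p.1 p.2.
Proof.
rewrite !big_seqmul exchange_big /=.
by under eq_bigr do under eq_bigr do rewrite [_.1 * _]mulrC [_.2 * _]mulrC.
Qed.

Lemma tens_mulE s t : tens_mul (\pi_T s) (\pi_T t) = \pi_T (tens_seqmul s t).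
Proof.
have h u u' v : tens_cong u u' -> tens_cong (tens_seqmul u v) (tens_seqmul u' v).
  move=> uu' f bf; rewrite !big_seqmul exchange_big [RHS]exchange_big /=.
  by apply: eq_bigr => q _; exact: (uu' _ (bilinear_form_mul q.1 q.2 bf)).
apply/tens_piP => f bf.
rewrite (h _ _ _ (tens_reprK s)) // big_seqmulC.
by rewrite (h _ _ _ (tens_reprK t)) // big_seqmulC.
Qed.

Lemma tens_mulC : commutative tens_mul.
Proof.
move=> x y; have [[s ->] [t ->]] := conj (tens_quotP x) (tens_quotP y).
by rewrite !tens_mulE; apply/tens_piP => f bf; rewrite big_seqmulC.
Qed.

Lemma tens_mulDl : left_distributive tens_mul +%R.
Proof.
move=> x y z; have [[s ->] [t ->] [u ->]] :=
  And3 (tens_quotP x) (tens_quotP y) (tens_quotP z).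
by rewrite -tens_piD !tens_mulE -tens_piD /tens_seqmul allpairs_cat.
Qed.

Lemma tens_mulA : associative tens_mul.
Proof.
move=> x y z; have [[s ->] [t ->] [u ->]] :=
  And3 (tens_quotP x) (tens_quotP y) (tens_quotP z).
rewrite !tens_mulE; apply/tens_piP => f bf; rewrite !big_seqmul big_allpairs_dep.
apply: eq_bigr => p _; rewrite big_allpairs_dep.
by under eq_bigr do under eq_bigr do rewrite !mulrA.
Qed.

Lemma tens_mul1 : left_id (pure_tensor 1 1) tens_mul.
Proof.
move=> x; have [s ->] := tens_quotP x.
rewrite tens_mulE; apply/tens_piP => f bf; rewrite big_seqmul big_seq1 /=.
by under eq_bigr do rewrite !mul1r.
Qed.

Lemma tens_scaleAl (c : K) (x y : T) : c *: tens_mul x y = tens_mul (c *: x) y.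
Proof.
have [[s ->] [t ->]] := conj (tens_quotP x) (tens_quotP y).
rewrite tens_mulE -![_ *: _]/(tens_scale c _) !tens_scaleE tens_mulE.
apply/tens_piP => f bf; rewrite big_map !big_seqmul big_map big_allpairs_dep /=.
by under eq_bigr do under eq_bigr do rewrite scalerAl.
Qed.

End TensorAlgebra.

Section Coproduct.
Context {K : fieldType} {W : lmodType K}.
Local Notation T := (tensor (Sym W) (Sym W)).

Lemma tens_sym1_neq0 : pure_tensor 1 1 != 0 :> T.
Proof.
apply/eqP => /tens_piP/(_ (fun a b => sym_eps a * sym_eps b)) h.
have /h : bilinear_form (fun a b : Sym W => sym_eps a * sym_eps b).
  split=> [a|b] c u v; first by rewrite linearP /= mulrDr mulrCA.
  by rewrite linearP /= mulrDl mulrA.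
rewrite big_seq1 big_nil /= rmorph1 mulr1 => /eqP.
by rewrite oner_eq0.
Qed.

HB.instance Definition _ := GRing.Zmodule_isComNzRing.Build T
  tens_mulA tens_mulC tens_mul1 tens_mulDl tens_sym1_neq0.
HB.instance Definition _ := GRing.Lmodule_isLalgebra.Build K T tens_scaleAl.
HB.instance Definition _ := GRing.Lalgebra_isComAlgebra.Build K T.

Definition sym_prim (w : W) : T :=
  pure_tensor (sym_gen w) 1 + pure_tensor 1 (sym_gen w).

Lemma sym_prim_is_linear : linear sym_prim.
Proof.
move=> c u v; rewrite /sym_prim linearP /= pure_tensor_linearl.
by rewrite pure_tensor_linearr scalerDr addrACA.
Qed.
HB.instance Definition _ := GRing.isLinear.Build K W T _ sym_prim sym_prim_is_linear.

(* the algebra homomorphism with w |-> w (x) 1 + 1 (x) w *)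
Definition sym_coprod : Sym W -> T := sym_lift sym_prim.
HB.instance Definition _ := GRing.LRMorphism.copy sym_coprod (sym_lift sym_prim).

End Coproduct.

(* Inner products are antilinear in the first argument and linear in the
   second. *)
HB.mixin Record Lmodule_isPreHilbert (R : realType) V of GRing.Lmodule R[i] V := {
  ip : V -> V -> R[i];
  ip_scalar : forall u, scalar (ip u);
  ip_conj : forall u v, ip u v = (ip v u)^*;
  ip_ge0 : forall u, 0 <= ip u u;
  ip_eq0 : forall u, ip u u = 0 -> u = 0
}.

#[short(type="preHilbertType")]
HB.structure Definition PreHilbert (R : realType) :=
  {V of GRing.Lmodule R[i] V & Lmodule_isPreHilbert R V}.

Definition hnorm {R : realType} {V : preHilbertType R} (v : V) : R :=
  Num.sqrt (complex.Re (ip v v)).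

HB.mixin Record PreHilbert_isHilbert (R : realType) V of PreHilbert R V := {
  hilbert_complete : forall u : nat -> V,
    (forall e : R, 0 < e -> exists N, forall m n,
      (N <= m)%N -> (N <= n)%N -> hnorm (u m - u n) < e) ->
    exists l : V, forall e : R, 0 < e -> exists N, forall n,
      (N <= n)%N -> hnorm (u n - l) < e
}.

#[short(type="hilbertType")]
HB.structure Definition Hilbert (R : realType) :=
  {V of PreHilbert R V & PreHilbert_isHilbert R V}.

HB.instance Definition _ (R : realType) (V : preHilbertType R) (u : V) :=
  GRing.isLinear.Build R[i] V R[i] *%R (ip u) (ip_scalar u).

Section DirectSum.
Context {R : realType}.

Section Pre.
Variables V W : preHilbertType R.

Definition dsum_ip (p q : V * W) : R[i] := ip p.1 q.1 + ip p.2 q.2.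

Lemma dsum_ip_scalar p : scalar (dsum_ip p).
Proof. by move=> a q r; rewrite /dsum_ip !linearP /= mulrDr addrACA. Qed.

Lemma dsum_ip_conj p q : dsum_ip p q = (dsum_ip q p)^*.
Proof.
by rewrite /dsum_ip rmorphD /= [in LHS]ip_conj [X in _ + X = _]ip_conj.
Qed.

Lemma dsum_ip_ge0 p : 0 <= dsum_ip p p.
Proof. by rewrite addr_ge0 ?ip_ge0. Qed.

Lemma dsum_ip_eq0 p : dsum_ip p p = 0 -> p = 0.
Proof.
move=> /eqP; rewrite paddr_eq0 ?ip_ge0 //.
by case: p => v w /andP[/eqP/ip_eq0 /= -> /eqP/ip_eq0 /= ->].
Qed.

HB.instance Definition _ := Lmodule_isPreHilbert.Build R (V * W)%type
  dsum_ip_scalar dsum_ip_conj dsum_ip_ge0 dsum_ip_eq0.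

End Pre.

Lemma dsum_complete (V W : hilbertType R) (u : nat -> V * W) :
    (forall e : R, 0 < e -> exists N, forall m n,
      (N <= m)%N -> (N <= n)%N -> hnorm (u m - u n) < e) ->
    exists l : V * W, forall e : R, 0 < e -> exists N, forall n,
      (N <= n)%N -> hnorm (u n - l) < e.
Proof.
have reE (U : preHilbertType R) (v : U) : 0 <= complex.Re (ip v v).
  by have := ip_ge0 v; rewrite lecE => /andP[].
have splitE (p : V * W) : complex.Re (ip p p) =
    complex.Re (ip p.1 p.1) + complex.Re (ip p.2 p.2).
  by rewrite -[ip p p]/(dsum_ip p p) /dsum_ip; case: (ip _ _) (ip _ _) => ? ? [].
have le1 (p : V * W) : hnorm p.1 <= hnorm p.
  by rewrite /hnorm ler_sqrt splitE ?addr_ge0 // lerDl.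
have le2 (p : V * W) : hnorm p.2 <= hnorm p.
  by rewrite /hnorm ler_sqrt splitE ?addr_ge0 // lerDr.
have leD (p : V * W) : hnorm p <= hnorm p.1 + hnorm p.2.
  rewrite -(ler_pXn2r (n := 2)) ?nnegrE ?addr_ge0 ?sqrtr_ge0 //.
  rewrite sqrrD /hnorm !sqr_sqrtr // splitE lerD2r lerDl.
  by rewrite mulrn_wge0 // mulr_ge0 ?sqrtr_ge0.
move=> cu.
have [|l1 h1] := hilbert_complete (fst \o u).
  move=> e /cu[N hN]; exists N => m n Nm Nn.
  exact: le_lt_trans (le1 (u m - u n)) (hN m n Nm Nn).
have [|l2 h2] := hilbert_complete (snd \o u).
  move=> e /cu[N hN]; exists N => m n Nm Nn.
  exact: le_lt_trans (le2 (u m - u n)) (hN m n Nm Nn).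
exists (l1, l2) => e e0; have e2 : 0 < e / 2 by rewrite divr_gt0.
have [[N1 hN1] [N2 hN2]] := conj (h1 _ e2) (h2 _ e2).
exists (maxn N1 N2) => n; rewrite geq_max => /andP[n1 n2].
apply: le_lt_trans (leD _) _; rewrite [e]splitr.
exact: ltrD (hN1 _ n1) (hN2 _ n2).
Qed.

HB.instance Definition _ (V W : hilbertType R) :=
  PreHilbert_isHilbert.Build R (V * W)%type (@dsum_complete V W).

End DirectSum.

Section Fock.
Context {R : realType}.

Definition antilinear {U V : lmodType R[i]} (f : U -> V) : Prop :=
  forall (a : R[i]) u v, f (a *: u + v) = a^* *: f u + f v.

Context {W : preHilbertType R}.

Definition sym_cre (v : W) (x : Sym W) : Sym W := sym_gen v * x.
Definition sym_ann (v : W) (x : Sym W) : Sym W := sym_der (ip v) x.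

Lemma sym_ann1 v : sym_ann v 1 = 0.
Proof. by rewrite /sym_ann -[1]scale1r sym_der_const. Qed.

Lemma sym_ann_gen v w : sym_ann v (sym_gen w) = (ip v w)%:A.
Proof. exact: sym_der_gen. Qed.

Lemma sym_ann_is_derivation v : is_derivation (sym_ann v).
Proof. exact: sym_der_is_derivation. Qed.

Lemma ip_linearl a (u v w : W) : ip (a *: u + v) w = a^* * ip u w + ip v w.
Proof. by rewrite ip_conj linearP rmorphD rmorphM /= -!ip_conj. Qed.

Lemma sym_ann_antilinear a u v x :
  sym_ann (a *: u + v) x = a^* *: sym_ann u x + sym_ann v x.
Proof.
rewrite /sym_ann; move: x; apply: Sym_ind => [w|b|x y hx hy|x y hx hy].
- by rewrite !sym_der_gen /= ip_linearl scalerDl scalerA.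
- by rewrite !sym_der_const scaler0 addr0.
- by rewrite !linearD /= hx hy addrACA.
- rewrite !sym_derM hx hy !scalerDr mulrDl mulrDr.
  by rewrite addrACA -!scalerAl -!scalerAr.
Qed.

Lemma sym_ann0 x : sym_ann 0 x = 0.
Proof.
have := sym_ann_antilinear 1 0 0 x; rewrite rmorph1 !scale1r addr0.
by rewrite -[LHS]addr0 => /addrI.
Qed.

(* For x = x_1 ... x_n the operator sym_annP x is a(x_1) ... a(x_n). *)
Fixpoint sym_annP_expr (e : sym_expr W) : Sym W -> Sym W :=
  match e with
  | SGen w => sym_ann w
  | SConst a => *:%R a^*
  | SAdd e1 e2 => fun x => sym_annP_expr e1 x + sym_annP_expr e2 x
  | SMul e1 e2 => fun x => sym_annP_expr e1 (sym_annP_expr e2 x)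
  end.

Lemma sym_annP_expr_is_linear e : linear (sym_annP_expr e).
Proof.
elim: e => [w|a|e1 h1 e2 h2|e1 h1 e2 h2] c x y /=.
- exact: sym_der_is_linear.
- by rewrite scalerDr !scalerA mulrC.
- by rewrite h1 h2 scalerDr addrACA.
- by rewrite h2 h1.
Qed.
HB.instance Definition _ e := GRing.isLinear.Build R[i] (Sym W) (Sym W) _
  (sym_annP_expr e) (sym_annP_expr_is_linear e).

Lemma sym_annP_expr_ann e w x :
  sym_annP_expr e (sym_ann w x) = sym_ann w (sym_annP_expr e x).
Proof.
elim: e x => [v|a|e1 h1 e2 h2|e1 h1 e2 h2] x /=.
- exact: sym_der_comm.
- by rewrite [RHS]linearZ.
- by rewrite h1 h2 [RHS]linearD.
- by rewrite h2 h1.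
Qed.

Lemma sym_annP_expr_comm e1 e2 x :
  sym_annP_expr e1 (sym_annP_expr e2 x) = sym_annP_expr e2 (sym_annP_expr e1 x).
Proof.
elim: e1 x => [v|a|d1 h1 d2 h2|d1 h1 d2 h2] x /=.
- by rewrite sym_annP_expr_ann.
- by rewrite linearZ.
- by rewrite h1 h2 linearD.
- by rewrite h2 h1.
Qed.

Lemma sym_annP_cong e1 e2 : sym_cong e1 e2 ->
  sym_annP_expr e1 =1 sym_annP_expr e2.
Proof.
elim=> //=.
- by move=> ? ? _ h x; rewrite h.
- by move=> ? ? ? _ h1 _ h2 x; rewrite h1.
- by move=> ? ? ? ? _ h1 _ h2 x; rewrite h1 h2.
- by move=> ? ? ? ? _ h1 _ h2 x; rewrite h1 h2.
- by move=> ? ? ? x; rewrite addrA.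
- by move=> ? ? x; rewrite addrC.
- by move=> ? x; rewrite rmorph0 scale0r add0r.
- by move=> ? ? x; rewrite sym_annP_expr_comm.
- by move=> ? x; rewrite rmorph1 scale1r.
- by move=> ? x; rewrite rmorph0 !scale0r.
- by move=> ? ? x; rewrite rmorphD scalerDl.
- by move=> ? ? x; rewrite rmorphM scalerA.
- by move=> u v x; rewrite -[u]scale1r sym_ann_antilinear rmorph1 !scale1r.
- by move=> a v x; rewrite -[a *: v]addr0 sym_ann_antilinear sym_ann0 addr0.
Qed.

Definition sym_annP (x : Sym W) : Sym W -> Sym W := sym_annP_expr (repr x).

Lemma sym_annPE e : sym_annP (\pi_(Sym W) e) =1 sym_annP_expr e.
Proof. exact/sym_annP_cong/sym_reprK. Qed.

Lemma sym_annPM x y z : sym_annP (x * y) z = sym_annP x (sym_annP y z).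
Proof.
have [[e1 ->] [e2 ->]] := conj (sym_quotP x) (sym_quotP y).
by rewrite -sym_piM !sym_annPE.
Qed.

Lemma sym_annP_gen w : sym_annP (sym_gen w) =1 sym_ann w.
Proof. by move=> x; rewrite sym_annPE. Qed.

Lemma sym_annP1 x : sym_annP 1 x = x.
Proof. by rewrite -[1]scale1r -sym_piC sym_annPE /= rmorph1 scale1r. Qed.

(* <x|y> is the component of a(x) y in S^0 W; sym_ip_prod and
   sym_ip_prod_neq are the usual description on products of vectors. *)
Definition sym_ip (x y : Sym W) : R[i] := sym_eps (sym_annP x y).

Lemma sym_ip_linearr x : scalar (sym_ip x).
Proof.
by move=> a y z; rewrite /sym_ip /sym_annP !linearP.
Qed.

Lemma sym_ip_linearl y a x x' :
  sym_ip (a *: x + x') y = a^* * sym_ip x y + sym_ip x' y.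
Proof.
have [[e1 ->] [e2 ->]] := conj (sym_quotP x) (sym_quotP x').
rewrite -[a *: _]mulr_algl -sym_piC -sym_piM -sym_piD /sym_ip !sym_annPE /=.
by rewrite linearP.
Qed.

Lemma sym_ann_prod v n (y : 'I_n.+1 -> W) :
  sym_ann v (\prod_(i < n.+1) sym_gen (y i)) =
  \sum_(k < n.+1) ip v (y k) *: \prod_(i < n) sym_gen (y (lift k i)).
Proof.
elim: n y => [|n IHn] y.
  by rewrite !big_ord1 big_ord0 sym_ann_gen.
rewrite big_ord_recl (sym_ann_is_derivation v).2 sym_ann_gen IHn.
rewrite [RHS]big_ord_recl mulr_algl; congr (_ + _).
rewrite mulr_sumr; apply: eq_bigr => k _.
rewrite -scalerAr big_ord_recl; congr (_ *: (sym_gen (y _) * _)).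
  exact/val_inj.
apply: eq_bigr => i _; congr (sym_gen (y _)); apply/val_inj.
by rewrite /= /bump !leq0n !add1n ltnS addnS.
Qed.

Lemma permanent_expand (T : comPzRingType) n (M : 'I_n.+1 -> 'I_n.+1 -> T) :
  \sum_(p : 'S_n.+1) \prod_j M j (p j) =
  \sum_k M ord0 k * \sum_(s : 'S_n) \prod_j M (lift ord0 j) (lift k (s j)).
Proof.
rewrite (partition_big (fun p : 'S_n.+1 => p ord0) xpredT) //=.
apply: eq_bigr => k _; rewrite mulr_sumr.
rewrite (reindex (lift_perm ord0 k)); last first.
  pose ulsf i (s : 'S_n.+1) j := odflt j (unlift (s i) (s (lift i j))).
  have ulsfK i (s : 'S_n.+1) j : lift (s i) (ulsf i s j) = s (lift i j).
    rewrite /ulsf; have := neq_lift i j.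
    by rewrite -(can_eq (permK s)) => /unlift_some[] ? ? ->.
  have inj_ulsf : injective (ulsf ord0 _).
    move=> s; apply: can_inj (ulsf (s ord0) s^-1%g) _ => j.
    by rewrite {1}/ulsf ulsfK !permK liftK.
  exists (fun s => perm (inj_ulsf s)) => [s _ | s].
    by apply/permP => j; rewrite permE /ulsf lift_perm_lift lift_perm_id liftK.
  move/(s _ =P _) => s0; apply/permP => j.
  case: (unliftP ord0 j) => [j'|] ->; rewrite ?lift_perm_id //.
  by rewrite lift_perm_lift -s0 permE ulsfK.
apply: eq_big => [s | s _]; first by rewrite lift_perm_id eqxx.
rewrite big_ord_recl lift_perm_id; congr (_ * _).
by apply: eq_bigr => j _; rewrite lift_perm_lift.
Qed.

Lemma sym_ip_prod n (x y : 'I_n -> W) :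
  sym_ip (\prod_(i < n) sym_gen (x i)) (\prod_(i < n) sym_gen (y i)) =
  \sum_(p : 'S_n) \prod_(j < n) ip (x j) (y (p j)).
Proof.
elim: n x y => [|n IHn] x y.
  rewrite /sym_ip !big_ord0 sym_annP1 rmorph1.
  rewrite (bigD1 (1%g : 'S_0)) //= big_ord0 big1 ?addr0 // => p.
  by case/eqP; apply/permP => -[].
rewrite (permanent_expand (fun i j => ip (x i) (y j))) /sym_ip.
rewrite [X in sym_annP X _]big_ord_recl mulrC sym_annPM sym_annP_gen.
rewrite sym_ann_prod /sym_annP !linear_sum /=; apply: eq_bigr => k _.
rewrite !linearZ /=; congr (_ * _).
exact: (IHn (fun i => x (lift ord0 i)) (fun i => y (lift k i))).
Qed.

Lemma sym_ip_prod_neq m n (x : 'I_m -> W) (y : 'I_n -> W) : m != n ->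
  sym_ip (\prod_(i < m) sym_gen (x i)) (\prod_(i < n) sym_gen (y i)) = 0.
Proof.
elim: m n x y => [|m IHm] [|n] x y //= mn.
- rewrite /sym_ip big_ord0 sym_annP1 big_ord_recl rmorphM.
  by rewrite [X in X * _]sym_eps_gen mul0r.
- rewrite /sym_ip big_ord0 big_ord_recl mulrC sym_annPM sym_annP_gen sym_ann1.
  by rewrite /sym_annP !linear0.
- rewrite /sym_ip big_ord_recl mulrC sym_annPM sym_annP_gen sym_ann_prod.
  rewrite /sym_annP !linear_sum /= big1 // => k _; rewrite !linearZ /=.
  rewrite -[RHS](mulr0 (ip (x ord0) (y k))); congr (_ * _).
  exact: (IHm n (fun i => x (lift ord0 i)) (fun i => y (lift k i))).
Qed.

(* (Phi (x) Psi)(sum_i a_i (x) b_i) = sum_i Phi(a_i) Psi(b_i) *)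
Definition tens_fun (Phi Psi : Sym W -> R[i]^o)
    (t : tensor (Sym W) (Sym W)) : R[i]^o :=
  \sum_(p <- repr t) Phi p.1 * Psi p.2.

Lemma tens_funE Phi Psi s : antilinear Phi -> antilinear Psi ->
  tens_fun Phi Psi (\pi_(tensor (Sym W) (Sym W)) s) =
  \sum_(p <- s) Phi p.1 * Psi p.2.
Proof.
move=> hPhi hPsi; apply: (inv_inj conjCK); rewrite !rmorph_sum /=.
have hPhi' a u v : Phi (a *: u + v) = a^* * Phi u + Phi v := hPhi a u v.
have hPsi' a u v : Psi (a *: u + v) = a^* * Psi u + Psi v := hPsi a u v.
have := tens_reprK s (f := fun a b => (Phi a * Psi b)^*); apply; split.
  by move=> a c u v; rewrite hPsi' mulrDr rmorphD mulrCA rmorphM /= conjCK.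
by move=> b c u v; rewrite hPhi' mulrDl rmorphD -mulrA rmorphM /= conjCK.
Qed.

Lemma tens_fun_pure Phi Psi a b : antilinear Phi -> antilinear Psi ->
  tens_fun Phi Psi (pure_tensor a b) = Phi a * Psi b.
Proof. by move=> hPhi hPsi; rewrite tens_funE // big_seq1. Qed.

(* The full antidual SW' is the set of all antilinear Phi : Sym W -> R[i]^o, with the product
   dual_mul, the unit dual_one and the powers dual_exp. *)
Definition dual_mul (Phi Psi : Sym W -> R[i]^o) : Sym W -> R[i]^o :=
  fun x => tens_fun Phi Psi (sym_coprod x).

Definition dual_one : Sym W -> R[i]^o := fun x => (sym_eps x)^*.

Definition dual_exp (Phi : Sym W -> R[i]^o) (n : nat) : Sym W -> R[i]^o :=
  iter n (dual_mul Phi) dual_one.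

Definition dual_cre (v : W) (Phi : Sym W -> R[i]^o) : Sym W -> R[i]^o :=
  fun x => Phi (sym_ann v x).
Definition dual_ann (v : W) (Phi : Sym W -> R[i]^o) : Sym W -> R[i]^o :=
  fun x => Phi (sym_cre v x).

Definition symmetric_map (Z : W -> W) : Prop :=
  forall x y, ip y (Z x) = ip x (Z y).

(* The functional zeta of Z: antilinear, zero on S^n W (which is spanned by the
   products of n vectors) for n != 2, and zeta (x y) = <y|Z x>. By quadraticP
   it exists when Z is antilinear and symmetric. *)
Definition is_quadratic (Z : W -> W) (zeta : Sym W -> R[i]^o) : Prop :=
  [/\ antilinear zeta,
      forall s : seq W, size s != 2 -> zeta (sym_prod s) = 0
    & forall x y : W, zeta (sym_gen x * sym_gen y) = ip y (Z x)].

Definition quadratic (Z : W -> W) : Sym W -> R[i]^o :=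
  xget (fun=> 0) [set zeta | is_quadratic Z zeta].

Section QuadraticExists.
Variable Z : W -> W.
Hypotheses (Zanti : antilinear Z) (Zsym : symmetric_map Z).

(* the components of degree 0 and 1, and the value of the quadratic form
   associated with Z on the component of degree 2 *)
Fixpoint quad_expr (e : sym_expr W) : R[i] * W * R[i] :=
  match e with
  | SGen w => (0, w, 0)
  | SConst a => (a, 0, 0)
  | SAdd e1 e2 => quad_expr e1 + quad_expr e2
  | SMul e1 e2 =>
      let: (a, u, b) := quad_expr e1 in let: (c, v, d) := quad_expr e2 in
      (a * c, a *: v + c *: u, a * d + c * b + ip (Z u) v)
  end.

Lemma quad_ipC u v : ip (Z u) v = ip (Z v) u.
Proof. by rewrite ip_conj Zsym -ip_conj. Qed.

Lemma quad_ipD u v w : ip (Z w) (u + v) = ip (Z w) u + ip (Z w) v.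
Proof. exact: linearD. Qed.

Lemma quad_ipZ a u v : ip (Z v) (a *: u) = a * ip (Z v) u.
Proof. exact: linearZ. Qed.

Lemma quad_ip0 u : ip (Z u) 0 = 0.
Proof. exact: linear0. Qed.

Lemma quad_cong e1 e2 : sym_cong e1 e2 -> quad_expr e1 = quad_expr e2.
Proof.
have D (a b c d : R[i]) (u v : W) :
  ((a, u, b) + (c, v, d) : R[i] * W * R[i]) = (a + c, u + v, b + d) by [].
have ip0 u : ip (Z 0) u = 0 by rewrite quad_ipC quad_ip0.
have ipD u v w : ip (Z (u + v)) w = ip (Z u) w + ip (Z v) w.
  by rewrite quad_ipC quad_ipD !(quad_ipC w).
have ipZ a u v : ip (Z (a *: u)) v = a * ip (Z u) v.
  by rewrite quad_ipC quad_ipZ (quad_ipC v).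
elim=> //=.
- by move=> ? ? ? _ -> _ ->.
- by move=> ? ? ? ? _ -> _ ->.
- by move=> ? ? ? ? _ -> _ ->.
- by move=> ? ? ?; rewrite addrA.
- by move=> ? ?; rewrite addrC.
- by move=> e; case: (quad_expr e) => [[a u] b]; rewrite D !add0r.
- move=> d1 d2 d3; case: (quad_expr d1) (quad_expr d2) (quad_expr d3)
    => [[a1 u1] b1] [[a2 u2] b2] [[a3 u3] b3] /=.
  rewrite !(quad_ipD, quad_ipZ, ipD, ipZ) !scalerDr !scalerA addrA.
  congr (_, _, _); [ring| |ring].
  by rewrite (mulrC a3 a1) (mulrC a3 a2) addrA.
- move=> d1 d2; case: (quad_expr d1) (quad_expr d2) => [[a u] b] [[c v] d] /=.
  by rewrite quad_ipC [X in (_, X, _)]addrC; congr (_, _, _); ring.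
- move=> e; case: (quad_expr e) => [[a u] b] /=.
  by rewrite ip0 scale1r scaler0 addr0; congr (_, _, _); ring.
- move=> e; case: (quad_expr e) => [[a u] b] /=.
  by rewrite ip0 scale0r scaler0 addr0; congr (_, _, _); ring.
- move=> d1 d2 d3; case: (quad_expr d1) (quad_expr d2) (quad_expr d3)
    => [[a1 u1] b1] [[a2 u2] b2] [[a3 u3] b3] /=.
  rewrite !D /= ipD scalerDl scalerDr addrACA.
  by congr (_, _, _); ring.
- by move=> a b; rewrite D !addr0.
- by move=> a b; rewrite ip0 !scaler0 !mulr0 !addr0.
- by move=> u v; rewrite D !addr0.
- by move=> a v; rewrite ip0 scaler0 addr0 !mulr0 !addr0.
Qed.

Lemma quadratic_exists : exists zeta, is_quadratic Z zeta.
Proof.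
pose q (x : Sym W) := quad_expr (repr x).
have qE e : q (\pi_(Sym W) e) = quad_expr e by apply/quad_cong/sym_reprK.
have qM w x : q (sym_gen w * x) =
    (0, (q x).1.1 *: w, ip (Z w) (q x).1.2).
  have [e ->] := sym_quotP x; rewrite -sym_piM !qE /=.
  case: (quad_expr e) => [[a u] b] /=.
  by rewrite !mul0r scale0r mulr0 !add0r.
have q1 : q 1 = (1, 0, 0) by rewrite -[1]scale1r -sym_piC qE.
exists (fun x => ((q x).2)^*); split.
- move=> a x y; have [[e ->] [d ->]] := conj (sym_quotP x) (sym_quotP y).
  rewrite -[a *: _]mulr_algl -sym_piC -sym_piM -sym_piD !qE /=.
  case: (quad_expr e) (quad_expr d) => [[a1 u1] b1] [[a2 u2] b2] /=.
  have -> : ip (Z 0) u1 = 0 by rewrite quad_ipC quad_ip0.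
  by rewrite mulr0 !addr0 rmorphD rmorphM.
- case=> [|x [|y [|z s]]] // _; rewrite /sym_prod ?big_cons ?big_nil.
  + by rewrite q1 rmorph0.
  + by rewrite qM q1 /= quad_ip0 rmorph0.
  + by rewrite !qM /= scale0r quad_ip0 rmorph0.
- move=> x y; rewrite qM -[sym_gen y]mulr1 qM q1 /= scale1r.
  by rewrite -ip_conj.
Qed.

Lemma quadraticP : is_quadratic Z (quadratic Z).
Proof.
have [z hz] := quadratic_exists; rewrite /quadratic.
by case: xgetP => [y _ //|/(_ z)].
Qed.

End QuadraticExists.

(* e^Z, the pointwise sum of zeta^k / k! *)
Definition gaussian (Z : W -> W) : Sym W -> R[i]^o := fun x =>
  limn (fun n => \sum_(0 <= k < n) (k`!%:R)^-1 * dual_exp (quadratic Z) k x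
        : R[i]^o).

Definition sym_norm (x : Sym W) : R := Num.sqrt (complex.Re (sym_ip x x)).

Definition fock_emb (x : Sym W) : Sym W -> R[i]^o := fun y => sym_ip y x.

(* Fock space, the completion of Sym W, as the space of bounded antilinear
   functionals; fock_emb is the inclusion of Sym W. *)
Definition fock_space : set (Sym W -> R[i]^o) :=
  [set Phi | antilinear Phi /\
     exists M : R, forall x, `|Phi x| <= (M * sym_norm x)%:C%C].

(* The norm of the completion is the norm of functionals, and its inner
   product is recovered from the norm by polarization. *)
Definition fock_norm (Phi : Sym W -> R[i]^o) : R :=
  sup [set complex.Re `|Phi x| | x in [set x | sym_norm x <= 1]].

Definition fock_ip (Phi Psi : Sym W -> R[i]^o) : R[i] :=
  4^-1 * \sum_(k < 4) (- 'i) ^+ k * ((fock_norm (Phi + 'i ^+ k *: Psi)) ^+ 2)%:C%C.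

Definition antiunitary (T : (Sym W -> R[i]^o) -> (Sym W -> R[i]^o)) : Prop :=
  [/\ forall Phi, fock_space Phi -> fock_space (T Phi),
      forall a Phi Psi, fock_space Phi -> fock_space Psi ->
        T (a *: Phi + Psi) = a^* *: T Phi + T Psi,
      forall Psi, fock_space Psi -> exists2 Phi, fock_space Phi & T Phi = Psi
    & forall Phi Psi, fock_space Phi -> fock_space Psi ->
        fock_ip (T Phi) (T Psi) = fock_ip Psi Phi].

Definition rescalable_to_antiunitary (U : Sym W -> (Sym W -> R[i]^o)) : Prop :=
  (forall x, fock_space (U x)) /\
  exists2 c : R[i], c != 0 &
    exists2 T, antiunitary T & forall x, T (fock_emb x) = c *: U x.

End Fock.

Section HilbertSchmidt.
Context {R : realType} {V : hilbertType R}.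

Definition orthonormal_basis (E : set V) : Prop :=
  [/\ forall e, E e -> ip e e = 1,
      forall e f, E e -> E f -> e != f -> ip e f = 0
    & forall v, (forall e, E e -> ip e v = 0) -> v = 0].

Definition hilbert_schmidt (T : V -> V) : Prop :=
  exists2 E, orthonormal_basis E &
    (\esum_(e in E) ((hnorm (T e)) ^+ 2)%:E < +oo)%E.

End HilbertSchmidt.

Section Metaplectic.
Context {R : realType} {V : hilbertType R}.

Definition antisymplectic (g : V -> V) : Prop :=
  [/\ forall (r : R) u v, g (r%:C%C *: u + v) = r%:C%C *: g u + g v,
      bijective g
    & forall u v, complex.Im (ip (g u) (g v)) = - complex.Im (ip u v)].

(* the inverse of f when f is bijective *)
Definition inverse (f : V -> V) : V -> V := 'pinv_(fun=> 0) [set: V] f.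

(* C_g = (g - J g J) / 2 and A_g = (g + J g J) / 2, J being multiplication
   by 'i *)
Definition lin_part (g : V -> V) (v : V) : V :=
  2^-1 *: (g v - 'i *: g ('i *: v)).
Definition antilin_part (g : V -> V) (v : V) : V :=
  2^-1 *: (g v + 'i *: g ('i *: v)).

Definition Z_of (g : V -> V) : V -> V := inverse (antilin_part g) \o lin_part g.

(* the value at p = (v, w) is Z(v_1) + Z(w_2) *)
Definition metaZ (g : V -> V) (p : V * V) : V * V :=
  let g' := inverse g in
  (Z_of g p.1, inverse (antilin_part g') p.1) +
  (inverse (antilin_part g) p.2, Z_of g' p.2).

Definition dsum1 (v : V) : V * V := (v, 0).
Definition dsum2 (v : V) : V * V := (0, v).

Lemma dsum1_is_linear : linear dsum1.
Proof. by move=> a u v; congr (_, _); rewrite /= scaler0 addr0. Qed.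
HB.instance Definition _ := GRing.isLinear.Build R[i] V (V * V)%type _
  dsum1 dsum1_is_linear.
Lemma dsum2_is_linear : linear dsum2.
Proof. by move=> a u v; congr (_, _); rewrite /= scaler0 addr0. Qed.
HB.instance Definition _ := GRing.isLinear.Build R[i] V (V * V)%type _
  dsum2 dsum2_is_linear.

Definition sym1 : Sym V -> Sym (V * V)%type := sym_lift (sym_gen \o dsum1).
Definition sym2 : Sym V -> Sym (V * V)%type := sym_lift (sym_gen \o dsum2).

Definition metaU (g : V -> V) : Sym V -> (Sym V -> R[i]^o) :=
  fun x y => gaussian (metaZ g) (sym1 x * sym2 y).

Definition weak_metaplectic (g : V -> V) (U : Sym V -> (Sym V -> R[i]^o)) : Prop :=
  let C := lin_part g in let A := antilin_part g in
  [/\ forall x, antilinear (U x), antilinear U,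
      exists x y, U x y != 0,
      forall v x, U (sym_cre v x) = dual_ann (C v) (U x) + dual_cre (A v) (U x)
    & forall v x, U (sym_ann v x) = dual_ann (A v) (U x) + dual_cre (C v) (U x)].

End Metaplectic.

(* Main.v *)
Require Import Defs.
From HB Require Import structures.
From mathcomp Require Import all_boot all_order all_algebra.
From mathcomp Require Import all_classical all_reals all_analysis.
From mathcomp Require Import complex ring lra.

Set Implicit Arguments.
Unset Strict Implicit.
Unset Printing Implicit Defensive.

Import Order.TTheory GRing.Theory Num.Theory.
Local Open Scope ring_scope.

(* The functional e^Z is the unique one with e^Z(1) = 1 and
   e^Z(wx) = e^Z(a(Zw)x). Write C, A for the two parts of g and C', A' for those
   of g^-1, so that C' = -C* and A' = A* (the antilinear adjoint). For the
   block Z of the theorem these rules become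
     U c(v) = U a(A^-1 C v) + c(A'^-1 v) U,
     a(v) U = U a(A^-1 v) + c(A'^-1 C' v) U,
   which by the relations C'C + A'A = 1 and C'A + A'C = 0 are equivalent to the
   weak metaplectic relations, and which determine U up to the scalar [U 1](1).
   If C is Hilbert-Schmidt then so are Z_g and Z_{g^-1}; having norm less than 1,
   they give Gaussians U_g 1 and U_{g^-1} 1 that remain bounded after the dilation
   t^N for some t > 1. All U_g x inherit this, so on them creators and annihilators
   are mutually adjoint, and the exchange rules yield <Ux|Uy> = k <y|x>. The
   transpose of U_g is U_{g^-1}: it provides the extension to Fock space and its
   surjectivity. Conversely, if a multiple of U_g is isometric then e^{Z_g} is
   bounded, and testing it on sum_e e.(Z_g e) for finite orthonormal families
   shows that Z_g, hence C = A Z_g, is Hilbert-Schmidt. *)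

(** * Pre-Hilbert spaces and bounded antilinear functionals *)

(** Elements of Fock space are functionals here, not limits of vectors. A statement about a bounded
    functional is therefore read off from vectors x of SV for which <.|x> is within e of it, and
    then e tends to 0; a variational form of Riesz' theorem supplies such x without completeness of
    SV. The obstacle is that creators and annihilators are unbounded on SV: in degree n they cost a
    factor of order sqrt n. A geometric factor s^n with s < 1 absorbs it, and this is what a spare
    dilation t > 1 pays for. The room for t comes from the strict contraction, because t^N turns e^Z
    into the Gaussian of t^2 Z. Continuity of C and A is not part of the hypotheses on g. In one
    direction C is bounded because it is Hilbert-Schmidt; in the other A is bounded because it has
    an everywhere defined adjoint, by a uniform boundedness argument. All relations are invariant
    under exchanging g with g^-1 and the two slots of the kernel, so each fact is proved for one
    slot and transposed. *)

Section ComplexModulus.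
Context {R : realType}.
Implicit Types (z w : R[i]).

Definition cabs z : R := complex.Re `|z|.

Lemma cabsE z : `|z| = (cabs z)%:C%C.
Proof. by rewrite /cabs normc_def. Qed.

Lemma cabs_le z (x : R) : (`|z| <= x%:C%C) = (cabs z <= x).
Proof. by rewrite cabsE lecR. Qed.

Lemma cabs_ge0 z : 0 <= cabs z.
Proof. by rewrite -lecR -cabsE; exact: normr_ge0. Qed.

Lemma cabs0 : cabs 0 = 0.
Proof. by rewrite /cabs normr0. Qed.

Lemma cabs1 : cabs 1 = 1.
Proof. by rewrite /cabs normr1. Qed.

Lemma cabsM z w : cabs (z * w) = cabs z * cabs w.
Proof. by apply: complexI; rewrite rmorphM /= -!cabsE normrM. Qed.

Lemma cabsD z w : cabs (z + w) <= cabs z + cabs w.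
Proof. by rewrite -lecR rmorphD /= -!cabsE ler_normD. Qed.

Lemma cabsN z : cabs (- z) = cabs z.
Proof. by rewrite /cabs normrN. Qed.

Lemma cabs_conj z : cabs z^* = cabs z.
Proof. by rewrite /cabs norm_conjC. Qed.

Lemma cabs_eq0 z : cabs z = 0 -> z = 0.
Proof. by move=> h; apply/eqP; rewrite -normr_eq0 cabsE h. Qed.

Lemma cabs_real (x : R) : cabs x%:C%C = `|x|.
Proof. by rewrite /cabs normc_def /= expr0n addr0 sqrtr_sqr. Qed.

Lemma mul_conj_cabs z : z * z^* = (cabs z ^+ 2)%:C%C.
Proof. by rewrite -normCK cabsE rmorphXn. Qed.

Lemma Re_le_cabs z : complex.Re z <= cabs z.
Proof.
by apply: le_trans (ler_norm _) _; rewrite -lecR -cabsE normc_ge_Re.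
Qed.

Lemma cabs_le_ReIm z : cabs z <= `|complex.Re z| + `|complex.Im z|.
Proof.
rewrite /cabs normc_def /= -(ler_pXn2r (n := 2)) ?nnegrE ?addr_ge0 ?sqrtr_ge0 //.
rewrite sqr_sqrtr ?addr_ge0 ?sqr_ge0 // sqrrD !real_normK ?num_real //.
by rewrite lerD2r lerDl mulrn_wge0 // mulr_ge0.
Qed.

Lemma Re_conjC z : complex.Re z^* = complex.Re z.
Proof. by case: z. Qed.

Lemma conj_realC (x : R) : (x%:C%C)^* = x%:C%C :> R[i].
Proof. exact: conjc_real. Qed.

Lemma Re_realM (x : R) z : complex.Re (x%:C%C * z) = x * complex.Re z.
Proof. by case: z => a b /=; rewrite mul0r subr0. Qed.

(** The constant k has no prescribed sign, so error terms can be collected without checking that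
    their sum is nonnegative. *)
Lemma le_eps (x y k : R) : (forall e, 0 < e -> x <= y + k * e) -> x <= y.
Proof.
move=> h; apply/ler_addgt0Pl => e e0.
have k1 : 0 < `|k| + 1 by rewrite ltr_wpDl.
have := h (e / (`|k| + 1)) (divr_gt0 e0 k1); move/le_trans; apply.
rewrite addrC lerD2r mulrA ler_pdivrMr // mulrC ler_pM2l //.
by have := ler_norm k; lra.
Qed.

Lemma ceq_eps z w (k : R) : (forall e, 0 < e -> cabs (z - w) <= k * e) -> z = w.
Proof.
move=> h; apply/eqP; rewrite -subr_eq0; apply/eqP/cabs_eq0/le_anti.
rewrite cabs_ge0 andbT; apply: (@le_eps _ _ k) => e e0; rewrite add0r; exact: h.
Qed.

Lemma Re_sum (I : Type) (s : seq I) (F : I -> R[i]) :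
  complex.Re (\sum_(i <- s) F i) = \sum_(i <- s) complex.Re (F i).
Proof.
by apply: (big_morph (@complex.Re R)) => // -[a b] [c d].
Qed.

Lemma sum_realC (I : Type) (s : seq I) (F : I -> R) :
  \sum_(i <- s) (F i)%:C%C = (\sum_(i <- s) F i)%:C%C :> R[i].
Proof. by rewrite -rmorph_sum. Qed.

End ComplexModulus.

Section PreHilbertTheory.
Context {R : realType} {H : preHilbertType R}.
Implicit Types (u v w : H) (a : R[i]).

Definition nsq v : R := complex.Re (ip v v).

Lemma ip_sqr v : ip v v = (nsq v)%:C%C.
Proof.
have := ip_ge0 v; rewrite lecE => /andP[/eqP h _].
by rewrite /nsq; move: h; case: (ip v v) => x y /= ->.
Qed.

Lemma nsq_ge0 v : 0 <= nsq v.
Proof. by have := ip_ge0 v; rewrite lecE => /andP[]. Qed.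

Lemma nsq_eq0 v : nsq v = 0 -> v = 0.
Proof. by move=> h; apply: ip_eq0; rewrite ip_sqr h. Qed.

Lemma ipDr u v w : ip u (v + w) = ip u v + ip u w.
Proof. exact: linearD. Qed.
Lemma ipZr a u v : ip u (a *: v) = a * ip u v.
Proof. exact: linearZ. Qed.
Lemma ip0r u : ip u 0 = 0.
Proof. exact: linear0. Qed.
Lemma ipNr u v : ip u (- v) = - ip u v.
Proof. exact: linearN. Qed.
Lemma ipBr u v w : ip u (v - w) = ip u v - ip u w.
Proof. exact: linearB. Qed.
Lemma ip_sumr (I : Type) (s : seq I) (F : I -> H) u :
  ip u (\sum_(i <- s) F i) = \sum_(i <- s) ip u (F i).
Proof. exact: linear_sum. Qed.
Lemma ipDl u v w : ip (u + v) w = ip u w + ip v w.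
Proof. by rewrite -[u]scale1r ip_linearl rmorph1 mul1r scale1r. Qed.
Lemma ip0l w : ip 0 w = 0.
Proof. by rewrite ip_conj ip0r rmorph0. Qed.
Lemma ipZl a u w : ip (a *: u) w = a^* * ip u w.
Proof. by rewrite -[a *: u]addr0 ip_linearl ip0l addr0. Qed.
Lemma ipNl u w : ip (- u) w = - ip u w.
Proof. by rewrite -scaleN1r ipZl rmorphN rmorph1 mulN1r. Qed.
Lemma ipBl u v w : ip (u - v) w = ip u w - ip v w.
Proof. by rewrite ipDl ipNl. Qed.
Lemma ip_suml (I : Type) (s : seq I) (F : I -> H) u :
  ip (\sum_(i <- s) F i) u = \sum_(i <- s) ip (F i) u.
Proof. by apply: (big_morph (ip^~ u)); [move=> *; exact: ipDl | exact: ip0l]. Qed.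

Lemma ip_eq u v : (forall w, ip w u = ip w v) -> u = v.
Proof.
move=> h; apply/eqP; rewrite -subr_eq0; apply/eqP/ip_eq0.
by rewrite ipBr h subrr.
Qed.

Lemma nsqD u v : nsq (u + v) = nsq u + nsq v + 2 * complex.Re (ip u v).
Proof.
rewrite /nsq ipDl !ipDr [ip v u]ip_conj.
by case: (ip u u) (ip v v) (ip u v) => a b [c d] [e f] /=; ring.
Qed.

Lemma nsqN v : nsq (- v) = nsq v.
Proof. by rewrite /nsq ipNl ipNr opprK. Qed.

Lemma nsqB u v : nsq (u - v) = nsq u + nsq v - 2 * complex.Re (ip u v).
Proof. by rewrite nsqD nsqN ipNr; case: (ip u v) => a b /=; ring. Qed.

Lemma nsqZ a v : nsq (a *: v) = cabs a ^+ 2 * nsq v.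
Proof.
by rewrite /nsq ipZl ipZr mulrA (mulrC _ a) mul_conj_cabs Re_realM.
Qed.

Lemma nsq0 : nsq 0 = 0. Proof. by rewrite /nsq ip0r. Qed.

Lemma parallelogram u v : nsq (u + v) + nsq (u - v) = 2 * (nsq u + nsq v).
Proof. by rewrite nsqD nsqB; ring. Qed.

Lemma hnorm_ge0 v : 0 <= hnorm v.
Proof. exact: sqrtr_ge0. Qed.

Lemma hnorm_sqr v : hnorm v ^+ 2 = nsq v.
Proof. exact/sqr_sqrtr/nsq_ge0. Qed.

Lemma hnorm_le v (x : R) : 0 <= x -> (hnorm v <= x) = (nsq v <= x ^+ 2).
Proof.
by move=> x0; rewrite -hnorm_sqr ler_pXn2r ?nnegrE ?hnorm_ge0.
Qed.

Lemma hnorm0 : hnorm (0 : H) = 0.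
Proof. by rewrite /hnorm ip0r sqrtr0. Qed.

Lemma hnorm_eq0 v : hnorm v = 0 -> v = 0.
Proof. by move=> h; apply: nsq_eq0; rewrite -hnorm_sqr h expr0n. Qed.

Lemma cauchy_schwarz_sqr u v : cabs (ip u v) ^+ 2 <= nsq u * nsq v.
Proof.
have [/nsq_eq0 ->|v0] := eqVneq (nsq v) 0.
  by rewrite ip0r cabs0 expr0n nsq0 mulr0.
have vp : 0 < nsq v by rewrite lt_def v0 nsq_ge0.
(* The vector is u minus its component along v; its squared norm is the defect in the inequality
   divided by |v|^2. *)
have := nsq_ge0 (u - ((nsq v)^-1%:C%C * ip v u) *: v).
rewrite nsqB nsqZ ipZr cabsM cabs_real ger0_norm ?invr_ge0 ?nsq_ge0 //.
rewrite -mulrA [ip u v]ip_conj cabs_conj mul_conj_cabs -rmorphM /= => h.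
rewrite mulrC -ler_pdivrMl //.
have e : ((nsq v)^-1 * cabs (ip v u)) ^+ 2 * nsq v =
  (nsq v)^-1 * cabs (ip v u) ^+ 2 by field.
by move: h; rewrite e; lra.
Qed.

Lemma cauchy_schwarz u v : cabs (ip u v) <= hnorm u * hnorm v.
Proof.
rewrite -(ler_pXn2r (n := 2)) ?nnegrE ?mulr_ge0 ?hnorm_ge0 ?cabs_ge0 //.
by rewrite exprMn !hnorm_sqr cauchy_schwarz_sqr.
Qed.

Lemma hnormD u v : hnorm (u + v) <= hnorm u + hnorm v.
Proof.
rewrite hnorm_le ?addr_ge0 ?hnorm_ge0 // sqrrD !hnorm_sqr nsqD.
have := le_trans (Re_le_cabs _) (cauchy_schwarz u v).
by rewrite -mulr_natl; lra.
Qed.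

Lemma hnormZ a v : hnorm (a *: v) = cabs a * hnorm v.
Proof.
apply/eqP; rewrite -(eqrXn2 (n := 2)) ?mulr_ge0 ?hnorm_ge0 ?cabs_ge0 //.
by rewrite exprMn !hnorm_sqr nsqZ.
Qed.

Lemma hnormN v : hnorm (- v) = hnorm v.
Proof. by rewrite /hnorm ipNl ipNr opprK. Qed.

Lemma hnormBC u v : hnorm (u - v) = hnorm (v - u).
Proof. by rewrite -hnormN opprB. Qed.

End PreHilbertTheory.

Section Antilinear.
Context {R : realType} {U V : lmodType R[i]} {f : U -> V}.
Hypothesis fA : antilinear f.

Lemma antilin0 : f 0 = 0.
Proof.
have := fA 1 0 0; rewrite rmorph1 !scale1r addr0 => h.
by apply: (addrI (f 0)); rewrite addr0 -h.
Qed.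

Lemma antilinD u v : f (u + v) = f u + f v.
Proof. by have := fA 1 u v; rewrite rmorph1 !scale1r. Qed.

Lemma antilinZ a u : f (a *: u) = a^* *: f u.
Proof. by have := fA a u 0; rewrite antilin0 !addr0. Qed.

Lemma antilinN u : f (- u) = - f u.
Proof. by rewrite -scaleN1r antilinZ rmorphN rmorph1 scaleN1r. Qed.

Lemma antilinB u v : f (u - v) = f u - f v.
Proof. by rewrite antilinD antilinN. Qed.

Lemma antilin_sum (I : Type) (s : seq I) (F : I -> U) :
  f (\sum_(i <- s) F i) = \sum_(i <- s) f (F i).
Proof. exact: (big_morph f antilinD antilin0). Qed.

End Antilinear.

Lemma scaleoE {R : realType} (a : R[i]) (z : R[i]^o) : a *: z = a * z.
Proof. by []. Qed.


(** * Finite orthonormal families and their projections *)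

Section Orthonormal.
Context {R : realType} {H : preHilbertType R}.
Implicit Types (u v w e : H) (f : seq H).

(** Each vector is required to be orthogonal only to the later ones, which fits induction on the
    list; conjugate symmetry gives the other half. *)
Fixpoint onseq f : Prop :=
  if f is e :: f' then
    [/\ ip e e = 1, forall x, x \in f' -> ip e x = 0 & onseq f']
  else True.

Definition oproj f v : H := \sum_(e <- f) ip e v *: e.

Lemma projE f a u v : oproj f (a *: u + v) = a *: oproj f u + oproj f v.
Proof.
rewrite /oproj scaler_sumr -big_split; apply: eq_bigr => e _ /=.
by rewrite ipDr ipZr scalerDl scalerA.
Qed.
HB.instance Definition _ f := GRing.isLinear.Build R[i] H H _ (oproj f) (projE f).

Lemma proj_selfadj f u v : ip u (oproj f v) = ip (oproj f u) v.
Proof.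
rewrite ip_sumr ip_suml; apply: eq_bigr => e _.
by rewrite ipZr ipZl mulrC [ip u e]ip_conj.
Qed.

Lemma orth_proj f u v : (forall x, x \in f -> ip u x = 0) -> ip u (oproj f v) = 0.
Proof.
by move=> h; rewrite ip_sumr big_seq big1 // => e ef; rewrite ipZr h ?mulr0.
Qed.

Lemma ip_proj f e v : onseq f -> e \in f -> ip e (oproj f v) = ip e v.
Proof.
elim: f => // e' f IH [e1 e0 onf] ; rewrite /oproj big_cons -/(oproj f v) ipDr ipZr.
rewrite in_cons => /orP[/eqP->|ef]; first by rewrite orth_proj // e1 mulr1 addr0.
by rewrite IH // [ip e e']ip_conj [ip e' e]e0 // rmorph0 mulr0 add0r.
Qed.

Lemma proj_idem f v : onseq f -> oproj f (oproj f v) = oproj f v.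
Proof. by move=> onf; apply: eq_big_seq => e ef; rewrite ip_proj. Qed.

Lemma nsq_proj f v : onseq f -> nsq (oproj f v) = \sum_(e <- f) cabs (ip e v) ^+ 2.
Proof.
move=> onf; rewrite /nsq -proj_selfadj proj_idem // ip_sumr Re_sum.
by apply: eq_bigr => e _; rewrite ipZr [ip v e]ip_conj mul_conj_cabs.
Qed.

Lemma nsq_sub_proj f v : onseq f -> nsq (v - oproj f v) = nsq v - nsq (oproj f v).
Proof.
move=> onf; rewrite nsqB.
have -> : complex.Re (ip v (oproj f v)) = nsq (oproj f v).
  by rewrite /nsq -proj_selfadj proj_idem.
by ring.
Qed.

Lemma proj_le f v : onseq f -> nsq (oproj f v) <= nsq v.
Proof. by move=> onf; rewrite -subr_ge0 -nsq_sub_proj // nsq_ge0. Qed.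

Lemma bessel f v : onseq f -> \sum_(e <- f) cabs (ip e v) ^+ 2 <= nsq v.
Proof. by move=> onf; rewrite -nsq_proj // proj_le. Qed.

(** Being fixed by [oproj f] expresses that the vectors of l lie in the span of f. A new vector w is
    replaced by its normalized defect w - Pw, and is skipped if the defect vanishes. *)
Lemma gram_schmidt (l : seq H) :
  exists f, onseq f /\ forall w, w \in l -> oproj f w = w.
Proof.
elim: l => [|w l [f [onf fl]]]; first by exists [::].
pose d := w - oproj f w.
have dorth x : x \in f -> ip d x = 0.
  by move=> xf; rewrite ip_conj ipBr ip_proj // subrr rmorph0.
have [d0|d0] := eqVneq d 0.
  exists f; split=> // v; rewrite in_cons => /orP[/eqP->|/fl//].
  by apply/esym/eqP; rewrite -subr_eq0 -/d d0.
have dn : hnorm d != 0 by apply: contra_neq d0; exact: hnorm_eq0.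
pose e := ((hnorm d)^-1)%:C%C *: d.
have dE : d = (hnorm d)%:C%C *: e by rewrite scalerA -rmorphM /= mulfV // scale1r.
have ee : ip e e = 1.
  rewrite ip_sqr nsqZ cabs_real -hnorm_sqr ger0_norm ?invr_ge0 ?hnorm_ge0 //.
  by rewrite -exprMn mulVf // expr1n.
have eorth x : x \in f -> ip e x = 0 by move=> xf; rewrite ipZl dorth ?mulr0.
exists (e :: f); split=> // v; rewrite in_cons /oproj big_cons -/(oproj f v).
have wE : w = d + oproj f w by rewrite subrK.
move=> /orP[/eqP->|vl].
  rewrite {1}wE ipDr orth_proj // addr0 {1}dE ipZr ee mulr1 -dE -wE.
  by [].
by rewrite -{1}(fl _ vl) orth_proj // scale0r add0r fl.
Qed.

End Orthonormal.

(* Take c = D / n, or c a large multiple of D when n = 0. *)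
Lemma quadratic_bound {R : realType} (n eta : R) (D : R[i]) : 0 <= n ->
  (forall c : R[i], - eta <= cabs c ^+ 2 * n - 2 * complex.Re (c^* * D)) ->
  cabs D ^+ 2 <= eta * n.
Proof.
move=> n0 h.
have hs (s : R) : - eta <= cabs D ^+ 2 * (s ^+ 2 * n - 2 * s).
  have := h (s%:C%C * D); rewrite cabsM cabs_real rmorphM /= conj_realC.
  by rewrite -mulrA [_^* * D]mulrC mul_conj_cabs Re_realM /= exprMn real_normK ?num_real; nra.
have [n_0|nn] := eqVneq n 0.
  have [->|D0] := eqVneq (cabs D) 0; first by rewrite n_0 mulr0 expr0n.
  have Dp : 0 < cabs D ^+ 2 by rewrite exprn_gt0 // lt_def D0 cabs_ge0.
  have := hs ((eta + 1) / (2 * cabs D ^+ 2)).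
  have -> : cabs D ^+ 2 * (((eta + 1) / (2 * cabs D ^+ 2)) ^+ 2 * n -
    2 * ((eta + 1) / (2 * cabs D ^+ 2))) = - (eta + 1) by rewrite n_0; field.
  lra.
have np : 0 < n by rewrite lt_def nn.
have := hs n^-1.
have -> : cabs D ^+ 2 * (n^-1 ^+ 2 * n - 2 * n^-1) = - (cabs D ^+ 2 / n) by field.
by rewrite lerN2 ler_pdivrMr.
Qed.

(** * Bounded antilinear functionals: Riesz approximation and inner product *)

Section BoundedFunctionals.
Context {R : realType} {H : preHilbertType R}.
Implicit Types (x y : H) (Phi Psi : H -> R[i]^o).

Definition bdd (M : R) Phi := forall x, cabs (Phi x) <= M * hnorm x.
(** The distance of Phi to <.|x> in the dual norm is at most e. Such x replace convergent sequences
    in the completion. *)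
Definition approx (e : R) x Phi := forall y, cabs (Phi y - ip y x) <= e * hnorm y.

(** An exact representing vector would minimize J x = |x|^2 - 2 Re Phi(x). Without completeness only
    a near minimizer exists, and the first variation of J shows that it represents Phi up to a small
    error. *)
Lemma riesz_approx Phi M e : antilinear Phi -> bdd M Phi -> 0 < e ->
  exists x, approx e x Phi.
Proof.
move=> PA PM e0; pose J x := nsq x - 2 * complex.Re (Phi x : R[i]).
have Jlb x : - M ^+ 2 <= J x.
  have := le_trans (Re_le_cabs (Phi x : R[i])) (PM x).
  rewrite /J -hnorm_sqr; have := sqr_ge0 (hnorm x - M); nra.
pose S : set R := [set J x | x in [set: H]]%classic.
have Sinf : has_inf S.
  split; first by exists (J 0); exists 0.
  by exists (- M ^+ 2) => _ [x _ <-].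
(* The tolerance is e^2 because [quadratic_bound] bounds the square of the error in Phi by the
   tolerance in J. *)
have [_ [x _ <-] Jx] := inf_adherent (exprn_gt0 2 e0) Sinf.
exists x => y.
have Jge z : J x - e ^+ 2 <= J z.
  by rewrite lerBlDr; apply/ltW/(lt_le_trans Jx); rewrite lerD2r; apply: ge_inf;
    [case: Sinf | exists z].
have : cabs (Phi y - ip y x) ^+ 2 <= e ^+ 2 * nsq y.
  apply: quadratic_bound; first exact: nsq_ge0.
  move=> c; have := Jge (x + c *: y).
  rewrite /J nsqD nsqZ (antilinD PA) (antilinZ PA) scaleoE.
  have -> : complex.Re (ip x (c *: y)) = complex.Re (c^* * ip y x).
    by rewrite ipZr [ip x y]ip_conj -Re_conjC rmorphM /= conjCK.
  rewrite mulrBr !raddfD /= raddfN /=; lra.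
rewrite -hnorm_sqr -exprMn ler_pXn2r ?nnegrE ?mulr_ge0 ?hnorm_ge0 ?cabs_ge0 //.
exact: ltW.
Qed.

(** Both approximations are tested on the vector x - y itself. *)
Lemma approx_dist Phi e d x y : 0 < e -> 0 < d -> approx e x Phi -> approx d y Phi ->
  hnorm (x - y) <= e + d.
Proof.
move=> e0 d0 ex dy; have [->|n0] := eqVneq (hnorm (x - y)) 0; first lra.
have np : 0 < hnorm (x - y) by rewrite lt_def n0 hnorm_ge0.
rewrite -(ler_pM2r np) -expr2 hnorm_sqr.
have := ex (x - y); have := dy (x - y) => h1 h2.
have -> : nsq (x - y) = complex.Re ((Phi (x - y) - ip (x - y) y) -
    (Phi (x - y) - ip (x - y) x)).
  by rewrite /nsq ipBr; congr complex.Re; ring.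
apply: le_trans (Re_le_cabs _) _; apply: le_trans (cabsD _ _) _.
by rewrite cabsN mulrDl addrC lerD.
Qed.

Lemma approx_norm Phi M e x : 0 <= M -> 0 <= e -> bdd M Phi -> approx e x Phi ->
  hnorm x <= M + e.
Proof.
move=> M0 e0 PM ex; have [->|n0] := eqVneq (hnorm x) 0; first lra.
have np : 0 < hnorm x by rewrite lt_def n0 hnorm_ge0.
rewrite -(ler_pM2r np) -expr2 hnorm_sqr.
have -> : nsq x = complex.Re (Phi x - (Phi x - ip x x)).
  by rewrite opprB addrCA subrr addr0.
apply: le_trans (Re_le_cabs _) _; apply: le_trans (cabsD _ _) _.
by rewrite cabsN mulrDl lerD.
Qed.

Lemma approx_bdd Phi e x : approx e x Phi -> bdd (hnorm x + e) Phi.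
Proof.
move=> ex y; rewrite -[Phi y](subrK (ip y x)); apply: le_trans (cabsD _ _) _.
by rewrite mulrDl addrC lerD // mulrC cauchy_schwarz.
Qed.

Lemma approx_ip x e : 0 <= e -> approx e x (fun y => ip y x).
Proof. by move=> e0 y; rewrite subrr cabs0 mulr_ge0 ?hnorm_ge0. Qed.

Lemma approxW Phi e d x : e <= d -> approx e x Phi -> approx d x Phi.
Proof. by move=> ed h y; apply: le_trans (h y) _; rewrite ler_wpM2r ?hnorm_ge0. Qed.

Lemma approxP Phi Psi a e d x y : approx e x Phi -> approx d y Psi ->
  approx (cabs a * e + d) (a *: x + y) (a *: Phi + Psi).
Proof.
move=> h1 h2 z; have -> : (a *: Phi + Psi) z - ip z (a *: x + y) =
   a * (Phi z - ip z x) + (Psi z - ip z y).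
  by rewrite ipDr ipZr fctE /= -[(a *: Phi) z]/(a * Phi z); ring.
apply: le_trans (cabsD _ _) _; rewrite cabsM mulrDl lerD // -mulrA.
by rewrite ler_wpM2l ?cabs_ge0.
Qed.

Lemma bddP Phi Psi a M N : bdd M Phi -> bdd N Psi ->
  bdd (cabs a * M + N) (a *: Phi + Psi).
Proof.
move=> h1 h2 z; apply: le_trans (cabsD _ _) _; rewrite cabsM mulrDl lerD // -mulrA.
by rewrite ler_wpM2l ?cabs_ge0.
Qed.

Lemma bdd_ip x : bdd (hnorm x) (fun y => ip y x).
Proof. by move=> y; rewrite mulrC cauchy_schwarz. Qed.

(* z is the limit of Psi(x) as <.|x> tends to Phi, that is <Phi|Psi> *)
Definition is_fip Phi Psi (z : R[i]) := exists K : R,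
  forall e x, 0 < e -> approx e x Phi -> cabs (z - Psi x) <= K * e.

Definition fip Phi Psi : R[i] := xget 0 [set z | is_fip Phi Psi z]%classic.

(** An e-approximant x confines the limit to the interval of radius M e around rho x. Any two such
    intervals meet by [approx_dist], so the supremum of their left ends lies in all of them; no
    sequence has to be chosen. *)
Lemma real_limit (Phi : H -> R[i]^o) (rho : H -> R) (M N : R) :
  antilinear Phi -> bdd N Phi ->
  (forall x y, rho x - rho y <= M * hnorm (x - y)) -> 0 <= M ->
  exists l, forall e x, 0 < e -> approx e x Phi -> `|l - rho x| <= M * e.
Proof.
move=> PA PN rhoM M0.
pose A : set R := [set r | exists e x, [/\ 0 < e, approx e x Phi & r = rho x - M * e]]%classic.
have lbd e x d y : 0 < e -> approx e x Phi -> 0 < d -> approx d y Phi ->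
    rho x - M * e <= rho y + M * d.
  move=> e0 ex d0 dy; have := rhoM x y; have := approx_dist e0 d0 ex dy.
  by move=> /(ler_wpM2l M0); lra.
have [x0 hx0] := riesz_approx PA PN ltr01.
have A0 : (A !=set0)%classic by exists (rho x0 - M * 1), 1, x0.
have Aub : has_ubound A.
  by exists (rho x0 + M * 1) => _ [e [x [e0 ex ->]]]; apply: lbd.
exists (sup A) => e x e0 ex; rewrite ler_norml; apply/andP; split.
  have : A (rho x - M * e) by exists e, x.
  by move=> /(ub_le_sup Aub); lra.
have : sup A <= rho x + M * e.
  by apply: ge_sup => // _ [d [y [d0 dy ->]]]; apply: lbd.
lra.
Qed.

(** Psi is Lipschitz, hence so are its real and imaginary parts, and [real_limit] applies to each.
    The imaginary part is treated as the real part of -i Psi. *)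
Lemma is_fip_ex Phi Psi M N : antilinear Phi -> antilinear Psi ->
  0 <= M -> bdd M Phi -> 0 <= N -> bdd N Psi -> exists z, is_fip Phi Psi z.
Proof.
move=> PA QA M0 PM N0 QN.
have QB x y : cabs (Psi x - Psi y) <= N * hnorm (x - y) by rewrite -(antilinB QA).
have [|a ha] := @real_limit Phi (fun x => complex.Re (Psi x : R[i])) N _ PA PM _ N0.
  move=> x y; apply: le_trans (QB x y); apply: le_trans (Re_le_cabs _).
  by rewrite raddfB.
have [|b hb] := @real_limit Phi (fun x => complex.Im (Psi x : R[i])) N _ PA PM _ N0.
  move=> x y; apply: le_trans (QB x y).
  have -> : complex.Im (Psi x : R[i]) - complex.Im (Psi y : R[i]) =
    complex.Re (- 'i * (Psi x - Psi y)).
    by rewrite -complexiE; case: (Psi x) (Psi y) => p q [r s] /=; ring.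
  apply: le_trans (Re_le_cabs _) _; rewrite cabsM cabsN.
  by rewrite /cabs -complexiE normc_def /= expr0n add0r expr1n sqrtr1 mul1r.
exists (Complex a b), (N + N) => e x e0 ex.
apply: le_trans (cabs_le_ReIm _) _.
have := ha _ _ e0 ex; have := hb _ _ e0 ex.
by case: (Psi x) => p q /=; rewrite mulrDl => h1 h2; apply: lerD.
Qed.

Lemma is_fip_uniq Phi Psi M (z w : R[i]) : antilinear Phi -> bdd M Phi ->
  is_fip Phi Psi z -> is_fip Phi Psi w -> z = w.
Proof.
move=> PA PM [K hz] [L hw]; apply: (@ceq_eps _ _ _ (K + L)) => e e0.
have [x hx] := riesz_approx PA PM e0.
have -> : z - w = (z - Psi x) - (w - Psi x) by ring.
apply: le_trans (cabsD _ _) _; rewrite cabsN mulrDl.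
by apply: lerD; [exact: hz | exact: hw].
Qed.

Definition bounded Phi := antilinear Phi /\ exists2 M, 0 <= M & bdd M Phi.

Lemma fipP Phi Psi : bounded Phi -> bounded Psi -> is_fip Phi Psi (fip Phi Psi).
Proof.
move=> [PA [M M0 PM]] [QA [N N0 QN]].
have [z hz] := is_fip_ex PA QA M0 PM N0 QN.
by rewrite /fip; case: xgetP => [y _ //|/(_ z)].
Qed.

Lemma fip_uniq Phi Psi (z : R[i]) : bounded Phi -> is_fip Phi Psi z -> fip Phi Psi = z.
Proof.
move=> [PA [M M0 PM]] hz; rewrite /fip; case: xgetP => [y _ hy|/(_ z) //].
exact: is_fip_uniq PM hy hz.
Qed.

Lemma bounded_approx Phi e : bounded Phi -> 0 < e -> exists x, approx e x Phi.
Proof. by move=> [PA [M M0 PM]]; apply: riesz_approx. Qed.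

Lemma bounded_ip x : bounded (fun y => ip y x).
Proof.
split; last by exists (hnorm x); [exact: hnorm_ge0 | exact: bdd_ip].
by move=> a u v; rewrite ipDl ipZl.
Qed.

Lemma boundedP a Phi Psi : bounded Phi -> bounded Psi -> bounded (a *: Phi + Psi).
Proof.
move=> [PA [M M0 PM]] [QA [N N0 QN]]; split; last first.
  exists (cabs a * M + N); last exact: bddP.
  by rewrite addr_ge0 // mulr_ge0 ?cabs_ge0.
move=> b u v; rewrite !fctE /= PA QA.
by rewrite !scaleoE; ring.
Qed.

Lemma fipl x Psi : bounded Psi -> fip (fun y => ip y x) Psi = Psi x.
Proof.
move=> hQ; have [K hK] := fipP (bounded_ip x) hQ.
apply: (@ceq_eps _ _ _ K) => e e0; apply: hK => //; exact/approx_ip/ltW.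
Qed.

Lemma fipPr a Phi Psi Psi' : bounded Phi -> bounded Psi -> bounded Psi' ->
  fip Phi (a *: Psi + Psi') = a * fip Phi Psi + fip Phi Psi'.
Proof.
move=> hP hQ hQ'; apply: fip_uniq => //.
have [[K hK] [K' hK']] := conj (fipP hP hQ) (fipP hP hQ').
exists (cabs a * K + K') => e x e0 ex.
have -> : a * fip Phi Psi + fip Phi Psi' - (a *: Psi + Psi') x =
    a * (fip Phi Psi - Psi x) + (fip Phi Psi' - Psi' x).
  by rewrite -[(a *: Psi + Psi') x]/(a * Psi x + Psi' x); ring.
apply: le_trans (cabsD _ _) _; rewrite cabsM mulrDl lerD ?hK' // -mulrA.
by rewrite ler_wpM2l ?cabs_ge0 ?hK.
Qed.

(** In the first slot the approximants change: if x and x' approximate the summands up to e, then a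
    x + x' approximates the combination up to (|a| + 1) e. *)
Lemma fipPl a Phi Phi' Psi : bounded Phi -> bounded Phi' -> bounded Psi ->
  fip (a *: Phi + Phi') Psi = a^* * fip Phi Psi + fip Phi' Psi.
Proof.
move=> hP hP' hQ.
have [[K hK] [K' hK']] := conj (fipP hP hQ) (fipP hP' hQ).
have [L hL] := fipP (boundedP a hP hP') hQ.
apply: (@ceq_eps _ _ _ (L * (cabs a + 1) + (cabs a * K + K'))) => e e0.
have [[x hx] [x' hx']] := conj (bounded_approx hP e0) (bounded_approx hP' e0).
have hxx := approxP a hx hx'.
have ce : 0 < cabs a * e + e by rewrite ltr_wpDl // mulr_ge0 ?cabs_ge0 // ltW.
have h1 := hL _ _ ce hxx.
have QA := hQ.1; move: h1; rewrite QA => h1.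
have -> : fip (a *: Phi + Phi') Psi - (a^* * fip Phi Psi + fip Phi' Psi) =
  (fip (a *: Phi + Phi') Psi - (a^* *: Psi x + Psi x')) -
  (a^* * (fip Phi Psi - Psi x) + (fip Phi' Psi - Psi x')).
  by rewrite /GRing.scale /=; ring.
apply: le_trans (cabsD _ _) _; rewrite cabsN.
apply: le_trans (lerD h1 (cabsD _ _)) _; rewrite cabsM cabs_conj.
have := hK _ _ e0 hx; have := hK' _ _ e0 hx' => h2.
by move=> /(ler_wpM2l (cabs_ge0 a)); nra.
Qed.

Lemma fip_le Phi Psi M N : bounded Phi -> bounded Psi -> 0 <= M -> 0 <= N ->
  bdd M Phi -> bdd N Psi -> cabs (fip Phi Psi) <= M * N.
Proof.
move=> hP hQ M0 N0 PM QN; have [K hK] := fipP hP hQ.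
apply: (@le_eps _ _ _ (K + N)) => e e0.
have [x hx] := bounded_approx hP e0.
rewrite -[fip _ _](subrK (Psi x : R[i])).
apply: le_trans (cabsD _ _) _.
have := hK _ _ e0 hx; have := QN x; have := approx_norm M0 (ltW e0) PM hx.
by move=> /(ler_wpM2l N0); nra.
Qed.

End BoundedFunctionals.

(** * The symmetric algebra and its inner product *)

Section SymGrading.
Context {K : fieldType} {W : lmodType K}.
Implicit Types (x y : Sym W) (w : W).

(** Only that S^n W is spanned by products of n vectors is recorded, with 0 belonging to every
    degree. Independence of the degrees comes later, as orthogonality in [sym_ip_homog]. *)
Inductive homog : nat -> Sym W -> Prop :=
  | homog_zero n : homog n 0
  | homog_const a : homog 0 a%:A
  | homog_gen n w x : homog n x -> homog n.+1 (sym_gen w * x)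
  | homog_add n x y : homog n x -> homog n y -> homog n (x + y).

Lemma homog_scale n a x : homog n x -> homog n (a *: x).
Proof.
elim=> {n x} [n|b|n w x _ IH|n x y _ IHx _ IHy].
- by rewrite scaler0; apply: homog_zero.
- by rewrite scalerA; apply: homog_const.
- by rewrite scalerAr; apply: homog_gen.
- by rewrite scalerDr; apply: homog_add.
Qed.

Lemma homog_mul m n x y : homog m x -> homog n y -> homog (m + n) (x * y).
Proof.
elim=> {m x} [m|b|m w x _ IH|m x z _ IHx _ IHz] hy.
- by rewrite mul0r; apply: homog_zero.
- by rewrite mulr_algl; apply: homog_scale.
- by rewrite -mulrA addSn; apply/homog_gen/IH.
- by rewrite mulrDl; apply: homog_add; [exact: IHx | exact: IHz].
Qed.

Lemma homog_one : homog 0 1.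
Proof. by rewrite -[1]scale1r; apply: homog_const. Qed.

Lemma homog_gen1 w : homog 1 (sym_gen w).
Proof. by rewrite -[sym_gen w]mulr1; apply/homog_gen/homog_one. Qed.

Lemma homog_sum (I : Type) (s : seq I) (F : I -> Sym W) n :
  (forall i, homog n (F i)) -> homog n (\sum_(i <- s) F i).
Proof.
by move=> h; apply: (big_ind (homog n)); [exact: homog_zero | exact: homog_add |].
Qed.

Lemma homog0 x : homog 0 x -> exists a, x = a%:A.
Proof.
move E : 0%N => n h; elim: h E => {n x} // [n|a|n x y _ IHx _ IHy] E.
- by exists 0; rewrite scale0r.
- by exists a.
- have [[a ->] [b ->]] := conj (IHx E) (IHy E).
  by exists (a + b); rewrite scalerDl.
Qed.

Definition graded n x :=
  exists X : nat -> Sym W, (forall i, homog i (X i)) /\ x = \sum_(i < n) X i.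

Lemma gradedW m n x : (m <= n)%N -> graded m x -> graded n x.
Proof.
move=> mn [X [hX ->]]; exists (fun i => if (i < m)%N then X i else 0); split.
  by move=> i; case: ifP => _; [exact: hX | exact: homog_zero].
by rewrite -big_mkcond /= (big_ord_widen _ X mn).
Qed.

Lemma graded_add m n x y : graded m x -> graded n y -> graded (maxn m n) (x + y).
Proof.
move=> /(gradedW (leq_maxl m n))[X [hX ->]] /(gradedW (leq_maxr m n))[Y [hY ->]].
exists (fun i => X i + Y i); split; last by rewrite big_split.
by move=> i; apply: homog_add.
Qed.

Lemma homog_graded n x : homog n x -> graded n.+1 x.
Proof.
move=> h; exists (fun i => if i == n then x else 0); split.
  by move=> i; case: eqP => [->|_] //; exact: homog_zero.
rewrite big_ord_recr /= eqxx big1 ?add0r // => i _.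
by rewrite ltn_eqF.
Qed.

Lemma graded_sum (I : Type) (s : seq I) (F : I -> Sym W) :
  (forall i, exists n, graded n (F i)) -> exists n, graded n (\sum_(i <- s) F i).
Proof.
move=> h; apply: (big_ind (fun x => exists n, graded n x)) => //.
  by exists 1%N; apply/homog_graded/homog_zero.
by move=> x y [m hm] [n hn]; exists (maxn m n); apply: graded_add.
Qed.

Lemma graded_ex x : exists n, graded n x.
Proof.
move: x; apply: Sym_ind => [w|a|x y [m hm] [n hn]|x y [m [X [hX ->]]] [n [Y [hY ->]]]].
- by exists 2%N; apply/homog_graded/homog_gen1.
- by exists 1%N; apply/homog_graded/homog_const.
- by exists (maxn m n); apply: graded_add.
- rewrite mulr_suml; apply: graded_sum => i; rewrite mulr_sumr.
  apply: graded_sum => j; exists (i + j).+1.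
  by apply/homog_graded/homog_mul.
Qed.

Lemma homog_ind_all (P : Sym W -> Prop) :
  (forall x y, P x -> P y -> P (x + y)) -> P 0 -> (forall n x, homog n x -> P x) ->
  forall x, P x.
Proof.
by move=> PD P0 Ph x; have [n [X [hX ->]]] := graded_ex x; apply: big_ind => // i _;
  apply: Ph (hX i).
Qed.

(** Multiplication by a single vector replaces general products, so that an induction step only
    needs the commutation relation of one creator. *)
Lemma sym_cre_ind (P : Sym W -> Prop) :
  (forall a, P a%:A) -> (forall x y, P x -> P y -> P (x + y)) ->
  (forall w x, P x -> P (sym_gen w * x)) -> forall x, P x.
Proof.
move=> Pc PD Pw; have P0 : P 0 by rewrite -(scale0r 1).
apply: homog_ind_all => // n x; elim=> // *; first exact: Pw.
exact: PD.
Qed.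

(** Rules such as E(wx) = E(a(Zw)x) pass to an element that is not a part of wx but has lower
    degree. Structural induction does not reach it; hence the hypothesis for all homogeneous y of
    degree at most n. *)
Lemma homog_strong_ind (P : nat -> Sym W -> Prop) :
  (forall n, P n 0) -> (forall a, P 0 a%:A) ->
  (forall n x y, P n x -> P n y -> P n (x + y)) ->
  (forall n w x, (forall m y, (m <= n)%N -> homog m y -> P m y) -> homog n x ->
    P n.+1 (sym_gen w * x)) ->
  forall n x, homog n x -> P n x.
Proof.
move=> P0 Pc PD Pw n; elim/ltn_ind: n => n IH x h.
elim: h IH => {n x} // [n w x hx _|n x y _ IHx _ IHy] IH.
  by apply: Pw => // m y mn; apply: IH.
by apply: PD; [exact: IHx | exact: IHy].
Qed.

End SymGrading.

(** * Second quantization of linear maps and dilations *)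

Section SymMap.
Context {K : fieldType}.

Definition sym_map {W W' : lmodType K} (f : {linear W -> W'}) : Sym W -> Sym W' :=
  sym_lift (sym_gen \o f).
HB.instance Definition _ (W W' : lmodType K) (f : {linear W -> W'}) :=
  GRing.LRMorphism.copy (sym_map f) (sym_lift (sym_gen \o f)).

Lemma sym_map_gen (W W' : lmodType K) (f : {linear W -> W'}) w :
  sym_map f (sym_gen w) = sym_gen (f w).
Proof. exact: sym_lift_gen. Qed.

Lemma sym_map_const (W W' : lmodType K) (f : {linear W -> W'}) a :
  sym_map f a%:A = a%:A.
Proof. by rewrite linearZ rmorph1. Qed.

Lemma homog_map (W W' : lmodType K) (f : {linear W -> W'}) n x :
  homog n x -> homog n (sym_map f x).
Proof.
elim=> {n x} [n|b|n w x _ IH|n x y _ IHx _ IHy].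
- by rewrite rmorph0; apply: homog_zero.
- by rewrite sym_map_const; apply: homog_const.
- by rewrite rmorphM /= sym_map_gen; apply: homog_gen.
- by rewrite rmorphD; apply: homog_add.
Qed.

(* Second quantization of the scalar t: multiplication by t^n in degree n. *)
Definition dil {W : lmodType K} (t : K) : Sym W -> Sym W := sym_map ( *:%R t).
HB.instance Definition _ (W : lmodType K) (t : K) :=
  GRing.LRMorphism.copy (@dil W t) (sym_map ( *:%R t : W -> W)).

Lemma dil_gen (W : lmodType K) t (w : W) x :
  dil t (sym_gen w * x) = t *: (sym_gen w * dil t x).
Proof. by rewrite rmorphM /= [dil t (sym_gen w)]sym_map_gen linearZ /= scalerAl. Qed.

Lemma dil_homog (W : lmodType K) t n (x : Sym W) : homog n x -> dil t x = t ^+ n *: x.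
Proof.
elim=> {n x} [n|b|n w x _ IH|n x y _ IHx _ IHy].
- by rewrite rmorph0 scaler0.
- by rewrite [LHS]sym_map_const scale1r.
- by rewrite dil_gen IH -scalerAr scalerA exprS.
- by rewrite rmorphD /= IHx IHy scalerDr.
Qed.

Lemma dilM (W : lmodType K) s t (x : Sym W) : dil s (dil t x) = dil (s * t) x.
Proof.
move: x; apply: homog_ind_all => [x y hx hy||n x h].
- by rewrite !rmorphD /= hx hy.
- by rewrite !rmorph0.
- by rewrite (dil_homog t h) linearZ /= (dil_homog s h) (dil_homog (s * t) h) scalerA mulrC exprMn.
Qed.

Lemma dil1 (W : lmodType K) (x : Sym W) : dil 1 x = x.
Proof.
move: x; apply: homog_ind_all => [x y hx hy||n x h].
- by rewrite rmorphD /= hx hy.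
- by rewrite rmorph0.
- by rewrite (dil_homog 1 h) expr1n scale1r.
Qed.

End SymMap.

(** * Positivity of the inner product and damped creators and annihilators *)

Section SymInnerProduct.
Context {R : realType} {W : preHilbertType R}.
Implicit Types (x y : Sym W) (u w : W) (f : seq W).

Lemma annM_gen u w x :
  sym_ann u (sym_gen w * x) = ip u w *: x + sym_gen w * sym_ann u x.
Proof. by rewrite /sym_ann sym_derM sym_der_gen mulr_algl. Qed.

Lemma sym_annM u x y : sym_ann u (x * y) = sym_ann u x * y + x * sym_ann u y.
Proof. exact: sym_derM. Qed.

Lemma ann_const u a : sym_ann u a%:A = 0.
Proof. exact: sym_der_const. Qed.

Lemma sym_annD u x y : sym_ann u (x + y) = sym_ann u x + sym_ann u y.
Proof. exact: linearD. Qed.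

Lemma sym_annZ u a x : sym_ann u (a *: x) = a *: sym_ann u x.
Proof. exact: linearZ. Qed.

Lemma sym_ann_0 u : sym_ann u 0 = 0.
Proof. exact: linear0. Qed.

Lemma sym_ann_sum u (I : Type) (s : seq I) (F : I -> Sym W) :
  sym_ann u (\sum_(i <- s) F i) = \sum_(i <- s) sym_ann u (F i).
Proof. exact: linear_sum. Qed.

Lemma homog0_ann u x : homog 0 x -> sym_ann u x = 0.
Proof. by case/homog0 => a ->; exact: ann_const. Qed.

Lemma homog_ann u n x : homog n x -> homog n.-1 (sym_ann u x).
Proof.
elim=> {n x} [n|b|n w x hx IH|n x y _ IHx _ IHy].
- by rewrite sym_ann_0; apply: homog_zero.
- by rewrite ann_const; apply: homog_zero.
- rewrite annM_gen /=; apply: homog_add; first exact: homog_scale.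
  case: n hx IH => [|n] hx IH; last exact: homog_gen.
  by rewrite homog0_ann // mulr0; apply: homog_zero.
- by rewrite sym_annD; apply: homog_add.
Qed.

(** The vector v stands for the adjoint of f applied to u, specified through its pairings only. This
    covers projections, dilations and the two inclusions of V in its double. *)
Lemma ann_map (W' : preHilbertType R) (f : {linear W -> W'}) (u : W') (v : W) x :
  (forall w, ip u (f w) = ip v w) ->
  sym_ann u (sym_map f x) = sym_map f (sym_ann v x).
Proof.
move=> h; move: x; apply: sym_cre_ind => [a|x y hx hy|w x hx].
- by rewrite sym_map_const /sym_ann !sym_der_const rmorph0.
- by rewrite /sym_ann in hx hy *; rewrite rmorphD /= !linearD /= hx hy.
- rewrite /sym_ann in hx *; rewrite rmorphM /= sym_map_gen !sym_derM !sym_der_gen.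
  by rewrite hx /= h !mulr_algl rmorphD /= linearZ /= rmorphM /= sym_map_gen.
Qed.

Lemma ann_dil u (t : R) x : sym_ann u (dil t%:C%C x) = t%:C%C *: dil t%:C%C (sym_ann u x).
Proof.
rewrite /dil (@ann_map _ _ _ (t%:C%C *: u)) => [|w]; last first.
  by rewrite ipZr ipZl conj_realC.
rewrite -linearZ; congr (sym_map _ _).
by rewrite -[_ *: u]addr0 sym_ann_antilinear sym_ann0 addr0 conj_realC.
Qed.

Lemma sym_ip_cre w x y : sym_ip (sym_gen w * x) y = sym_ip x (sym_ann w y).
Proof. by rewrite /sym_ip mulrC sym_annPM sym_annP_gen. Qed.

Lemma sym_ip_const a y : sym_ip a%:A y = a^* * sym_eps y.
Proof.
have -> : a%:A = a *: 1 + 0 :> Sym W by rewrite addr0.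
have -> : 0 = 0 *: (1 : Sym W) + 0 by rewrite addr0 scale0r.
rewrite !sym_ip_linearl rmorph0 mul0r add0r.
have -> : sym_ip 0 y = 0.
  have := sym_ip_linearl y 1 0 0; rewrite rmorph1 scale1r mul1r addr0 => h.
  by apply: (addrI (sym_ip 0 y)); rewrite addr0 -h.
by rewrite addr0 /sym_ip sym_annP1.
Qed.

Lemma sym_ipDl x x' y : sym_ip (x + x') y = sym_ip x y + sym_ip x' y.
Proof. by rewrite -[x]scale1r sym_ip_linearl rmorph1 mul1r scale1r. Qed.

Lemma sym_ipDr x y y' : sym_ip x (y + y') = sym_ip x y + sym_ip x y'.
Proof. by rewrite -[y]scale1r sym_ip_linearr mul1r scale1r. Qed.

Lemma sym_ip0r x : sym_ip x 0 = 0.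
Proof.
have := sym_ip_linearr x 1 0 0; rewrite /= scale1r mul1r addr0 => h.
by apply: (addrI (sym_ip x 0)); rewrite addr0 -h.
Qed.

Lemma sym_ipZr x a y : sym_ip x (a *: y) = a * sym_ip x y.
Proof. by rewrite -[a *: y]addr0 sym_ip_linearr sym_ip0r addr0. Qed.

Lemma sym_eps_const (a : R[i]) : sym_eps (a%:A : Sym W) = a.
Proof. by rewrite linearZ /= rmorph1; exact: mulr1. Qed.

(** Adjointness with the creator in the first slot is built into the definition of the inner
    product. In the second slot it follows by induction on x, both sides producing the same term
    <v|w><x|y> from the commutation relation. *)
Lemma sym_ip_ann w x y : sym_ip x (sym_gen w * y) = sym_ip (sym_ann w x) y.
Proof.
move: x y; apply: sym_cre_ind => [a|x x' hx hx'|v x hx] y.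
- rewrite sym_ip_const ann_const rmorphM /= sym_eps_gen mul0r mulr0.
  by rewrite -[0 in RHS](scale0r 1) sym_ip_const rmorph0 mul0r.
- by rewrite sym_annD !sym_ipDl hx hx'.
- rewrite sym_ip_cre !annM_gen sym_ipDr sym_ipZr hx sym_ip_linearl sym_ip_cre.
  by rewrite [ip v w]ip_conj.
Qed.

Lemma sym_ip_conj x y : sym_ip x y = (sym_ip y x)^*.
Proof.
move: x y; apply: sym_cre_ind => [a|x x' hx hx'|v x hx] y.
- rewrite sym_ip_const -[a%:A]/(a *: 1) sym_ipZr rmorphM /=; congr (_ * _).
  move: y; apply: sym_cre_ind => [b|y y' hy hy'|v y hy].
  + by rewrite sym_ip_const sym_eps_const rmorph1 mulr1 conjCK.
  + by rewrite rmorphD /= sym_ipDl rmorphD /= hy hy'.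
  + by rewrite sym_ip_cre sym_ann1 sym_ip0r rmorphM /= sym_eps_gen mul0r rmorph0.
- by rewrite sym_ipDl sym_ipDr hx hx' rmorphD.
- by rewrite sym_ip_cre sym_ip_ann hx.
Qed.

Lemma sym_ip_homog m n x y : homog m x -> homog n y -> m != n -> sym_ip x y = 0.
Proof.
move=> hx; elim: hx n y => {m x} [m|b|m w x _ IH|m x x' _ IH _ IH'] n y hy mn.
- by rewrite sym_ip_conj sym_ip0r rmorph0.
- rewrite sym_ip_const; suff -> : sym_eps y = 0 by rewrite mulr0.
  elim: hy mn => {n y} [n|c|n w y _ _|n y y' _ IH _ IH'] // nn.
  + by rewrite rmorph0.
  + by rewrite rmorphM /= sym_eps_gen mul0r.
  + by rewrite rmorphD /= IH // IH' // addr0.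
- rewrite sym_ip_cre; case: n hy mn => [|n] hy mn; first by rewrite homog0_ann // sym_ip0r.
  exact: IH (homog_ann _ hy) _.
- by rewrite sym_ipDl (IH n) // (IH' n) // addr0.
Qed.

(** An expression for x involves finitely many vectors, and a projection that fixes them fixes x.
    This reduces questions about one element to a finite-dimensional space. *)
Lemma sym_proj_ex x : exists l : seq W, forall f,
  (forall w, w \in l -> oproj f w = w) -> sym_map (oproj f) x = x.
Proof.
move: x; apply: Sym_ind => [w|a|x y [l hl] [l' hl']|x y [l hl] [l' hl']].
- by exists [:: w] => f h; rewrite sym_map_gen /= h ?inE.
- by exists [::] => f _; exact: sym_map_const.
- exists (l ++ l') => f h; rewrite rmorphD /= hl ?hl' // => w wl; apply: h;
    by rewrite mem_cat wl ?orbT.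
- exists (l ++ l') => f h; rewrite rmorphM /= hl ?hl' // => w wl; apply: h;
    by rewrite mem_cat wl ?orbT.
Qed.

Lemma sym_finite_support x : exists f, onseq f /\ sym_map (oproj f) x = x.
Proof.
have [l hl] := sym_proj_ex x; have [f [onf hf]] := gram_schmidt l.
by exists f; split=> //; apply: hl.
Qed.

(** This is Euler's identity for the finite sum of c(e)a(e): after projection onto the span of f,
    every vector in x is seen by the family. *)
Lemma number_operator f n x : onseq f -> homog n x ->
  \sum_(e <- f) sym_gen e * sym_ann e (sym_map (oproj f) x) =
  n%:R *: sym_map (oproj f) x.
Proof.
move=> onf; elim=> {n x} [n|b|n w x _ IH|n x y _ IHx _ IHy].
- by rewrite rmorph0 scaler0 big1 // => e _; rewrite sym_ann_0 mulr0.
- by rewrite scale0r big1 // => e _; rewrite sym_map_const ann_const mulr0.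
- rewrite rmorphM /= sym_map_gen; set P := oproj f.
  transitivity (\sum_(e <- f) (ip e (P w) *: sym_gen e) * sym_map P x +
     sym_gen (P w) * \sum_(e <- f) sym_gen e * sym_ann e (sym_map P x)).
    rewrite mulr_sumr -big_split; apply: eq_bigr => e _ /=.
    by rewrite annM_gen mulrDr -scalerAr scalerAl mulrCA.
  rewrite -mulr_suml IH -scalerAr.
  have -> : \sum_(e <- f) ip e (P w) *: sym_gen e = sym_gen (P w).
    under eq_bigr do rewrite -linearZ /=.
    by rewrite -linear_sum; congr (sym_gen _); exact: proj_idem.
  by rewrite -[X in X + _]scale1r -scalerDl nat1r.
- rewrite rmorphD /= scalerDr -IHx -IHy -big_split; apply: eq_bigr => e _ /=.
  by rewrite sym_annD mulrDr.
Qed.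

Lemma sym_ip_suml (I : Type) (s : seq I) (F : I -> Sym W) y :
  sym_ip (\sum_(i <- s) F i) y = \sum_(i <- s) sym_ip (F i) y.
Proof.
apply: (big_morph (sym_ip^~ y)) => [x x'|]; first exact: sym_ipDl.
by rewrite sym_ip_conj sym_ip0r rmorph0.
Qed.

Lemma sym_ip_sumr (I : Type) (s : seq I) (F : I -> Sym W) y :
  sym_ip y (\sum_(i <- s) F i) = \sum_(i <- s) sym_ip y (F i).
Proof.
by apply: (big_morph (sym_ip y)) => [x x'|]; [exact: sym_ipDr | exact: sym_ip0r].
Qed.

(* Induction on the degree n through n <x|x> = sum_e <a(e)x|a(e)x>. *)
Lemma sym_ip_homog_pos n x : homog n x ->
  0 <= sym_ip x x /\ (sym_ip x x = 0 -> x = 0).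
Proof.
elim: n x => [|n IH] x h.
  have [a ->] := homog0 h; rewrite sym_ip_const sym_eps_const.
  rewrite mulrC mul_conjC_ge0; split=> // /eqP; rewrite mul_conjC_eq0 => /eqP->.
  by rewrite scale0r.
have [f [onf hf]] := sym_finite_support x.
have := number_operator onf h; rewrite hf => hn.
have e1 : n.+1%:R * sym_ip x x = \sum_(e <- f) sym_ip (sym_ann e x) (sym_ann e x).
  rewrite -sym_ipZr -hn sym_ip_sumr.
  by apply: eq_bigr => e _; rewrite sym_ip_ann.
have pos e : 0 <= sym_ip (sym_ann e x) (sym_ann e x) by have [] := IH _ (homog_ann e h).
split=> [|x0].
  by rewrite -(pmulr_rge0 _ (ltr0Sn _ n)) e1 sumr_ge0.
have : n.+1%:R *: x = 0.
  rewrite -hn big_seq big1 // => e ef.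
  suff -> : sym_ann e x = 0 by rewrite mulr0.
  apply: (IH _ (homog_ann e h)).2; apply/eqP; move/eqP: e1.
  rewrite x0 mulr0 eq_sym psumr_eq0 // => /allP /(_ e ef) /=.
  by [].
by move/eqP; rewrite scaler_eq0 pnatr_eq0 => /eqP.
Qed.

(** The degrees enter through an injective d so that the lemma also serves for the terms of a
    Gaussian, which have degrees 0, 2, 4 and so on. *)
Lemma sym_ip_graded n (d : nat -> nat) (X : nat -> Sym W) : injective d ->
  (forall i, homog (d i) (X i)) ->
  sym_ip (\sum_(i < n) X i) (\sum_(i < n) X i) = \sum_(i < n) sym_ip (X i) (X i).
Proof.
move=> dI hX; rewrite sym_ip_suml; apply: eq_bigr => i _.
rewrite sym_ip_sumr (bigD1 i) //= big1 ?addr0 // => j ji.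
by apply: sym_ip_homog (hX i) (hX j) _; rewrite (inj_eq dI) eq_sym.
Qed.

Lemma sym_ip_ge0 x : 0 <= sym_ip x x.
Proof.
have [n [X [hX ->]]] := graded_ex x; rewrite (@sym_ip_graded n id) //.
by apply: sumr_ge0 => i _; have [] := sym_ip_homog_pos (hX i).
Qed.

Lemma sym_ip_eq0 x : sym_ip x x = 0 -> x = 0.
Proof.
have [n [X [hX ->]]] := graded_ex x; rewrite (@sym_ip_graded n id) // => /eqP.
rewrite psumr_eq0 => [/allP h|i _]; last by have [] := sym_ip_homog_pos (hX i).
rewrite big1 // => i _; have [_] := sym_ip_homog_pos (hX i); apply.
by apply/eqP/(h i); rewrite mem_index_enum.
Qed.

HB.instance Definition _ := Lmodule_isPreHilbert.Build R (Sym W)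
  sym_ip_linearr sym_ip_conj sym_ip_ge0 sym_ip_eq0.

Lemma ip_symE x y : ip x y = sym_ip x y. Proof. by []. Qed.

Lemma sym_normE x : sym_norm x = hnorm x. Proof. by []. Qed.

Lemma ip_cre w x y : ip (sym_gen w * x) y = ip x (sym_ann w y).
Proof. exact: sym_ip_cre. Qed.

Lemma ip_ann w x y : ip (sym_ann w x) y = ip x (sym_gen w * y).
Proof. exact/esym/sym_ip_ann. Qed.

(** The commutation relation a(u)c(u) = |u|^2 + c(u)a(u), paired with x. All later norm estimates
    rest on this identity. *)
Lemma nsq_cre u x : nsq (sym_gen u * x) = nsq u * nsq x + nsq (sym_ann u x).
Proof.
rewrite {1}/nsq ip_cre annM_gen ipDr ipZr -ip_ann ip_sqr (ip_sqr x).
by rewrite (ip_sqr (sym_ann u x)) -rmorphM -rmorphD.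
Qed.

Lemma nsq_one : nsq (1 : Sym W) = 1.
Proof.
rewrite /nsq ip_symE -[1]scale1r sym_ip_const.
by rewrite sym_eps_const rmorph1 mulr1.
Qed.

Lemma nsq_graded n (d : nat -> nat) (X : nat -> Sym W) : injective d ->
  (forall i, homog (d i) (X i)) ->
  nsq (\sum_(i < n) X i) = \sum_(i < n) nsq (X i).
Proof. by move=> dI hX; rewrite /nsq ip_symE (sym_ip_graded _ dI) // Re_sum. Qed.

Lemma dil_selfadj (t : R) x y : ip (dil t%:C%C x) y = ip x (dil t%:C%C y).
Proof.
move: x y; apply: sym_cre_ind => [a|x x' hx hx'|v x hx] y.
- rewrite [dil _ _]sym_map_const !ip_symE !sym_ip_const; congr (_ * _).
  move: y; apply: sym_cre_ind => [b|y y' hy hy'|v y hy].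
  + by rewrite [dil _ _]sym_map_const.
  + by rewrite !rmorphD /= hy hy'.
  + by rewrite dil_gen linearZ /= !rmorphM /= !sym_eps_gen !mul0r scaler0.
- by rewrite rmorphD /= !ipDl hx hx'.
- by rewrite dil_gen ipZl conj_realC ip_cre hx ip_cre ann_dil ipZr.
Qed.

Lemma dil_le (t : R) x : 0 <= t <= 1 -> nsq (dil t%:C%C x) <= nsq x.
Proof.
move=> /andP[t0 t1]; have [n [X [hX ->]]] := graded_ex x.
rewrite rmorph_sum /= (@nsq_graded n id (fun i => dil t%:C%C (X i))) => [||i]; [| by [] | exact: homog_map].
rewrite (@nsq_graded n id) //; apply: ler_sum => i _.
rewrite (dil_homog _ (hX i)) nsqZ -rmorphXn cabs_real normrX ger0_norm //.
by rewrite -exprM ler_piMl ?nsq_ge0 // exprn_ile1.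
Qed.

Lemma hnorm_dil_le (t : R) x : 0 <= t <= 1 -> hnorm (dil t%:C%C x) <= hnorm x.
Proof. by move=> h; rewrite hnorm_le ?hnorm_ge0 // hnorm_sqr dil_le. Qed.

Lemma graded_ann u n x : graded n.+1 x -> graded n (sym_ann u x).
Proof.
case=> X [hX ->]; exists (fun i => sym_ann u (X i.+1)); split.
  by move=> i; exact: (homog_ann u (hX i.+1)).
by rewrite sym_ann_sum big_ord_recl /= (homog0_ann _ (hX 0%N)) add0r.
Qed.

Lemma graded_dil t n x : graded n x -> graded n (dil t x).
Proof.
case=> X [hX ->]; exists (fun i => dil t (X i)); split=> [i|]; first exact: homog_map.
by rewrite rmorph_sum.
Qed.

(* With b^2 the right-hand side, |a(u)* s^N y| <= b |y| on degree < n implies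
   |s^N a(u)x|^2 = <x|a(u)* s^2N a(u)x> <= b |x| |s^N a(u)x| on degree <= n. *)
Lemma nsq_dil_ann u (s : R) x : 0 < s < 1 ->
  nsq (dil s%:C%C (sym_ann u x)) <= nsq u / (1 - s ^+ 2) * nsq x.
Proof.
move=> /andP[s0 s1]; have s2 : 0 < 1 - s ^+ 2 by nra.
set b := nsq u / _; have b0 : 0 <= b by rewrite divr_ge0 ?nsq_ge0 // ltW.
have bE : nsq u = b - s ^+ 2 * b by rewrite /b; field; rewrite lt0r_neq0.
have [n hn] := graded_ex x; elim: n x hn => [|n IH] x hn.
  by case: hn => X [_ ->]; rewrite big_ord0 sym_ann_0 rmorph0 !nsq0 mulr0.
pose y := dil s%:C%C (sym_ann u x); rewrite -/y.
have yE : nsq y = complex.Re (ip x (sym_gen u * dil s%:C%C y)).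
  by rewrite -ip_ann -dil_selfadj.
have hb : nsq (sym_gen u * dil s%:C%C y) <= b * nsq y.
  rewrite nsq_cre ann_dil nsqZ cabs_real real_normK ?num_real //.
  have h1 := IH y (graded_dil _ (graded_ann u hn)).
  have h2 : nsq (dil s%:C%C y) <= nsq y by apply: dil_le; rewrite !ltW.
  rewrite bE mulrBl; have := nsq_ge0 u; rewrite bE; nra.
have := cauchy_schwarz_sqr x (sym_gen u * dil s%:C%C y) => h.
have h1 : nsq y ^+ 2 <= nsq x * (b * nsq y).
  apply: le_trans (le_trans h (ler_wpM2l (nsq_ge0 x) hb)).
  by rewrite ler_pXn2r ?nnegrE ?nsq_ge0 ?cabs_ge0 // {1}yE Re_le_cabs.
have [->|y0] := eqVneq (nsq y) 0; first by rewrite mulr_ge0 ?nsq_ge0.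
have yp : 0 < nsq y by rewrite lt_def y0 nsq_ge0.
rewrite -(ler_pM2r yp) -expr2; apply: le_trans h1 _.
by rewrite le_eqVlt; apply/orP; left; apply/eqP; ring.
Qed.

Lemma hnorm_sqrt_le (H H' : preHilbertType R) (v : H) (v' : H') (b : R) : 0 <= b ->
  nsq v <= b * nsq v' -> hnorm v <= Num.sqrt b * hnorm v'.
Proof.
by move=> b0 h; rewrite hnorm_le ?mulr_ge0 ?hnorm_ge0 ?sqrtr_ge0 // exprMn sqr_sqrtr // hnorm_sqr.
Qed.

Lemma dil_cre_ann_bounded u (s : R) : 0 < s < 1 -> exists2 B : R, 0 <= B &
  forall x, hnorm (dil s%:C%C (sym_ann u x)) <= B * hnorm x /\
            hnorm (sym_gen u * dil s%:C%C x) <= B * hnorm x.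
Proof.
move=> hs; have /andP[s0 s1] := hs; have s2 : 0 < 1 - s ^+ 2 by nra.
(* b solves b = |u|^2 + s^2 b. The creator contributes |u|^2 and, through [nsq_cre], s^2 times the
   bound b of the damped annihilator, so one constant serves both. *)
set b := nsq u / (1 - s ^+ 2); have b0 : 0 <= b by rewrite divr_ge0 ?nsq_ge0 // ltW.
have bE : nsq u = b - s ^+ 2 * b by rewrite /b; field; rewrite lt0r_neq0.
exists (Num.sqrt b); first exact: sqrtr_ge0.
move=> x; split; apply: hnorm_sqrt_le => //; first exact: nsq_dil_ann.
rewrite nsq_cre ann_dil nsqZ cabs_real real_normK ?num_real //.
have h1 : _ <= b * nsq x := nsq_dil_ann u x hs.
have h2 : nsq (dil s%:C%C x) <= nsq x by apply: dil_le; rewrite !ltW.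
have k1 := ler_wpM2l (nsq_ge0 u) h2.
have k2 := ler_wpM2l (sqr_ge0 s) h1.
by move: k1 k2; rewrite bE; lra.
Qed.

End SymInnerProduct.

(** * The algebra of antilinear functionals *)

Section DualAlgebra.
Local Open Scope quotient_scope.
Context {R : realType} {W : preHilbertType R}.
Implicit Types (x y : Sym W) (u w : W) (Phi Psi : Sym W -> R[i]^o).

Lemma dual_ann_antilin w Phi : antilinear Phi -> antilinear (dual_ann w Phi).
Proof. by move=> PA a x y; rewrite /dual_ann /sym_cre mulrDr -scalerAr PA. Qed.

Lemma dual_cre_antilin w Phi : antilinear Phi -> antilinear (dual_cre w Phi).
Proof. by move=> PA a x y; rewrite /dual_cre sym_annD sym_annZ PA. Qed.

Lemma tens_fun_antilin Phi Psi : antilinear Phi -> antilinear Psi ->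
  antilinear (tens_fun Phi Psi).
Proof.
move=> PA QA a t t'; have [[s ->] [s' ->]] := conj (tens_quotP t) (tens_quotP t').
rewrite -[a *: _]/(tens_scale _ _) tens_scaleE -tens_piD !tens_funE //.
rewrite big_cat big_map /= scaler_sumr; congr (_ + _); apply: eq_bigr => p _ /=.
by rewrite (antilinZ PA) scaleoE -mulrA.
Qed.

Lemma dual_mul_antilin Phi Psi : antilinear Phi -> antilinear Psi ->
  antilinear (dual_mul Phi Psi).
Proof. by move=> PA QA a x y; rewrite /dual_mul linearP /= tens_fun_antilin. Qed.

Lemma dual_mul1 Phi Psi : antilinear Phi -> antilinear Psi ->
  dual_mul Phi Psi 1 = Phi 1 * Psi 1.
Proof. by move=> PA QA; rewrite /dual_mul rmorph1 tens_fun_pure. Qed.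

(** Since the coproduct of w is w (x) 1 + 1 (x) w, annihilators act as derivations of the product of
    functionals. *)
Lemma dual_mul_gen Phi Psi w x : antilinear Phi -> antilinear Psi ->
  dual_mul Phi Psi (sym_gen w * x) =
  dual_mul (dual_ann w Phi) Psi x + dual_mul Phi (dual_ann w Psi) x.
Proof.
move=> PA QA; rewrite /dual_mul rmorphM /= /sym_coprod sym_lift_gen /= mulrDl.
rewrite -/(sym_coprod _); have [s ->] := tens_quotP (sym_coprod x).
rewrite (antilinD (tens_fun_antilin PA QA)).
have mE (a b : seq (Sym W * Sym W)) : \pi_(tensor (Sym W) (Sym W)) a *
    \pi_(tensor (Sym W) (Sym W)) b = \pi_(tensor (Sym W) (Sym W)) (tens_seqmul a b).
  exact: tens_mulE.
rewrite /pure_tensor !mE !tens_funE //; try exact: dual_ann_antilin.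
rewrite !(big_seqmul (fun a b => Phi a * Psi b)) !big_seq1 /=.
by congr (_ + _); apply: eq_bigr => p _; rewrite mul1r.
Qed.

Lemma dual_mul_linl a Phi Phi' Psi x :
  dual_mul (a *: Phi + Phi') Psi x = a * dual_mul Phi Psi x + dual_mul Phi' Psi x.
Proof.
rewrite /dual_mul /tens_fun mulr_sumr -big_split; apply: eq_bigr => p _ /=.
by rewrite mulrA -mulrDl.
Qed.

Lemma dual_mul_linr a Phi Psi Psi' x :
  dual_mul Phi (a *: Psi + Psi') x = a * dual_mul Phi Psi x + dual_mul Phi Psi' x.
Proof.
rewrite /dual_mul /tens_fun mulr_sumr -big_split; apply: eq_bigr => p _ /=.
by rewrite mulrCA -mulrDr.
Qed.

Lemma dual_ann_cre u w Phi : antilinear Phi ->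
  dual_ann w (dual_cre u Phi) = (ip u w)^* *: Phi + dual_cre u (dual_ann w Phi).
Proof.
move=> PA; apply/funext => y.
by rewrite /dual_ann /dual_cre /sym_cre annM_gen PA.
Qed.

(** On functionals c(u) is multiplication by the functional of u, so this is a case of
    associativity. It is proved directly by induction on x, with both factors varying because
    annihilators act on them. *)
Lemma dual_mul_crel u Phi Psi x : antilinear Phi -> antilinear Psi ->
  dual_mul (dual_cre u Phi) Psi x = dual_mul Phi Psi (sym_ann u x).
Proof.
move: x Phi Psi; apply: sym_cre_ind => [a|x y hx hy|w x hx] Phi Psi PA QA.
- rewrite ann_const (antilin0 (dual_mul_antilin PA QA)).
  rewrite (antilinZ (dual_mul_antilin (dual_cre_antilin u PA) QA)) dual_mul1 //.
    by rewrite /dual_cre sym_ann1 (antilin0 PA) mul0r scaler0.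
  exact: dual_cre_antilin.
- rewrite sym_annD (antilinD (dual_mul_antilin PA QA)) -hx // -hy //.
  exact: (antilinD (dual_mul_antilin (dual_cre_antilin u PA) QA)).
- rewrite dual_mul_gen ?dual_ann_cre //; last exact: dual_cre_antilin.
  rewrite dual_mul_linl annM_gen (antilinD (dual_mul_antilin PA QA)).
  rewrite (antilinZ (dual_mul_antilin PA QA)) dual_mul_gen //.
  by rewrite -addrA !hx //; exact: dual_ann_antilin.
Qed.

Lemma dual_mulC Phi Psi x : antilinear Phi -> antilinear Psi ->
  dual_mul Phi Psi x = dual_mul Psi Phi x.
Proof.
move: x Phi Psi; apply: sym_cre_ind => [a|x y hx hy|w x hx] Phi Psi PA QA.
- rewrite (antilinZ (dual_mul_antilin PA QA)) (antilinZ (dual_mul_antilin QA PA)).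
  by rewrite !dual_mul1 // mulrC.
- rewrite (antilinD (dual_mul_antilin PA QA)) (antilinD (dual_mul_antilin QA PA)).
  by rewrite hx // hy.
- rewrite !dual_mul_gen // addrC.
  by congr (_ + _); apply: hx => //; exact: dual_ann_antilin.
Qed.

Lemma dual_mul_crer u Phi Psi x : antilinear Phi -> antilinear Psi ->
  dual_mul Phi (dual_cre u Psi) x = dual_mul Phi Psi (sym_ann u x).
Proof.
move=> PA QA; rewrite dual_mulC //; last exact: dual_cre_antilin.
by rewrite dual_mul_crel // dual_mulC.
Qed.

Lemma dual_one_antilin : antilinear (dual_one : Sym W -> R[i]^o).
Proof. by move=> a y z; rewrite /dual_one linearP rmorphD rmorphM. Qed.

Lemma dual_mul1l Psi x : antilinear Psi -> dual_mul dual_one Psi x = Psi x.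
Proof.
have oneA := dual_one_antilin.
move: x Psi; apply: sym_cre_ind => [a|x y hx hy|w x hx] Psi QA.
- rewrite (antilinZ (dual_mul_antilin oneA QA)) dual_mul1 // (antilinZ QA).
  by rewrite /dual_one !rmorph1 mul1r.
- by rewrite (antilinD (dual_mul_antilin oneA QA)) (antilinD QA) hx // hy.
- rewrite dual_mul_gen // [X in _ + X]hx; last exact: dual_ann_antilin.
  rewrite (_ : dual_mul _ _ _ = 0) ?add0r // /dual_mul /tens_fun big1 // => p _.
  by rewrite /dual_ann /dual_one /sym_cre rmorphM /= sym_eps_gen mul0r rmorph0 mul0r.
Qed.

End DualAlgebra.

(** * Gaussians *)

Section Gaussian.
Context {R : realType} {W : preHilbertType R}.
Implicit Types (x y : Sym W) (u w : W).

(* These rules determine e^Z. *)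
Definition is_gauss (Z : W -> W) (E : Sym W -> R[i]^o) :=
  [/\ antilinear E, E 1 = 1 &
      forall w x, E (sym_gen w * x) = E (sym_ann (Z w) x)].

Variable Z : W -> W.
Hypothesis Zsym : symmetric_map Z.
Let zeta := quadratic Z.
Let zetaP : is_quadratic Z zeta. Proof. exact: quadraticP. Qed.
Let zA : antilinear zeta. Proof. by case: zetaP. Qed.

(** The vanishing of zeta is given on products of vectors only. The factors of y are moved one by
    one into the list, which stays longer than two. *)
Lemma quadratic_ge3 y (s : seq W) : (2 < size s)%N -> zeta (sym_prod s * y) = 0.
Proof.
move: y s; apply: sym_cre_ind => [a|x y hx hy|w x hx] s hs.
- rewrite mulrC mulr_algl (antilinZ zA); case: zetaP => _ -> //; rewrite ?scaler0 //.
  by rewrite neq_ltn hs orbT.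
- by rewrite mulrDr (antilinD zA) hx // hy // addr0.
- rewrite mulrCA mulrA -[_ * sym_prod s]/(sym_gen w * sym_prod s).
  have -> : sym_gen w * sym_prod s = sym_prod (w :: s) by rewrite /sym_prod big_cons.
  by apply: hx; rewrite /= ltnW.
Qed.

(** The derivative of a quadratic form is linear: a(w) zeta is the functional of the vector Zw. It
    is written as a creator applied to the unit so that [dual_mul_crel] can move it out of a
    product. *)
Lemma quadratic_gen w : dual_ann w zeta = dual_cre (Z w) dual_one.
Proof.
case: zetaP => _ z0 z2; apply/funext; rewrite /dual_ann /dual_cre /sym_cre /dual_one.
apply: sym_cre_ind => [a|x y hx hy|v x _].
- rewrite ann_const linear0 rmorph0 mulrC mulr_algl (antilinZ zA).
  have := z0 [:: w]; rewrite /sym_prod big_seq1 => -> //; exact: scaler0.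
- by rewrite mulrDr (antilinD zA) hx hy sym_annD !rmorphD.
move: x; apply: sym_cre_ind => [a|x y hx hy|u x _].
- rewrite [sym_gen v * _]mulrC mulr_algl -scalerAr (antilinZ zA) z2.
  rewrite sym_annZ sym_ann_gen !linearZ /= rmorph1 scaleoE [ip v _]ip_conj.
  by rewrite /GRing.scale /= mulr1 rmorphM.
- by rewrite mulrDr [in LHS]mulrDr (antilinD zA) hx hy sym_annD !rmorphD.
- rewrite (_ : sym_gen w * _ = sym_prod [:: w; v; u] * x); last first.
    by rewrite /sym_prod !big_cons big_nil mulr1 !mulrA.
  rewrite quadratic_ge3 // (_ : sym_eps _ = 0) ?rmorph0 // annM_gen.
  by rewrite linearP /= !rmorphM /= !sym_eps_gen !mul0r addr0; exact: mulr0.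
Qed.

Let zk := dual_exp zeta.

Lemma dual_exp_antilin k : antilinear (zk k).
Proof.
elim: k => [|k IH]; [exact: dual_one_antilin | exact: dual_mul_antilin].
Qed.

Lemma dual_exp0_gen w x : zk 0 (sym_gen w * x) = 0.
Proof. by rewrite /zk /= /dual_one rmorphM /= sym_eps_gen mul0r rmorph0. Qed.

(** The power rule for the derivation a(w), whose value on zeta is multiplication by the functional
    of Zw. *)
Lemma dual_exp_gen k w x :
  zk k.+1 (sym_gen w * x) = k.+1%:R * zk k (sym_ann (Z w) x).
Proof.
elim: k x => [|k IH] x; have kA := dual_exp_antilin.
  rewrite -[LHS]/(dual_mul zeta (zk 0) _) dual_mul_gen // quadratic_gen.
  rewrite dual_mul_crel ?dual_mul1l //; try exact: (kA 0%N).
  rewrite [X in _ + X](_ : _ = 0) ?addr0 ?mul1r // /dual_mul /tens_fun big1 // => p _.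
  by rewrite /dual_ann /sym_cre dual_exp0_gen mulr0.
rewrite -[LHS]/(dual_mul zeta (zk k.+1) _) dual_mul_gen // quadratic_gen.
rewrite dual_mul_crel ?dual_mul1l //; try exact: (kA k.+1); try exact: (kA 0%N).
have -> : dual_ann w (zk k.+1) =
    k.+1%:R *: dual_cre (Z w) (zk k) + 0.
  by rewrite addr0; apply/funext => y; exact: IH.
rewrite dual_mul_linr [X in _ + (_ + X)](_ : _ = 0); last first.
  by rewrite /dual_mul /tens_fun big1 // => p _; rewrite mulr0.
rewrite dual_mul_crer //.
by rewrite addr0 -[in RHS]nat1r mulrDl mul1r.
Qed.

Lemma dual_exp_one k : zk k.+1 1 = 0.
Proof.
rewrite [LHS]dual_mul1 //; last exact: dual_exp_antilin.
case: zetaP => _ /(_ [::]) z0 _; move: z0; rewrite /sym_prod big_nil => -> //.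
by rewrite mul0r.
Qed.

(** zeta^k lives in degree 2k. Vanishing in degrees below k is weaker but already makes the
    exponential series finite at each x. *)
Lemma dual_exp_hom m x : homog m x -> forall k, (m < k)%N -> zk k x = 0.
Proof.
move: m x; apply: homog_strong_ind => [n|a|n x y hx hy|n w x IH hx] [//|k] nk.
- exact: (antilin0 (dual_exp_antilin _)).
- by rewrite (antilinZ (dual_exp_antilin _)) dual_exp_one scaler0.
- by rewrite (antilinD (dual_exp_antilin _)) hx // hy // addr0.
- rewrite dual_exp_gen (IH n.-1) ?mulr0 ?leq_pred //; first exact: homog_ann.
  exact: leq_ltn_trans (leq_pred n) _.
Qed.

Let psum n x : R[i]^o := \sum_(0 <= k < n) (k`!%:R)^-1 * zk k x.

Lemma gaussianE x : exists N, forall n, (N <= n)%N -> gaussian Z x = psum n x.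
Proof.
have [N [X [hX xE]]] := graded_ex x.
have pE n : (N <= n)%N -> psum n x = psum N x.
  move=> Nn; rewrite /psum (big_cat_nat (n := N)) //=.
  rewrite [X in _ + X](_ : _ = 0) ?addr0 // big_nat_cond big1 // => k /andP[/andP[Nk _] _].
  rewrite xE (antilin_sum (dual_exp_antilin k)) big1 ?mulr0 //.
  by move=> i _; apply: dual_exp_hom (hX i) _ (leq_trans (ltn_ord i) Nk).
exists N => n Nn; rewrite pE // /gaussian.
apply: lim_near_cst => //; 
by exists N => // k /= Nk; exact: pE.
Qed.

Lemma gaussianP : is_gauss Z (gaussian Z).
Proof.
have kA := dual_exp_antilin.
have pA n : antilinear (psum n).
  move=> a x y; rewrite /psum scaler_sumr -big_split; apply: eq_bigr => k _ /=.
  by rewrite kA mulrDr !scaleoE mulrCA.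
split.
- move=> a x y; have [[M hM] [N hN] [P hP]] :=
    And3 (gaussianE x) (gaussianE y) (gaussianE (a *: x + y)).
  rewrite (hM (M + N + P)%N) ?(hN (M + N + P)%N) ?(hP (M + N + P)%N) ?leq_addl //.
  + by rewrite pA.
  + by rewrite (addnC M) -addnA leq_addr.
  + by rewrite -addnA leq_addr.
- have [N hN] := gaussianE 1; rewrite (hN N.+1) // /psum big_nat_recl //.
  rewrite big1 ?addr0 => [|k _]; last by rewrite dual_exp_one mulr0.
  by rewrite /zk /= /dual_one !rmorph1 invr1 mulr1.
- move=> w x; have [[M hM] [N hN]] :=
    conj (gaussianE (sym_gen w * x)) (gaussianE (sym_ann (Z w) x)).
  (* The partial sum on wx is taken one term longer: its term k = 0 vanishes, and the term k + 1 on
     wx matches the term k on a(Zw)x. *)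
  rewrite (hM (M + N).+1) ?(hN (M + N)%N) ?leq_addl //; last first.
    by rewrite ltnW // ltnS leq_addr.
  rewrite /psum big_nat_recl // dual_exp0_gen mulr0 add0r; apply: eq_bigr => k _.
  rewrite dual_exp_gen mulrA; congr (_ * _).
  by rewrite factS natrM invfM mulrAC mulVf ?mul1r // pnatr_eq0.
Qed.

End Gaussian.

(** * Boundedness of a Gaussian *)

Section RatioSequence.
Context {R : realType}.
Variables (r h : R).

(** A majorant for the squared norms of the terms of a Gaussian. For r > 0 these are the Taylor
    coefficients of (1 - r x)^(-1 - h/(2r)), summed at x = 1 below. *)
Fixpoint ratio_seq (k : nat) : R :=
  if k is k'.+1 then (r + h / (2 * k'.+1%:R)) * ratio_seq k' else 1.

Hypotheses (r0 : 0 <= r) (r1 : r < 1) (h0 : 0 <= h).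

Lemma ratio_seq_ge0 k : 0 <= ratio_seq k.
Proof.
elim: k => //= k IH; rewrite mulr_ge0 // addr_ge0 // divr_ge0 // mulr_ge0 //.
Qed.

Lemma ratio_seq_sum_bounded :
  exists2 K, 0 <= K & forall n, \sum_(k < n) ratio_seq k <= K.
Proof.
(* From k0 on, h/(2(k+1)) is at most (1 - r)/2, so successive ratios are at most rho, the midpoint
   between r and 1. *)
pose k0 := Num.bound (h / (1 - r)); pose rho := (1 + r) / 2.
have rho1 : 0 < 1 - rho by move: r1; rewrite /rho; lra.
have step k : (k0 <= k)%N -> ratio_seq k.+1 <= rho * ratio_seq k.
  move=> hk; rewrite /= ler_wpM2r ?ratio_seq_ge0 //.
  suff hc : h / (2 * k.+1%:R) <= (1 - r) / 2.
    by rewrite -lerBrDl; apply: le_trans hc _; move: r1; rewrite /rho; lra.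
  have kp : 0 < k.+1%:R :> R by rewrite ltr0n.
  rewrite invfM mulrA ler_pdivrMr //.
  have hb : h / (1 - r) < k.+1%:R.
    apply: le_lt_trans (ler_norm _) _; apply: lt_trans (archi_boundP _) _.
      by rewrite normr_ge0.
    rewrite ltr_nat ltnS.
    by rewrite /k0 in hk; apply: leq_trans hk; rewrite ger0_norm // divr_ge0 // subr_ge0 ltW.
  move: hb; rewrite ltr_pdivrMr ?subr_gt0 // => hb.
  lra.
(* The partial sum plus a geometric bound for the whole tail; this quantity decreases from k0 on and
   so bounds all partial sums. *)
pose T n := \sum_(k < n) ratio_seq k + ratio_seq n / (1 - rho).
have Tdec n : (k0 <= n)%N -> T n.+1 <= T n.
  move=> hn; rewrite /T big_ord_recr /= -addrA lerD2l.
  have s1 : (1 - rho) * ratio_seq n <= ratio_seq n - ratio_seq n.+1.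
    by have := step _ hn; lra.
  rewrite -/(ratio_seq n.+1) -lerBrDr -mulrBl ler_pdivlMr // mulrC.
  by [].
have TK n : T (k0 + n)%N <= T k0.
  elim: n => [|n IH]; first by rewrite addn0.
  by rewrite addnS; apply: le_trans IH; apply: Tdec; rewrite leq_addr.
have mono m n : (m <= n)%N -> \sum_(k < m) ratio_seq k <= \sum_(k < n) ratio_seq k.
  move=> mn; rewrite -(subnKC mn) big_split_ord /= lerDl.
  by apply: sumr_ge0 => i _; exact: ratio_seq_ge0.
exists (T k0).
  rewrite addr_ge0 ?sumr_ge0 ?divr_ge0 ?ratio_seq_ge0 ?ltW // => i _.
  exact: ratio_seq_ge0.
move=> n; apply: le_trans (mono _ _ (leq_addl k0 n)) _.
apply: le_trans (TK n); rewrite /T lerDl divr_ge0 ?ratio_seq_ge0 //.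
exact: ltW.
Qed.

End RatioSequence.

Section GaussianBound.
Context {R : realType} {W : preHilbertType R}.
Variables (Z : W -> W) (r h : R).
Hypotheses (Zanti : antilinear Z) (Zsym : symmetric_map Z).
Hypotheses (r0 : 0 <= r) (r1 : r < 1) (Zr : forall x, nsq (Z x) <= r * nsq x).
Hypothesis Zh : forall f : seq W, onseq f -> \sum_(e <- f) nsq (Z e) <= h.

Lemma gauss_h_ge0 : 0 <= h.
Proof. by have := @Zh [::] I; rewrite big_nil. Qed.

Lemma oproj_in (f : seq W) e : onseq f -> e \in f -> oproj f e = e.
Proof.
elim: f => // e' f IH [e1 e0 onf]; rewrite inE /oproj big_cons -/(oproj f e).
case/orP=> [/eqP->|ef]; last by rewrite e0 // scale0r add0r IH.
rewrite e1 scale1r /oproj big_seq big1 ?addr0 // => x xf.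
by rewrite ip_conj e0 // rmorph0 scale0r.
Qed.

(* With P a finite-rank projection and Y = PZP, the restriction of e^Z to the
   range of P is represented by exp q, where q is the element of degree 2 with
   a(w)q = Yw. The squared norms p_k of q^k/k! satisfy
     2k p_k = sum_(1 <= i <= k) |Y^i|_HS^2 p_(k-i) <= h sum_i r^(i-1) p_(k-i),
   so sum_k p_k is bounded independently of P. *)
Section FiniteRank.
Variable f : seq W.
Hypothesis onf : onseq f.
Let P := oproj f.
Let Y w := P (Z (P w)).

Let PP w : P (P w) = P w. Proof. exact: proj_idem. Qed.

Lemma compress_antilin : antilinear Y.
Proof. by move=> a u v; rewrite /Y /P linearP Zanti linearP. Qed.

Lemma compress_sym u v : ip u (Y v) = ip v (Y u).
Proof. by rewrite /Y /P !proj_selfadj Zsym. Qed.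

Lemma compress_le w : nsq (Y w) <= r * nsq w.
Proof.
apply: le_trans (proj_le _ onf) _; apply: le_trans (Zr _) _.
by rewrite ler_wpM2l // proj_le.
Qed.

Definition gauss_quad : Sym W :=
  2^-1 *: \sum_(e <- f) sym_gen e * sym_gen (Y e).

(** The derivation hits either factor of e.(Ye). One sum is Y applied to the expansion of Pw, the
    other is the expansion of Yw by symmetry of Y; they agree, whence the factor 1/2 in
    [gauss_quad]. *)
Lemma ann_gauss_quad w : sym_ann w gauss_quad = sym_gen (Y w).
Proof.
rewrite /gauss_quad sym_annZ sym_ann_sum.
have -> : \sum_(e <- f) sym_ann w (sym_gen e * sym_gen (Y e)) =
    \sum_(e <- f) ip w e *: sym_gen (Y e) + \sum_(e <- f) ip w (Y e) *: sym_gen e.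
  rewrite -big_split; apply: eq_bigr => e _ /=.
  by rewrite annM_gen sym_ann_gen mulrC mulr_algl.
have -> : \sum_(e <- f) ip w e *: sym_gen (Y e) = sym_gen (Y w).
  under eq_bigr do rewrite -linearZ /=.
  rewrite -linear_sum; congr (sym_gen _) => /=.
  rewrite -[Y w]/(P (Z (P w))) -[P w]PP -/(Y (P w)) /P /oproj.
  rewrite (antilin_sum compress_antilin); apply: eq_bigr => e _.
  by rewrite (antilinZ compress_antilin) -ip_conj.
have -> : \sum_(e <- f) ip w (Y e) *: sym_gen e = sym_gen (Y w).
  under eq_bigr do rewrite compress_sym -linearZ /=.
  by rewrite -linear_sum; congr (sym_gen _); exact: PP.
rewrite -[sym_gen _]scale1r -scalerDl scalerA -[1 + 1]/(2%:R : R[i]).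
by rewrite mulVf // pnatr_eq0.
Qed.

Definition gauss_term k : Sym W := (k`!%:R)^-1 *: gauss_quad ^+ k.

Lemma ann_gauss_term w k :
  sym_ann w (gauss_term k.+1) = sym_gen (Y w) * gauss_term k.
Proof.
have e n : sym_ann w (gauss_quad ^+ n.+1) =
    n.+1%:R *: (sym_gen (Y w) * gauss_quad ^+ n).
  elim: n => [|n IH]; first by rewrite expr1 expr0 mulr1 scale1r ann_gauss_quad.
  rewrite exprS sym_annM ann_gauss_quad IH -scalerAr mulrCA -exprS.
  by rewrite -[X in X + _]scale1r -scalerDl nat1r.
rewrite /gauss_term sym_annZ e scalerA -scalerAr; congr (_ *: _).
by rewrite factS natrM invfM mulrAC mulVf ?mul1r // pnatr_eq0.
Qed.

Lemma gauss_term0 : gauss_term 0 = 1.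
Proof. by rewrite /gauss_term expr0 fact0 invr1 scale1r. Qed.

Lemma gauss_term_homog k : homog k.*2 (gauss_term k).
Proof.
apply: homog_scale; elim: k => [|k IH]; first exact: homog_one.
rewrite exprS doubleS -addn2 addnC; apply: homog_mul => //.
by apply/homog_scale/homog_sum => e; apply/homog_gen/homog_gen1.
Qed.

Let p k := nsq (gauss_term k).
Let G i k := \sum_(e <- f) nsq (sym_gen (iter i Y e) * gauss_term k).

(** The number operator on a term of degree 2(k+1), paired with that term: each a(e) turns the term
    of index k+1 into Ye times the term of index k. *)
Lemma gauss_term_number k : 2 * k.+1%:R * p k.+1 = G 1 k.
Proof.
have e : \sum_(e <- f) sym_gen e * sym_ann e (gauss_term k.+1) =
    (2 * k.+1%:R) *: gauss_term k.+1.
  under eq_bigr do rewrite ann_gauss_term mulrA.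
  rewrite -mulr_suml.
  have -> : \sum_(e <- f) sym_gen e * sym_gen (Y e) = 2 *: gauss_quad.
    by rewrite scalerA mulfV ?scale1r // pnatr_eq0.
  rewrite /gauss_term exprS -scalerAl -scalerAr !scalerA; congr (_ *: _).
  by rewrite factS natrM invfM -mulrA mulVKf ?pnatr_eq0.
have : ip (gauss_term k.+1) (\sum_(e <- f) sym_gen e * sym_ann e (gauss_term k.+1)) =
   \sum_(e <- f) ip (sym_ann e (gauss_term k.+1)) (sym_ann e (gauss_term k.+1)).
  by rewrite ip_sumr; apply: eq_bigr => x _; rewrite -ip_ann.
rewrite e ipZr ip_sqr => /(congr1 (@complex.Re R)).
rewrite Re_sum -[2 * _]/(2 * k.+1%:R : R[i]) -[2%:R * _ : R[i]]natrM.
rewrite -[X in X * _](rmorph_nat (real_complex R)) Re_realM /= natrM => ->.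
by apply: eq_bigr => x _; rewrite ann_gauss_term.
Qed.

Let hs i := \sum_(e <- f) nsq (iter i Y e).

(** One factor Y is spent on the Hilbert-Schmidt bound h; each of the others contributes the
    operator bound r. *)
Lemma compress_hs i : hs i.+1 <= h * r ^+ i.
Proof.
elim: i => [|i IH].
  rewrite expr0 mulr1; apply: le_trans (Zh onf); rewrite /hs !big_seq.
  apply: ler_sum => e ef; rewrite /= /Y {2}/P oproj_in //; exact: proj_le.
apply: (@le_trans _ _ (r * hs i.+1)).
  by rewrite mulr_sumr; apply: ler_sum => e _; exact: compress_le.
by rewrite exprS mulrCA ler_wpM2l.
Qed.

Lemma gauss_G0 i : G i 0 = hs i.
Proof.
apply: eq_bigr => e _.
by rewrite gauss_term0 nsq_cre sym_ann1 nsq0 addr0 nsq_one mulr1.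
Qed.

(** By [nsq_cre]; the annihilator term trades one index of the Gaussian term for one more power of
    Y. Iteration expresses G 1 k through the p_j. *)
Lemma gauss_GS i k : G i k.+1 = hs i * p k.+1 + G i.+1 k.
Proof.
rewrite mulr_suml -big_split; apply: eq_bigr => e _ /=.
by rewrite nsq_cre ann_gauss_term.
Qed.

(** Horner form of the sum of r^(k-j) p_j over j <= k; the initial value is p_0 = 1. *)
Fixpoint gauss_S k : R := if k is k'.+1 then p k + r * gauss_S k' else 1.

Lemma gauss_S_ge0 k : 0 <= gauss_S k.
Proof. by elim: k => //= k IH; rewrite addr_ge0 ?nsq_ge0 // mulr_ge0. Qed.

Lemma gauss_G_le i k : G i.+1 k <= h * r ^+ i * gauss_S k.
Proof.
elim: k i => [|k IH] i; first by rewrite gauss_G0 mulr1 compress_hs.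
rewrite gauss_GS mulrDr lerD //.
  by rewrite ler_wpM2r ?nsq_ge0 ?compress_hs.
by apply: le_trans (IH _) _; rewrite exprSr !mulrA.
Qed.

(** From S_(k+1) = p_(k+1) + r S_k and p_(k+1) <= h/(2(k+1)) S_k, which is the recursion defining
    [ratio_seq]. *)
Lemma gauss_S_le k : gauss_S k <= ratio_seq r h k.
Proof.
elim: k => //= k IH; have kp : 0 < 2 * k.+1%:R :> R by rewrite mulr_gt0 ?ltr0n.
have : p k.+1 <= h / (2 * k.+1%:R) * gauss_S k.
  rewrite mulrAC ler_pdivlMr // mulrC gauss_term_number.
  by apply: le_trans (gauss_G_le 0 k) _; rewrite expr0 mulr1.
have c0 : 0 <= h / (2 * k.+1%:R) by rewrite divr_ge0 ?gauss_h_ge0 // ltW.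
have := ler_wpM2l c0 IH; have := ler_wpM2l r0 IH; rewrite mulrDl; lra.
Qed.

Lemma gauss_term_le k : p k <= ratio_seq r h k.
Proof.
apply: le_trans (gauss_S_le k); case: k => [|k] /=.
  by rewrite /p gauss_term0 nsq_one.
by rewrite lerDl mulr_ge0 ?gauss_S_ge0.
Qed.

Definition gauss_sum n : Sym W := \sum_(k < n.+1) gauss_term k.

Lemma ann_gauss_sum w n :
  sym_ann w (gauss_sum n.+1) = sym_gen (Y w) * gauss_sum n.
Proof.
rewrite /gauss_sum sym_ann_sum big_ord_recl /= gauss_term0 sym_ann1 add0r mulr_sumr.
by apply: eq_bigr => i _; rewrite ann_gauss_term.
Qed.

Lemma nsq_gauss_sum n : nsq (gauss_sum n) <= \sum_(k < n.+1) ratio_seq r h k.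
Proof.
rewrite /gauss_sum (nsq_graded n.+1 (@double_inj)) => [|k]; last exact: gauss_term_homog.
by apply: ler_sum => k _; exact: gauss_term_le.
Qed.

Lemma ip_one_gauss_sum n : ip (1 : Sym W) (gauss_sum n) = 1.
Proof.
rewrite /gauss_sum ip_sumr big_ord_recl /= gauss_term0 big1 ?addr0 => [|i _].
  by rewrite ip_sqr nsq_one.
by apply: (sym_ip_homog (n := i.+1.*2)) homog_one _ _; first exact: gauss_term_homog.
Qed.

(** Both sides obey the same recursion: E by its exchange rule, the pairing because a(w) maps the
    truncated exponential to Yw times a shorter truncation. Each use costs one term of the
    truncation and lowers the degree, so n >= m suffices. *)
Lemma gauss_compress E m x : is_gauss Z E -> homog m x ->
  forall n, (m <= n)%N -> E (sym_map (oproj f) x) = ip (sym_map (oproj f) x) (gauss_sum n).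
Proof.
move=> [EA E1 EZ]; move: m x; apply: homog_strong_ind => [m|a|m x y hx hy|m w x IH hx] n mn.
- by rewrite rmorph0 (antilin0 EA) ip0l.
- by rewrite sym_map_const (antilinZ EA) E1 ipZl ip_one_gauss_sum.
- by rewrite rmorphD /= (antilinD EA) (hx n) // (hy n) // ipDl.
have annP u : sym_ann u (sym_map (oproj f) x) = sym_map (oproj f) (sym_ann (P u) x).
  by apply: ann_map => v; rewrite proj_selfadj.
case: n mn => // n mn.
rewrite rmorphM /= sym_map_gen EZ annP -/P -/(Y w) ip_cre ann_gauss_sum.
rewrite -ip_ann annP.
have -> : P (Y (P w)) = Y w by rewrite /Y !PP.
apply: IH (leq_pred m) (homog_ann _ hx) _ _.
exact: leq_trans (leq_pred m) _.
Qed.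

End FiniteRank.

(** The projection and the truncation depend on x, but the bound on the norm of the representing
    vector does not. *)
Lemma gauss_bounded E : is_gauss Z E -> exists2 M, 0 <= M & bdd M E.
Proof.
move=> gE; have [EA _ _] := gE.
have [K K0 hK] := ratio_seq_sum_bounded r0 r1 gauss_h_ge0.
exists (Num.sqrt K); first exact: sqrtr_ge0.
move=> x; have [f [onf xP]] := sym_finite_support x.
have [n [X [hX xE]]] := graded_ex x.
have -> : E x = ip x (gauss_sum f n).
  rewrite -xP {1 2}xE !rmorph_sum /= (antilin_sum EA) ip_suml; apply: eq_bigr => i _.
  by rewrite (gauss_compress onf gE (hX i) (ltnW (ltn_ord i))).
apply: le_trans (cauchy_schwarz _ _) _; rewrite mulrC ler_wpM2r ?hnorm_ge0 //.
rewrite hnorm_le ?sqrtr_ge0 // sqr_sqrtr //.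
exact: le_trans (nsq_gauss_sum onf n) (hK _).
Qed.

End GaussianBound.

(** * Projections, orthonormal bases and bounded adjoints *)

Section HilbertProjection.
Context {R : realType} {V : hilbertType R}.
Implicit Types (u v s p : V).

Lemma small_inv (e : R) : 0 < e ->
  exists N, forall n, (N <= n)%N -> (n.+1%:R)^-1 < e :> R.
Proof.
move=> e0; exists (Num.bound e^-1) => n hn.
rewrite invf_plt ?posrE ?ltr0n //.
apply: lt_trans (archi_boundP _) _; first by rewrite invr_ge0 ltW.
by rewrite ltr_nat ltnS.
Qed.

Lemma orth_le v s (eta : R) : (forall c, nsq v - eta <= nsq (v - c *: s)) ->
  cabs (ip s v) ^+ 2 <= eta * nsq s.
Proof.
move=> h; apply: quadratic_bound (nsq_ge0 s) _ => c; have := h c.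
rewrite nsqB nsqZ.
have -> : complex.Re (ip v (c *: s)) = complex.Re (c^* * ip s v).
  by rewrite ipZr [ip v s]ip_conj -Re_conjC rmorphM /= conjCK.
lra.
Qed.

(** The subspace S is not assumed closed: p is in its closure, which is expressed by approximants.
    The parallelogram law makes a minimizing sequence Cauchy because midpoints stay in S. *)
Lemma hilbert_projection (S : V -> Prop) v : S 0 ->
  (forall a s t, S s -> S t -> S (a *: s + t)) ->
  exists p, (forall e : R, 0 < e -> exists2 s, S s & hnorm (s - p) < e) /\
            forall s, S s -> ip s (v - p) = 0.
Proof.
move=> S0 SP; pose D : set R := [set nsq (v - s) | s in S]%classic.
have Dinf : has_inf D.
  by split; [exists (nsq (v - 0)), 0 | exists 0 => _ [s _ <-]; exact: nsq_ge0].
pose d := inf D.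
have dle s : S s -> d <= nsq (v - s) by move=> Ss; apply: ge_inf; [case: Dinf | exists s].
have /choice[u hu] : forall n, exists s, S s /\ nsq (v - s) < d + (n.+1%:R)^-1.
  move=> n; have n0 : 0 < (n.+1%:R)^-1 :> R by rewrite invr_gt0.
  by have [_ [s Ss <-] h] := inf_adherent n0 Dinf; exists s.
have cauchy m n : nsq (u m - u n) <= 2 * ((m.+1%:R)^-1 + (n.+1%:R)^-1).
  have := parallelogram (v - u m) (v - u n).
  have -> : v - u m - (v - u n) = - (u m - u n) by rewrite !opprB addrC addrA subrK.
  have -> : v - u m + (v - u n) = 2 *: (v - (2^-1 *: u m + 2^-1 *: u n)).
    rewrite scalerBr scalerDr !scalerA mulfV ?pnatr_eq0 // !scale1r.
    by rewrite -[2]/(1 + 1) scalerDl scale1r addrACA opprD.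
  have Sm : S (2^-1 *: u m + 2^-1 *: u n).
    apply/SP; first by have [] := hu m.
    by rewrite -[_ *: _]addr0; apply/SP => //; have [] := hu n.
  have := dle _ Sm; have [_ h1] := hu m; have [_ h2] := hu n.
  rewrite nsqN nsqZ -[2]/(2%:R) -(rmorph_nat (real_complex R)) cabs_real normr_nat.
  move: h1 h2; move: (m.+1%:R^-1 : R) (n.+1%:R^-1 : R) (nsq (v - (_ + _))) => a b c.
  by rewrite expr2; lra.
have [|p hp] := hilbert_complete u.
  move=> e e0; have e4 : 0 < e ^+ 2 / 4 by rewrite divr_gt0 ?exprn_gt0.
  have [N hN] := small_inv e4; exists N => m n hm hn.
  have h := cauchy m n; have := hN _ hm; have := hN _ hn => h1 h2.
  rewrite -(ltr_pXn2r (n := 2)) ?nnegrE ?hnorm_ge0 ?ltW // hnorm_sqr.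
  apply: le_lt_trans h _; move: h1 h2.
  by move: (n.+1%:R^-1 : R) (m.+1%:R^-1 : R) => a b; lra.
exists p; split.
  move=> e e0; have [N hN] := hp e e0; exists (u N); last exact: hN.
  by have [] := hu N.
move=> s Ss; apply: (@ceq_eps _ _ _ (1 + hnorm s)) => e e0; rewrite subr0.
have [N hN] := hp e e0.
(* With a gap below this value, [orth_le] gives a pairing with s of modulus at most e; the 1 in the
   denominator covers s = 0. *)
have e1 : 0 < e ^+ 2 / (1 + nsq s) by rewrite divr_gt0 ?exprn_gt0 // ltr_wpDr ?nsq_ge0.
have [M hM] := small_inv e1.
pose n := maxn M N; have hn := hN n (leq_maxr _ _); have hm := hM n (leq_maxl _ _).
have -> : ip s (v - p) = ip s (v - u n) + ip s (u n - p) by rewrite -ipDr addrA subrK.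
apply: le_trans (cabsD _ _) _; rewrite mulrDl mul1r lerD //.
  rewrite -(ler_pXn2r (n := 2)) ?nnegrE ?cabs_ge0 ?(ltW e0) //.
  have : cabs (ip s (v - u n)) ^+ 2 <= (n.+1%:R)^-1 * nsq s.
    apply: orth_le => c; rewrite -addrA -opprD.
    have [Sn hun] := hu n.
    have : S (u n + c *: s) by rewrite addrC; apply: SP.
    by move: hun; move: (n.+1%:R^-1 : R) => a hun /dle; lra.
  move=> /le_trans; apply.
  have : (n.+1%:R)^-1 * (1 + nsq s) <= e ^+ 2.
    by rewrite -ler_pdivlMr ?ltW // ltr_wpDr ?nsq_ge0.
  have : 0 < (n.+1%:R)^-1 :> R by rewrite invr_gt0.
  by move: (n.+1%:R^-1 : R) => a; rewrite mulrDr; lra.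
apply: le_trans (cauchy_schwarz _ _) _; rewrite ler_wpM2l ?hnorm_ge0 //.
exact: ltW.
Qed.

End HilbertProjection.

(** * Orthonormal bases and finite sums for the Hilbert-Schmidt norm *)

Section OrthonormalBases.
Context {R : realType} {V : hilbertType R}.
Implicit Types (f : seq V) (E : set V).

Lemma onseq_basis E f : orthonormal_basis E -> uniq f ->
  (forall e, e \in f -> E e) -> onseq f.
Proof.
case=> E1 E0 _; elim: f => //= e f IH /andP[ef uf] h; split.
- by apply/E1/h/mem_head.
- move=> x xf; apply: E0; try by apply: h; rewrite inE ?eqxx ?xf ?orbT.
  by apply: contraNneq ef => ->.
- by apply: IH => // x xf; apply: h; rewrite inE xf orbT.
Qed.

(** The projection of v on the closed span of E is v, since the difference is orthogonal to E. Hence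
    some finite combination s of elements of E is close to v, and its elements form the required
    list. *)
Lemma parseval_approx E v (eta : R) : orthonormal_basis E -> 0 < eta ->
  exists f, [/\ uniq f, forall e, e \in f -> E e &
    nsq v <= \sum_(e <- f) cabs (ip e v) ^+ 2 + eta].
Proof.
move=> onb eta0; have [E1 E0 Emax] := onb.
pose S u := exists f, [/\ uniq f, forall e, e \in f -> E e & oproj f u = u].
have SE e : E e -> S e.
  move=> Ee; exists [:: e]; split=> // [x|]; first by rewrite inE => /eqP->.
  by rewrite /oproj big_seq1 E1 // scale1r.
have S0 : S 0 by exists [::]; split=> //; rewrite /oproj big_nil.
have SP a s t : S s -> S t -> S (a *: s + t).
  move=> [f [uf fE fs]] [f' [uf' fE' ft]].
  have uff : uniq (undup (f ++ f')) := undup_uniq _.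
  have ffE e : e \in undup (f ++ f') -> E e.
    by rewrite mem_undup mem_cat => /orP[/fE|/fE'].
  have sub g u : (forall e, e \in g -> e \in undup (f ++ f')) -> oproj g u = u ->
      oproj (undup (f ++ f')) u = u.
    move=> hg gu; have uE : u = \sum_(e <- g) ip e u *: e by rewrite -{1}gu.
    rewrite {1}uE linear_sum /= [RHS]uE big_seq [RHS]big_seq.
    apply: eq_bigr => e eg; rewrite linearZ /= oproj_in //; first exact: onseq_basis onb _ _.
    exact: hg.
  exists (undup (f ++ f')); split=> //.
  by rewrite linearP /= (sub f) 1?(sub f') // => e ef; rewrite mem_undup mem_cat ef ?orbT.
have [p [happ horth]] := hilbert_projection v S0 SP.
have pE : p = v.
  apply/esym/eqP; rewrite -subr_eq0; apply/eqP/Emax => e Ee.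
  exact/horth/SE.
have s0 : 0 < Num.sqrt eta by rewrite sqrtr_gt0.
have [s [f [uf fE fs]] hs] := happ _ s0; exists f; split=> //.
have onf : onseq f := onseq_basis onb uf fE.
rewrite -nsq_proj // -lerBlDl -nsq_sub_proj //.
(* As s is fixed by the projection, the defect of v is that of v - s, which is no longer than v -
   s. *)
have -> : v - oproj f v = (v - s) - oproj f (v - s).
  by rewrite linearB /= fs opprB addrA subrK.
rewrite nsq_sub_proj //; have := nsq_ge0 (oproj f (v - s)).
have : nsq (v - s) <= eta.
  rewrite -(sqr_sqrtr (ltW eta0)) -hnorm_le ?sqrtr_ge0 //.
  by rewrite hnormBC -pE ltW.
lra.
Qed.

Lemma orthonormal_basis_ex : exists E : set V, orthonormal_basis E.
Proof.
pose ons (E : set V) := (forall e, E e -> ip e e = 1) /\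
  (forall e e', E e -> E e' -> e != e' -> ip e e' = 0).
have [|E [[E1 E0] Emax]] := @Zorn_bigcup V ons.
  move=> F FP tot; split=> [e [X FX Xe]|e f [X FX Xe] [Y FY Yf] ef].
    by have [h _] := FP _ FX; apply: h.
  have [XY|YX] := tot X Y FX FY.
    by have [_ h] := FP _ FY; apply: h => //; apply: XY.
  by have [_ h] := FP _ FX; apply: h => //; apply: YX.
exists E; split=> // v hv; apply: contrapT => /eqP v0.
have vn : hnorm v != 0 by apply: contra_neq v0; exact: hnorm_eq0.
pose e := ((hnorm v)^-1)%:C%C *: v.
have ee : ip e e = 1.
  rewrite ip_sqr nsqZ cabs_real -hnorm_sqr ger0_norm ?invr_ge0 ?hnorm_ge0 //.
  by rewrite -exprMn mulVf // expr1n.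
have eE x : E x -> ip x e = 0 by move=> Ex; rewrite ipZr hv ?mulr0.
have nEe : ~ E e by move=> /eE; rewrite ee => /eqP; rewrite oner_eq0.
apply: (Emax (E `|` [set e])%classic).
  split; first by move=> x Ex; left.
  by move=> h; apply: nEe; apply: h; right.
split=> [x [/E1//|->//]|x y [Ex|->] [Ey|->] xy].
- exact: E0.
- exact: eE.
- by rewrite ip_conj eE // rmorph0.
- by rewrite eqxx in xy.
Qed.

Lemma hilbert_schmidtP E (T : V -> V) : orthonormal_basis E ->
  (\esum_(e in E) ((hnorm (T e)) ^+ 2)%:E < +oo)%E <->
  exists h : R, forall f, uniq f -> (forall e, e \in f -> E e) ->
    \sum_(e <- f) nsq (T e) <= h.
Proof.
move=> onb; split=> [hfin|[h hh]].
  pose s := (\esum_(e in E) ((hnorm (T e)) ^+ 2)%:E)%E.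
  have s0 : (0 <= s)%E by apply: esum_ge0 => e _; rewrite lee_fin sqr_ge0.
  have sfin : s \is a fin_num by rewrite ge0_fin_numE.
  exists (fine s) => f uf fE; rewrite -lee_fin fineK //.
  apply: esum_ge; exists [set` f]%classic; first by split; [exact: finite_seq | move=> x /= /fE].
  rewrite -(@fsbig_seq _ _ _ _ _ _ uf) sumEFin lee_fin.
  by rewrite le_eqVlt; apply/orP; left; apply/eqP/eq_bigr => e _; rewrite hnorm_sqr.
apply: (@le_lt_trans _ _ h%:E); last exact: ltry.
apply: ge_ereal_sup => _ [F [finF FE] <-].
rewrite fsbig_finite //= sumEFin lee_fin.
rewrite (eq_bigr (fun e => nsq (T e))) => [|e _]; last exact: hnorm_sqr.
apply: hh; first exact: finmap.fset_uniq.
by move=> e; rewrite in_fset_set // inE => /FE.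
Qed.

End OrthonormalBases.

(** * Boundedness from an everywhere defined adjoint *)

Section AdjointBounded.
Context {R : realType} {V : hilbertType R}.
Implicit Types (x y z : V).

Section GlidingHump.
Variable y : nat -> V.
Local Notation q := (3^-1 : R).

Definition hump_unit n := ((hnorm (y n))^-1)%:C%C *: y n.

(** The values of <y_k|.> at h + u and h - u differ by 2<y_k|u>, so one of the two signs gives at
    least |<y_k|u>| in modulus. With ratio 1/3 all later steps together are at most half of the
    current one and cannot undo the gain. *)
Fixpoint hump n : V :=
  if n is k.+1 then
    let u := (q ^+ k.+1)%:C%C *: hump_unit k in
    if q ^+ k.+1 * hnorm (y k) <= cabs (ip (y k) (hump k + u)) then hump k + u
    else hump k - u
  else 0.

Lemma hump_step n : hnorm (hump n.+1 - hump n) <= q ^+ n.+1.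
Proof.
have h : hnorm ((q ^+ n.+1)%:C%C *: hump_unit n) <= q ^+ n.+1.
  rewrite hnormZ cabs_real ger0_norm ?exprn_ge0 ?invr_ge0 //.
  rewrite ler_piMr ?exprn_ge0 ?invr_ge0 // hnormZ cabs_real ger0_norm ?invr_ge0 ?hnorm_ge0 //.
  by have [->|h] := eqVneq (hnorm (y n)) 0; rewrite ?mulr0 // mulVf.
set u := (_ *: hump_unit n) in h *.
have [->|->] : hump n.+1 = hump n + u \/ hump n.+1 = hump n - u.
  by rewrite /= -/u; case: ifP => _; [left | right].
  by rewrite addrAC subrr add0r.
by rewrite addrAC subrr add0r hnormN.
Qed.

Lemma hump_large n : y n != 0 -> q ^+ n.+1 * hnorm (y n) <= cabs (ip (y n) (hump n.+1)).
Proof.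
move=> y0; have yn : hnorm (y n) != 0 by apply: contra_neq y0; exact: hnorm_eq0.
rewrite /=; set u := _ *: hump_unit n; case: ifPn => //; rewrite -ltNge => h.
have e : ip (y n) u = (q ^+ n.+1 * hnorm (y n))%:C%C.
  rewrite /u /hump_unit !ipZr ip_sqr -!rmorphM /= -hnorm_sqr; congr (_ %:C%C).
  by field.
have := cabsD (ip (y n) (hump n + u)) (- ip (y n) (hump n - u)).
have -> : ip (y n) (hump n + u) - ip (y n) (hump n - u) = 2 * ip (y n) u.
  by rewrite ipDr ipBr; ring.
rewrite cabsN e -[2]/(2%:R) -(rmorph_nat (real_complex R)) -rmorphM cabs_real.
rewrite ger0_norm ?mulr_ge0 ?exprn_ge0 ?invr_ge0 ?hnorm_ge0 //.
by move: h; lra.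
Qed.

(** The exact geometric sum of the step sizes, kept with its negative term so that the induction
    closes. *)
Lemma hump_dist n k : hnorm (hump (n + k) - hump n) <= (q ^+ n - q ^+ (n + k)) / 2.
Proof.
elim: k => [|k IH]; first by rewrite addn0 !subrr hnorm0 mul0r.
have -> : hump (n + k.+1) - hump n = (hump (n + k).+1 - hump (n + k)) + (hump (n + k) - hump n).
  by rewrite addnS addrA subrK.
have := hnormD (hump (n + k).+1 - hump (n + k)) (hump (n + k) - hump n).
have := hump_step (n + k); move: IH.
by rewrite addnS [q ^+ (n + k).+1]exprS; lra.
Qed.

Lemma hump_small (e : R) : 0 < e -> exists N, forall n, (N <= n)%N -> q ^+ n < e.
Proof.
move=> e0; have [N hN] := small_inv e0; exists N => n /hN; apply: le_lt_trans.
rewrite exprVn lef_pV2 ?posrE ?exprn_gt0 ?ltr0n // -natrX ler_nat.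
exact: ltn_expl.
Qed.

Lemma hump_limit : exists z, forall n, hnorm (z - hump n) <= q ^+ n / 2.
Proof.
have dist m n : (m <= n)%N -> hnorm (hump n - hump m) <= q ^+ m / 2.
  move=> /subnKC <-; apply: le_trans (hump_dist _ _) _.
  have : 0 <= q ^+ (m + (n - m)) by rewrite exprn_ge0 ?invr_ge0.
  by lra.
have [|z hz] := hilbert_complete hump.
  move=> e e0; have [N hN] := hump_small e0; exists N => m n hm hn.
  have [mn|/ltnW nm] := leqP m n.
    rewrite hnormBC; apply: le_lt_trans (dist _ _ mn) _.
    have : 0 <= q ^+ m by rewrite exprn_ge0 ?invr_ge0.
    have := hN _ hm.
    lra.
  apply: le_lt_trans (dist _ _ nm) _.
  have : 0 <= q ^+ n by rewrite exprn_ge0 ?invr_ge0.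
  have := hN _ hn.
  lra.
exists z => n; apply: (@le_eps _ _ _ 1) => e e0; rewrite mul1r.
have [N hN] := hz e e0; pose m := maxn n N.
have := dist n m (leq_maxl _ _); have := hN m (leq_maxr _ _).
have -> : z - hump n = (z - hump m) + (hump m - hump n) by rewrite addrA subrK.
have := hnormD (z - hump m) (hump m - hump n); rewrite (hnormBC z); lra.
Qed.

End GlidingHump.

(* Uniform boundedness of the functionals <f x|.>, |x| = 1, by a gliding hump. *)
Lemma adjoint_bounded (f f' : V -> V) : antilinear f ->
  (forall x y, ip (f x) y = ip (f' y) x) ->
  exists2 K : R, 0 <= K & forall x, nsq (f x) <= K * nsq x.
Proof.
move=> fA adj; apply: contrapT => /forall2NP nb.
have big (K : R) : 0 <= K -> exists x, hnorm x = 1 /\ K < hnorm (f x).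
  move=> K0; have [] := nb (K ^+ 2); first by rewrite exprn_ge0.
  move=> /existsNP[x /negP]; rewrite -ltNge => h.
  have x0 : hnorm x != 0.
    apply/eqP => /hnorm_eq0 x0; move: h.
    by rewrite x0 (antilin0 fA) !nsq0 mulr0 ltxx.
  have xp : 0 < hnorm x by rewrite lt_def x0 hnorm_ge0.
  exists (((hnorm x)^-1)%:C%C *: x); split.
    by rewrite hnormZ cabs_real ger0_norm ?invr_ge0 ?hnorm_ge0 // mulVf.
  rewrite (antilinZ fA) hnormZ cabs_conj cabs_real ger0_norm ?invr_ge0 ?hnorm_ge0 //.
  rewrite -ltr_pdivrMl ?invr_gt0 // invrK.
  by rewrite -(ltr_pXn2r (n := 2)) ?nnegrE ?mulr_ge0 ?hnorm_ge0 // exprMn !hnorm_sqr mulrC.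
(* The growth is chosen so that half of 3^-(n+1) |f x_n|, the part of the pairing with the limit z
   that survives, exceeds n + 1. The adjoint bounds that pairing by |f' z| for every n. *)
have /choice[x hx] : forall n, exists x, hnorm x = 1 /\
    2 * n.+1%:R * 3 ^+ n.+1 < hnorm (f x).
  by move=> n; apply: big; rewrite !mulr_ge0 ?exprn_ge0.
have [z hz] := hump_limit (f \o x).
have [N h4] : exists N : nat, hnorm (f' z) < N.+1%:R.
  exists (Num.bound (hnorm (f' z))).
  by apply: lt_trans (archi_boundP (hnorm_ge0 _)) _; rewrite ltr_nat.
have [x1 hN] := hx N.
have fx0 : f (x N) != 0.
  apply/eqP => e; move: hN; rewrite e hnorm0 ltNge => /negP; apply.
  by rewrite !mulr_ge0 ?exprn_ge0.
have := @hump_large (f \o x) N fx0; rewrite /= -/(hump (f \o x) N.+1).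
set w := hump (f \o x) N.+1 => h1.
have h2 : cabs (ip (f (x N)) (z - w)) <= hnorm (f (x N)) * (3^-1 ^+ N.+1 / 2).
  apply: le_trans (cauchy_schwarz _ _) _; rewrite ler_wpM2l ?hnorm_ge0 //.
  exact: hz.
have h3 : cabs (ip (f (x N)) z) <= hnorm (f' z).
  by rewrite adj; apply: le_trans (cauchy_schwarz _ _) _; rewrite x1 mulr1.
have h5 : cabs (ip (f (x N)) w) <= cabs (ip (f (x N)) z) + cabs (ip (f (x N)) (z - w)).
  have -> : ip (f (x N)) w = ip (f (x N)) z - ip (f (x N)) (z - w) by rewrite ipBr; ring.
  by apply: le_trans (cabsD _ _) _; rewrite cabsN.
have h6 : N.+1%:R * 2 < hnorm (f (x N)) * 3^-1 ^+ N.+1.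
  by rewrite exprVn ltr_pdivlMr ?exprn_gt0 // [_ * 2]mulrC.
move: h1 h2 h3 h4 h5 h6; move: (3^-1 ^+ N.+1 : R) (N.+1%:R : R) => a b.
by rewrite mulrA [a * _]mulrC; lra.
Qed.

End AdjointBounded.

(** * Linear and antilinear parts of an antisymplectic map *)

Section RealLinearParts.
Context {R : realType} {V : hilbertType R}.
Implicit Types (g h f : V -> V) (u v w : V).

Lemma inverseK f : bijective f -> cancel f (inverse f).
Proof.
by move=> fb x; apply: pinvKV; rewrite ?inE // => ? ? _ _; apply: bij_inj.
Qed.

Lemma inverseKV f : bijective f -> cancel (inverse f) f.
Proof.
move=> [h fh hf] x; apply: pinvK; rewrite inE; exists (h x) => //.
Qed.

Lemma inverse_bij f : bijective f -> bijective (inverse f).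
Proof. by move=> fb; exists f; [exact: inverseKV | exact: inverseK]. Qed.

Definition real_linear h := forall (r : R) u v, h (r%:C%C *: u + v) = r%:C%C *: h u + h v.

Section Parts.
Variable h : V -> V.
Hypothesis hL : real_linear h.

Lemma real_linD u v : h (u + v) = h u + h v.
Proof. by have := hL 1 u v; rewrite rmorph1 !scale1r. Qed.

Lemma real_lin0 : h 0 = 0.
Proof. by apply: (addrI (h 0)); rewrite -real_linD !addr0. Qed.

Lemma real_linZ (r : R) u : h (r%:C%C *: u) = r%:C%C *: h u.
Proof. by have := hL r u 0; rewrite real_lin0 !addr0. Qed.

Lemma real_linN u : h (- u) = - h u.
Proof.
by have := real_linZ (-1) u; rewrite rmorphN rmorph1 !scaleN1r.
Qed.

Lemma parts_sum v : h v = lin_part h v + antilin_part h v.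
Proof.
rewrite /lin_part /antilin_part -scalerDr addrACA addNr addr0 scalerDr.
by rewrite -scalerDl -[in LHS](scale1r (h v)); congr (_ *: _); field.
Qed.

Let ii : 'i * 'i = -1 :> R[i]. Proof. by rewrite -expr2 sqrCi. Qed.

Lemma lin_partD u v : lin_part h (u + v) = lin_part h u + lin_part h v.
Proof.
have e : 'i *: (u + v) = 'i *: u + 'i *: v by exact: scalerDr.
by rewrite /lin_part e !real_linD ['i *: (h _ + h _)]scalerDr opprD addrACA scalerDr.
Qed.

Lemma antilin_partD u v : antilin_part h (u + v) = antilin_part h u + antilin_part h v.
Proof.
have e : 'i *: (u + v) = 'i *: u + 'i *: v by exact: scalerDr.
by rewrite /antilin_part e !real_linD ['i *: (h _ + h _)]scalerDr addrACA scalerDr.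
Qed.

Lemma lin_partZr (r : R) u : lin_part h (r%:C%C *: u) = r%:C%C *: lin_part h u.
Proof.
rewrite /lin_part scalerA mulrC -scalerA !real_linZ scalerA [_ * r%:C%C]mulrC -scalerA.
by rewrite -scalerBr scalerA mulrC -scalerA.
Qed.

Lemma antilin_partZr (r : R) u : antilin_part h (r%:C%C *: u) = r%:C%C *: antilin_part h u.
Proof.
rewrite /antilin_part scalerA mulrC -scalerA !real_linZ scalerA [_ * r%:C%C]mulrC -scalerA.
by rewrite -scalerDr scalerA mulrC -scalerA.
Qed.

Lemma lin_part_i u : lin_part h ('i *: u) = 'i *: lin_part h u.
Proof.
rewrite /lin_part scalerA ii scaleN1r real_linN scalerN opprK scalerA [_ * 2^-1]mulrC -scalerA.
by congr (_ *: _); rewrite scalerBr scalerA ii scaleN1r opprK addrC.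
Qed.

Lemma antilin_part_i u : antilin_part h ('i *: u) = - ('i *: antilin_part h u).
Proof.
rewrite /antilin_part scalerA ii scaleN1r real_linN scalerN scalerA [_ * 2^-1]mulrC -scalerA.
rewrite -[RHS]scalerN; congr (_ *: _).
by rewrite scalerDr scalerA ii scaleN1r opprB.
Qed.

Let complexP (a : R[i]) : a = (complex.Re a)%:C%C + 'i * (complex.Im a)%:C%C.
Proof. by rewrite -complexiE -complexE. Qed.

Lemma lin_part_linear a u v : lin_part h (a *: u + v) = a *: lin_part h u + lin_part h v.
Proof.
rewrite lin_partD; congr (_ + _); rewrite {1}[a]complexP scalerDl lin_partD lin_partZr.
by rewrite -scalerA lin_part_i lin_partZr ['i *: (_ *: _)]scalerA -scalerDl -complexP.
Qed.

Lemma antilin_part_antilin : antilinear (antilin_part h).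
Proof.
move=> a u v; rewrite antilin_partD; congr (_ + _).
rewrite {1}[a]complexP scalerDl antilin_partD antilin_partZr.
rewrite -scalerA antilin_part_i antilin_partZr ['i *: (_ *: _)]scalerA -scaleNr -scalerDl.
congr (_ *: _); rewrite [in RHS](complexP a) rmorphD rmorphM /= !conj_realC.
by rewrite conjCi mulNr.
Qed.

End Parts.

(** The composite, which is the identity, splits into a complex-linear L and an antilinear M.
    Comparing L + M = 1 at v and at iv gives L - M = 1 as well. *)
Lemma parts_comp g h : real_linear g -> real_linear h -> cancel g h -> forall v,
  lin_part h (lin_part g v) + antilin_part h (antilin_part g v) = v /\
  lin_part h (antilin_part g v) + antilin_part h (lin_part g v) = 0.
Proof.
move=> gL hL gK.
pose L v := lin_part h (lin_part g v) + antilin_part h (antilin_part g v).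
pose M v := lin_part h (antilin_part g v) + antilin_part h (lin_part g v).
have LM v : L v + M v = v.
  rewrite -[RHS]gK [g v]parts_sum (real_linD hL) (parts_sum h (lin_part g v)).
  rewrite (parts_sum h (antilin_part g v)) /L /M addrACA.
  by rewrite [in RHS]addrACA [in RHS](addrC (antilin_part h (lin_part g v))) addrACA.
have Li v : L ('i *: v) = 'i *: L v.
  rewrite /L (lin_part_i gL) (lin_part_i hL) (antilin_part_i gL).
  have -> : antilin_part h (- ('i *: antilin_part g v)) = 'i *: antilin_part h (antilin_part g v).
    by rewrite (antilinN (antilin_part_antilin hL)) (antilin_part_i hL) opprK.
  by rewrite -scalerDr.
have Mi v : M ('i *: v) = - ('i *: M v).
  rewrite /M (lin_part_i gL) (antilin_part_i hL) (antilin_part_i gL).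
  have -> : lin_part h (- ('i *: antilin_part g v)) = - ('i *: lin_part h (antilin_part g v)).
    by rewrite -scaleN1r -[_ *: ('i *: _)]addr0 (lin_part_linear hL) (lin_part_i hL)
      -[0](subrr (0 : V)) scaleN1r; rewrite subrr /lin_part !scaler0 (real_lin0 hL) scaler0 subrr scaler0 addr0.
  by rewrite -opprD -scalerDr.
move=> v; have h1 := LM v; have := LM ('i *: v); rewrite Li Mi -scalerBr => h2.
have {}h2 : L v - M v = v by apply: (scalerI (neq0Ci _)).
have M0 : M v = 0.
  have : 2%:R *: M v = 0.
    have e : M v = - M v by apply: (addrI (L v)); rewrite h1 h2.
    by rewrite scaler_nat mulr2n {2}e subrr.
  by move/eqP; rewrite scaler_eq0 pnatr_eq0 /= => /eqP.
by split=> //; rewrite -[LHS]addr0 -M0.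
Qed.

End RealLinearParts.

(** * Bogoliubov relations and surjectivity of the antilinear part *)

Section Bogoliubov.
Context {R : realType} {V : hilbertType R}.
Implicit Types (u v w x y : V).

(* C, A are the linear and antilinear parts of g, C', A' those of g^-1. *)
Record bogoliubov (C A C' A' : V -> V) : Prop := Bogoliubov {
  bogo_lin : forall a u v, C (a *: u + v) = a *: C u + C v;
  bogo_antilin : antilinear A;
  bogo_lin' : forall a u v, C' (a *: u + v) = a *: C' u + C' v;
  bogo_antilin' : antilinear A';
  bogo_lin_adj : forall x y, ip (C x) y = - ip x (C' y);
  bogo_antilin_adj : forall x y, ip (A x) y = ip (A' y) x;
  bogo_id : forall v, C' (C v) + A' (A v) = v;
  bogo_mix : forall v, C' (A v) + A' (C v) = 0;
  bogo_id' : forall v, C (C' v) + A (A' v) = v;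
  bogo_mix' : forall v, C (A' v) + A (C' v) = 0
}.

(** The passage from g to its inverse; it supplies the primed version of every later lemma. *)
Lemma bogo_sym C A C' A' : bogoliubov C A C' A' -> bogoliubov C' A' C A.
Proof.
case=> h1 h2 h3 h4 h5 h6 h7 h8 h9 h10; split=> // x y.
by rewrite [LHS]ip_conj [ip x _]ip_conj h5 -rmorphN opprK.
Qed.

Lemma antisymplectic_inverse (g : V -> V) :
  antisymplectic g -> antisymplectic (inverse g).
Proof.
case=> gL gb gI; have gK := inverseK gb; have gK' := inverseKV gb.
split; last by move=> u v; rewrite -{2}[u]gK' -{2}[v]gK' gI opprK.
- move=> r u v; apply: (bij_inj gb).
  by rewrite gK' gL !gK'.
- exact: inverse_bij.
Qed.

Lemma antisymplectic_bogo (g : V -> V) : antisymplectic g ->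
  bogoliubov (lin_part g) (antilin_part g)
    (lin_part (inverse g)) (antilin_part (inverse g)).
Proof.
move=> hg; have [gL gb gI] := hg; have gK := inverseK gb; have gK' := inverseKV gb.
have [hL hb _] := antisymplectic_inverse hg.
set h := inverse g in gK gK' hL hb *.
set C := lin_part g; set A := antilin_part g; set C' := lin_part h; set A' := antilin_part h.
(* The hypothesis on g says that S + D has zero imaginary part. The second term of D is conjugated,
   so S and D are both linear in y, and replacing y by iy kills the real part too. In x, S is
   antilinear and D is linear, so replacing x by ix separates them. *)
pose S x y := ip (C x) y + ip x (C' y).
pose D x y := ip (A x) y - ip (A' y) x.
have ImT x y : complex.Im (S x y + D x y) = 0.
  have e1 : ip (C x) y + ip (A x) y = ip (g x) y by rewrite -ipDl -parts_sum.
  have e2 : ip x (C' y) + ip x (A' y) = ip x (h y) by rewrite -ipDr -parts_sum.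
  have e3 := gI x (h y); rewrite gK' -e1 -e2 in e3.
  move: e3; rewrite /S /D [ip (A' y) x]ip_conj.
  case: (ip (C x) y) (ip (A x) y) (ip x (C' y)) (ip x (A' y)) =>
    [a1 a2] [b1 b2] [c1 c2] [d1 d2] /=; lra.
have Si x y : S x ('i *: y) = 'i * S x y.
  by rewrite /S /C' (lin_part_i hL) !ipZr mulrDr.
have Di x y : D x ('i *: y) = 'i * D x y.
  rewrite /D /A' (antilin_part_i hL) ipZr ipNl [ip ('i *: _) _]ipZl conjCi mulrBr.
  by rewrite mulNr opprK.
have T0 x y : S x y + D x y = 0.
  have := ImT x ('i *: y); rewrite Si Di -mulrDr; have := ImT x y.
  rewrite -complexiE; case: (S x y + D x y) => a b /= ->.
  by rewrite mul0r add0r mul1r => ->.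
have Six x y : S ('i *: x) y = - ('i * S x y).
  by rewrite /S /C (lin_part_i gL) ![ip ('i *: _) _]ipZl conjCi -mulrDr mulNr.
have Dix x y : D ('i *: x) y = 'i * D x y.
  by rewrite /D /A (antilin_part_i gL) ipZr ipNl [ip ('i *: _) _]ipZl conjCi mulrBr mulNr opprK.
have S0 x y : S x y = 0.
  have h1 := T0 x y; have := T0 ('i *: x) y; rewrite Six Dix.
  have -> : D x y = - S x y by apply/eqP; rewrite -addr_eq0 addrC h1.
  rewrite mulrN -opprD -mulr2n => /eqP; rewrite oppr_eq0 mulrn_eq0 /= mulf_eq0.
  by rewrite (negPf (neq0Ci _)) => /eqP.
have D0 x y : D x y = 0 by have := T0 x y; rewrite S0 add0r.
split.
- exact: lin_part_linear.
- exact: antilin_part_antilin.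
- exact: lin_part_linear.
- exact: antilin_part_antilin.
- by move=> x y; apply/eqP; rewrite -addr_eq0; apply/eqP/S0.
- by move=> x y; apply/eqP; rewrite -subr_eq0; apply/eqP/D0.
- by move=> v; have [] := parts_comp gL hL gK v.
- by move=> v; have [] := parts_comp gL hL gK v.
- by move=> v; have [] := parts_comp hL gL gK' v.
- by move=> v; have [] := parts_comp hL gL gK' v.
Qed.

Section Theory.
Variables C A C' A' : V -> V.
Hypothesis B : bogoliubov C A C' A'.

(** This is A'A = 1 - C'C with A' and -C' the adjoints of A and C. It makes A bounded below, hence
    injective with contractive inverse. *)
Lemma bogo_nsq x : nsq (A x) = nsq x + nsq (C x).
Proof.
have e : A' (A x) = x - C' (C x) by rewrite -{2}(bogo_id B x) addrAC subrr add0r.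
rewrite /nsq (bogo_antilin_adj B) e ipBl [ip (C' _) x]ip_conj.
have -> : ip x (C' (C x)) = - ip (C x) (C x) by rewrite (bogo_lin_adj B) opprK.
by rewrite rmorphN opprK raddfD /= -ip_conj.
Qed.

Lemma bogo_nsq_ge x : nsq x <= nsq (A x).
Proof. by rewrite bogo_nsq lerDl nsq_ge0. Qed.

Lemma bogo_inj : injective A.
Proof.
move=> x y e; apply/eqP; rewrite -subr_eq0; apply/eqP/nsq_eq0/le_anti.
rewrite nsq_ge0 andbT; apply: le_trans (bogo_nsq_ge _) _.
by rewrite (antilinB (bogo_antilin B)) e subrr nsq0.
Qed.

End Theory.

(** The range is dense because a vector orthogonal to it is killed by the injective A'. It is closed
    because A is bounded below; continuity of A is replaced by testing the limit against w through
    the adjoint A'. *)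
Lemma bogo_surj C A C' A' : bogoliubov C A C' A' -> forall y, exists x, A x = y.
Proof.
move=> B y; have AA := bogo_antilin B.
pose S u := exists x, A x = u.
have S0 : S 0 by exists 0; exact: antilin0.
have SP a s t : S s -> S t -> S (a *: s + t).
  by move=> [u <-] [v <-]; exists (a^* *: u + v); rewrite AA conjCK.
have [p [hp horth]] := hilbert_projection y S0 SP.
have yp : y = p.
  apply/eqP; rewrite -subr_eq0; apply/eqP/(bogo_inj (bogo_sym B)).
  rewrite (antilin0 (bogo_antilin' B)); apply: ip_eq => w.
  rewrite ip0r ip_conj -(bogo_antilin_adj B) horth ?rmorph0 //.
  by exists w.
have /choice[u hu] : forall n, exists x, hnorm (A x - p) < (n.+1%:R)^-1.
  move=> n; have n0 : 0 < (n.+1%:R)^-1 :> R by rewrite invr_gt0.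
  by have [_ [x <-] h] := hp _ n0; exists x.
have [|x hx] := hilbert_complete u.
  move=> e e0; have e2 : 0 < e / 2 by rewrite divr_gt0.
  have [N hN] := small_inv e2; exists N => m n hm hn.
  apply: (@le_lt_trans _ _ (hnorm (A (u m - u n)))).
    by rewrite hnorm_le ?hnorm_ge0 // hnorm_sqr (bogo_nsq_ge B).
  have -> : A (u m - u n) = (A (u m) - p) - (A (u n) - p).
    by rewrite (antilinB AA) opprB addrA subrK.
  apply: le_lt_trans (hnormD _ _) _; rewrite hnormN [e]splitr.
  by apply: ltrD; [exact: lt_trans (hu m) (hN _ hm) | exact: lt_trans (hu n) (hN _ hn)].
exists x; rewrite yp; apply: ip_eq => w; rewrite ip_conj [RHS]ip_conj; congr (_^*).
apply: (@ceq_eps _ _ _ (hnorm (A' w) + hnorm w)) => e e0.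
have [[N hN] [M hM]] := conj (hx e e0) (small_inv e0).
pose n := maxn N M; have hn := hN n (leq_maxl _ _); have hm := hM n (leq_maxr _ _).
have -> : ip (A x) w - ip p w = - ip (A' w) (u n - x) + ip (A (u n) - p) w.
  by rewrite ipBr !ipBl !(bogo_antilin_adj B); ring.
apply: le_trans (cabsD _ _) _; rewrite cabsN mulrDl lerD //.
  by apply: le_trans (cauchy_schwarz _ _) _; rewrite ler_wpM2l ?hnorm_ge0 // ltW.
apply: le_trans (cauchy_schwarz _ _) _; rewrite mulrC ler_wpM2l ?hnorm_ge0 // ltW //.
exact: lt_trans (hu n) hm.
Qed.

End Bogoliubov.

(** * The inverse of the antilinear part and the kernel of the theorem *)

Section InverseAntilinearPart.
Context {R : realType} {V : hilbertType R}.
Implicit Types (u v w x y : V).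

Lemma bogo_bij (C A C' A' : V -> V) : bogoliubov C A C' A' -> bijective A.
Proof.
move=> B; have /choice[h hh] := bogo_surj B.
by exists h => // x; apply: (bogo_inj B); rewrite hh.
Qed.

Section OneSide.
Variables C A C' A' : V -> V.
Hypothesis B : bogoliubov C A C' A'.
Local Notation Ai := (inverse A).

Lemma bogo_lin0 : C 0 = 0.
Proof.
have := bogo_lin B 1 0 0; rewrite !scale1r addr0 => h.
by apply: (addrI (C 0)); rewrite addr0 -h.
Qed.

Lemma bogo_AiK : cancel A Ai. Proof. exact/inverseK/bogo_bij/B. Qed.
Lemma bogo_AKi : cancel Ai A. Proof. exact/inverseKV/bogo_bij/B. Qed.

Lemma bogo_inv_antilin : antilinear Ai.
Proof.
move=> a u v; apply: (bogo_inj B).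
by rewrite (bogo_antilin B) !bogo_AKi conjCK.
Qed.

Lemma bogo_inv_le x : nsq (Ai x) <= nsq x.
Proof. by rewrite -{2}[x]bogo_AKi (bogo_nsq_ge B). Qed.

Lemma bogo_Z_antilin : antilinear (Ai \o C).
Proof. by move=> a u v /=; rewrite (bogo_lin B) bogo_inv_antilin. Qed.

End OneSide.

Section BothSides.
Variables C A C' A' : V -> V.
Hypothesis B : bogoliubov C A C' A'.
Local Notation Ai := (inverse A).
Local Notation A'i := (inverse A').
Let B' := bogo_sym B.

Lemma bogo_inv_adj x y : ip y (Ai x) = ip x (A'i y).
Proof.
rewrite -{1}[y](bogo_AKi B') -{2}[x](bogo_AKi B).
exact/esym/(bogo_antilin_adj B).
Qed.

(** In other words Z_{g^-1} = -C A^-1, from the mixed relation A'C = -C'A. In this form C is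
    recovered without inverting anything. *)
Lemma bogo_Z'A v : A'i (C' (A v)) = - C v.
Proof.
apply: (bogo_inj B'); rewrite (bogo_AKi B') (antilinN (bogo_antilin' B)).
by apply/eqP; rewrite -addr_eq0 (bogo_mix B).
Qed.

Lemma bogo_CAi v : C (Ai v) = - A'i (C' v).
Proof. by rewrite -{2}[v](bogo_AKi B) bogo_Z'A opprK. Qed.

Lemma bogo_A'iCC v : A'i (C' (C v)) + A v = A'i v.
Proof.
apply: (bogo_inj B'); rewrite (antilinD (bogo_antilin' B)) !(bogo_AKi B').
exact: (bogo_id B).
Qed.

(** At Ax the squared ratio is |Cx|^2 / (|x|^2 + |Cx|^2), which stays away from 1 as soon as C is
    bounded. *)
Lemma bogo_Z'_le (K : R) : 0 <= K -> (forall x, nsq (C x) <= K * nsq x) ->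
  forall x, nsq (A'i (C' x)) <= K / (K + 1) * nsq x.
Proof.
move=> K0 hK x; rewrite -[x](bogo_AKi B) bogo_Z'A nsqN (bogo_nsq B).
have := hK (Ai x); set a := nsq (Ai x); set c := nsq (C _) => h.
have K1 : 0 < K + 1 by lra.
rewrite mulrAC ler_pdivlMr //; lra.
Qed.

End BothSides.

(** With x = A'a and y = A'b the claim becomes symmetry of <A'b|C'a> in a and b, which follows from
    the two adjunctions and AC' = -CA'. *)
Lemma bogo_Z_sym (C A C' A' : V -> V) : bogoliubov C A C' A' ->
  symmetric_map (inverse A \o C).
Proof.
move=> B x y /=; have B' := bogo_sym B.
rewrite -[x](bogo_AKi B') -[y](bogo_AKi B'); move: (inverse A' x) (inverse A' y) => a b.
rewrite !(bogo_Z'A B') !ipNr; congr (- _).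
have e : A (C' a) = - C (A' a) by apply/eqP; rewrite -addr_eq0 addrC (bogo_mix' B).
by rewrite -(bogo_antilin_adj B (C' a) b) e ipNl (bogo_lin_adj B) opprK.
Qed.

Section Kernel.
Variables C A C' A' : V -> V.
Hypothesis B : bogoliubov C A C' A'.
Local Notation Ai := (inverse A).
Local Notation A'i := (inverse A').
Let B' := bogo_sym B.

Definition bogoZ (p : V * V) : V * V :=
  (Ai (C p.1), A'i p.1) + (Ai p.2, A'i (C' p.2)).

Lemma bogoZ_antilin : antilinear bogoZ.
Proof.
move=> a [u1 u2] [v1 v2]; rewrite /bogoZ /=.
rewrite (bogo_lin B) (bogo_lin' B) !(bogo_inv_antilin B) !(bogo_inv_antilin B').
by congr (_, _) => /=; rewrite scalerDr addrACA.
Qed.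

Lemma bogoZ_sym : symmetric_map bogoZ.
Proof.
move=> [x1 x2] [y1 y2]; rewrite -![ip _ _]/(dsum_ip _ _) /dsum_ip /= !ipDr.
rewrite (bogo_Z_sym B x1 y1) (bogo_Z_sym B' x2 y2) /=.
rewrite (bogo_inv_adj B x2 y1) (bogo_inv_adj B' x1 y2).
by rewrite addrACA.
Qed.

End Kernel.
End InverseAntilinearPart.

(** * Weak metaplectic maps *)

Section MetaMaps.
Context {R : realType} {V : hilbertType R}.
Implicit Types (u v w : V) (x y : Sym V).

Lemma sym_annDl u v x : sym_ann (u + v) x = sym_ann u x + sym_ann v x.
Proof. by rewrite -[u]scale1r sym_ann_antilinear rmorph1 !scale1r. Qed.

Lemma sym_annNl v x : sym_ann (- v) x = - sym_ann v x.
Proof.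
by apply/eqP; rewrite -addr_eq0 -sym_annDl addNr sym_ann0.
Qed.

Lemma ann_sym1 (p : V * V) x : sym_ann p (sym1 x) = sym1 (sym_ann p.1 x).
Proof.
apply: (@ann_map _ _ _ (@dsum1 R V)) => w.
by rewrite -[LHS]/(dsum_ip _ _) /dsum_ip /= ip0r addr0.
Qed.

Lemma ann_sym2 (p : V * V) x : sym_ann p (sym2 x) = sym2 (sym_ann p.2 x).
Proof.
apply: (@ann_map _ _ _ (@dsum2 R V)) => w.
by rewrite -[LHS]/(dsum_ip _ _) /dsum_ip /= ip0r add0r.
Qed.

(* The exchange rules of U_g; they determine it up to a scalar. *)
Record meta_map (C A C' A' : V -> V) (U : Sym V -> Sym V -> R[i]^o) : Prop := MetaMap {
  metaR : forall x, antilinear (U x);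
  metaL : forall a x x' y, U (a *: x + x') y = a^* *: U x y + U x' y;
  meta1 : forall v x y, U (sym_gen v * x) y =
    U (sym_ann (inverse A (C v)) x) y + U x (sym_ann (inverse A' v) y);
  meta2 : forall v x y, U x (sym_gen v * y) =
    U (sym_ann (inverse A v) x) y + U x (sym_ann (inverse A' (C' v)) y)
}.

(** Transposing the kernel exchanges the two rules, so the transpose belongs to g^-1. *)
Lemma meta_sym C A C' A' U : meta_map C A C' A' U ->
  meta_map C' A' C A (fun y x => U x y).
Proof.
case=> hr hl h1 h2; split=> [x a y y'|a x x' y|v x y|v x y].
- exact: hl.
- exact: hr.
- by rewrite h2 addrC.
- by rewrite h1 addrC.
Qed.

Lemma metaL_antilin C A C' A' U : meta_map C A C' A' U ->
  forall y, antilinear (U^~ y).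
Proof. by move=> h y a x x'; apply: (metaL h). Qed.

Lemma meta_scale C A C' A' U c : meta_map C A C' A' U -> meta_map C A C' A' (c *: U).
Proof.
case=> hr hl h1 h2; split=> [x a y y'|a x x' y|v x y|v x y].
- rewrite -[(c *: U) x _]/(c * U x _) hr -[(c *: U) x y]/(c * U x y).
  by rewrite -[(c *: U) x y']/(c * U x y') !scaleoE; ring.
- rewrite -[(c *: U) _ y]/(c * U _ y) hl -[(c *: U) x y]/(c * U x y).
  by rewrite -[(c *: U) x' y]/(c * U x' y) !scaleoE; ring.
- by rewrite -[LHS]/(c * U _ y) h1 mulrDr.
- by rewrite -[LHS]/(c * U _ _) h2 mulrDr.
Qed.

Lemma meta_one_eq C A C' A' U T : meta_map C A C' A' U -> meta_map C A C' A' T ->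
  U 1 1 = T 1 1 -> forall y, U 1 y = T 1 y.
Proof.
move=> hU hT e; have UR := metaR hU 1; have TR := metaR hT 1.
have U0 y : U 0 y = 0 := antilin0 (metaL_antilin hU y).
have T0 y : T 0 y = 0 := antilin0 (metaL_antilin hT y).
apply: homog_ind_all => [x y hx hy||n x h].
- by rewrite (antilinD UR) (antilinD TR) hx hy.
- by rewrite (antilin0 UR) (antilin0 TR).
apply: (homog_strong_ind (P := fun _ y => U 1 y = T 1 y)) h => {n x}
  [n|a|n x y hx hy|n w x IH hx].
- by rewrite (antilin0 UR) (antilin0 TR).
- by rewrite (antilinZ UR) (antilinZ TR) e.
- by rewrite (antilinD UR) (antilinD TR) hx hy.
- rewrite (meta2 hU) (meta2 hT) !sym_ann1 U0 T0 !add0r.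
  by apply: (IH n.-1); [exact: leq_pred | exact: homog_ann].
Qed.

(** The rule for the first slot lowers the degree of x whatever y is, down to U 1 y; the rule for
    the second slot then lowers the degree of y. *)
Lemma meta_uniq C A C' A' U T : meta_map C A C' A' U -> meta_map C A C' A' T ->
  U 1 1 = T 1 1 -> U = T.
Proof.
move=> hU hT e; suff : forall x y, U x y = T x y.
  by move=> h; apply/funext => x; apply/funext => y.
have UL y := metaL_antilin hU y; have TL y := metaL_antilin hT y.
apply: homog_ind_all => [x y hx hy z|y|n x h].
- by rewrite (antilinD (UL z)) (antilinD (TL z)) hx hy.
- by rewrite (antilin0 (UL y)) (antilin0 (TL y)).
apply: (homog_strong_ind (P := fun _ x => forall y, U x y = T x y)) h => {n x}
  [n y|a y|n x y hx hy z|n w x IH hx y].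
- by rewrite (antilin0 (UL y)) (antilin0 (TL y)).
- by rewrite (antilinZ (UL y)) (antilinZ (TL y)) (meta_one_eq hU hT e).
- by rewrite (antilinD (UL z)) (antilinD (TL z)) hx hy.
- rewrite (meta1 hU) (meta1 hT); congr (_ + _); last exact: (IH n).
  by apply: (IH n.-1); [exact: leq_pred | exact: homog_ann].
Qed.

(** The annihilator of a vector of the double acts by the Leibniz rule on a product of the two
    copies, its components acting separately on each; the four blocks of Z appear as the four terms
    of the rules. *)
Lemma gauss_meta C A C' A' (E : Sym (V * V)%type -> R[i]^o) :
  bogoliubov C A C' A' -> is_gauss (bogoZ C A C' A') E ->
  meta_map C A C' A' (fun x y => E (sym1 x * sym2 y)).
Proof.
move=> B [EA E1 EZ]; have B' := bogo_sym B; split=> [x a y y'|a x x' y|v x y|v x y].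
- by rewrite /sym2 linearP /= mulrDr -scalerAr EA.
- by rewrite /sym1 linearP /= mulrDl -scalerAl EA.
- rewrite {1}/sym1 rmorphM /= sym_lift_gen -mulrA EZ sym_annM -/(sym1 x).
  rewrite ann_sym1 ann_sym2 (antilinD EA); congr (E (sym1 (sym_ann _ _) * _) + E (_ * sym2 (sym_ann _ _))).
    by rewrite /bogoZ /= (antilin0 (bogo_inv_antilin B)) addr0.
  by rewrite /bogoZ /= (bogo_lin0 B') (antilin0 (bogo_inv_antilin B')) addr0.
- rewrite {1}/sym2 rmorphM /= sym_lift_gen mulrCA EZ sym_annM -/(sym2 y).
  rewrite ann_sym1 ann_sym2 (antilinD EA); congr (E (sym1 (sym_ann _ _) * _) + E (_ * sym2 (sym_ann _ _))).
    by rewrite /bogoZ /= (bogo_lin0 B) (antilin0 (bogo_inv_antilin B)) add0r.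
  by rewrite /bogoZ /= (antilin0 (bogo_inv_antilin B')) add0r.
Qed.

Section WeakMeta.
Variables (C A C' A' : V -> V) (U : Sym V -> Sym V -> R[i]^o).
Hypothesis B : bogoliubov C A C' A'.

(** The term with an annihilator on x is eliminated by the second rule at Cv; what remains is
    collected by A'^-1 C'C + A = A'^-1. *)
Lemma meta_cre : meta_map C A C' A' U ->
  forall v x, U (sym_gen v * x) = dual_ann (C v) (U x) + dual_cre (A v) (U x).
Proof.
move=> hU v x; apply/funext => y; rewrite (meta1 hU).
rewrite -[RHS]/(U x (sym_gen (C v) * y) + U x (sym_ann (A v) y)) (meta2 hU).
by rewrite -addrA -(antilinD (metaR hU x)) -sym_annDl (bogo_A'iCC B).
Qed.

Lemma meta_ann : meta_map C A C' A' U ->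
  forall v x, U (sym_ann v x) = dual_ann (A v) (U x) + dual_cre (C v) (U x).
Proof.
move=> hU v x; apply/funext => y.
rewrite -[RHS]/(U x (sym_gen (A v) * y) + U x (sym_ann (C v) y)) (meta2 hU).
rewrite (bogo_AiK B) (bogo_Z'A B) sym_annNl (antilinN (metaR hU x)).
by rewrite subrK.
Qed.

(** The annihilator relation taken at A^-1 v is the second rule, since C A^-1 = -A'^-1 C'. The first
    rule then follows from the creator relation as in [meta_cre]. *)
Lemma weak_meta : (forall x, antilinear (U x)) -> antilinear U ->
  (forall v x, U (sym_cre v x) = dual_ann (C v) (U x) + dual_cre (A v) (U x)) ->
  (forall v x, U (sym_ann v x) = dual_ann (A v) (U x) + dual_cre (C v) (U x)) ->
  meta_map C A C' A' U.
Proof.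
move=> UR UL h1 h2.
have m2 v x y : U x (sym_gen v * y) =
    U (sym_ann (inverse A v) x) y + U x (sym_ann (inverse A' (C' v)) y).
  rewrite h2 -[X in _ = X + _]/(U x (sym_gen (A (inverse A v)) * y) +
    U x (sym_ann (C (inverse A v)) y)).
  by rewrite (bogo_AKi B) (bogo_CAi B) sym_annNl (antilinN (UR x)) subrK.
split=> // [a x x' y|v x y]; first by rewrite UL.
rewrite -[sym_gen v * x]/(sym_cre v x) h1.
rewrite -[LHS]/(U x (sym_gen (C v) * y) + U x (sym_ann (A v) y)) m2.
by rewrite -addrA -(antilinD (UR x)) -sym_annDl (bogo_A'iCC B).
Qed.

End WeakMeta.

Lemma meta_gauss_right C A C' A' U : meta_map C A C' A' U -> U 1 1 = 1 ->
  is_gauss (inverse A' \o C') (U 1).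
Proof.
move=> hU U1; split=> // [|w y]; first exact: metaR hU 1.
by rewrite (meta2 hU) sym_ann1 (antilin0 (metaL_antilin hU y)) add0r.
Qed.

Lemma meta_gauss_left C A C' A' U : meta_map C A C' A' U -> U 1 1 = 1 ->
  is_gauss (inverse A \o C) (U^~ 1).
Proof. by move=> hU; apply: (meta_gauss_right (meta_sym hU)). Qed.

End MetaMaps.

(** * Fock space *)

Section NiceFunctionals.
Context {R : realType} {W : preHilbertType R}.
Implicit Types (x y : Sym W) (u w : W) (Phi Psi : Sym W -> R[i]^o).

(* t^N Phi is bounded for some t > 1: on such functionals creators and
   annihilators are everywhere defined and adjoint to each other. *)
Definition nice Phi := antilinear Phi /\
  exists2 t : R, 1 < t & bounded (fun x => Phi (dil t%:C%C x)).

Lemma dilK (t : R) x : t != 0 -> dil t%:C%C (dil (t^-1)%:C%C x) = x.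
Proof. by move=> t0; rewrite dilM -rmorphM /= mulfV // dil1. Qed.

Lemma dil_antilin (t : R) Phi : antilinear Phi -> antilinear (fun x => Phi (dil t%:C%C x)).
Proof. by move=> PA a x y; rewrite linearP /= PA. Qed.

Lemma bdd_dil (s M : R) Phi : 0 <= s <= 1 -> 0 <= M -> bdd M Phi ->
  bdd M (fun x => Phi (dil s%:C%C x)).
Proof.
move=> hs M0 h x; apply: le_trans (h _) _.
by rewrite ler_wpM2l // hnorm_dil_le.
Qed.

Lemma niceW Phi (s t : R) : 1 < s <= t -> bounded (fun x => Phi (dil t%:C%C x)) ->
  antilinear Phi -> bounded (fun x => Phi (dil s%:C%C x)).
Proof.
move=> /andP[s1 st] [_ [M M0 PM]] PA; split; first exact: dil_antilin.
exists M => // x; have t0 : 0 < t by lra.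
have -> : dil s%:C%C x = dil t%:C%C (dil (s / t)%:C%C x).
  by rewrite dilM -rmorphM /= mulrCA mulfV ?mulr1 // lt0r_neq0.
apply: (bdd_dil (Phi := fun x => Phi (dil t%:C%C x)) (s := s / t)) => //.
by rewrite divr_ge0 ?ler_pdivrMr ?mul1r ?st //; lra.
Qed.

Lemma nice_bounded Phi : nice Phi -> bounded Phi.
Proof.
move=> [PA [t t1 [_ [M M0 PM]]]]; split=> //; exists M => // x.
have t0 : t != 0 by apply: lt0r_neq0; lra.
have ht : 0 <= t^-1 <= 1 by rewrite invr_ge0 invf_le1 ?(ltW t1) ?andbT; lra.
by have := bdd_dil ht M0 PM x; rewrite /= dilK.
Qed.

Lemma niceP a Phi Psi : nice Phi -> nice Psi -> nice (a *: Phi + Psi).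
Proof.
move=> [PA [t t1 Pt]] [QA [s s1 Qs]].
have PQ : antilinear (a *: Phi + Psi).
  move=> b x y; rewrite -![(a *: Phi + Psi) _]/(a * Phi _ + Psi _) PA QA !scaleoE.
  by ring.
split=> //; exists (Num.min s t); first by rewrite lt_min s1 t1.
have m1 : 1 < Num.min s t by rewrite lt_min s1 t1.
have ht : 1 < Num.min s t <= t by rewrite m1 ge_min lexx orbT.
have hs : 1 < Num.min s t <= s by rewrite m1 ge_min lexx.
exact: (boundedP a (niceW ht Pt PA) (niceW hs Qs QA)).
Qed.

Lemma nice0 : nice 0.
Proof.
have A0 : antilinear (0 : Sym W -> R[i]^o) by move=> a x y; rewrite scaler0 addr0.
split=> //; exists 2; first lra.
by split=> //; exists 0 => // x; rewrite mul0r cabs0.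
Qed.

Lemma niceD Phi Psi : nice Phi -> nice Psi -> nice (Phi + Psi).
Proof. by move=> hP hQ; rewrite -[Phi]scale1r; apply: niceP. Qed.

Lemma niceZ a Phi : nice Phi -> nice (a *: Phi).
Proof. by move=> hP; rewrite -[_ *: _]addr0; apply: niceP nice0. Qed.

Lemma sqrt_gt1 (t : R) : 1 < t -> 1 < Num.sqrt t.
Proof.
by move=> t1; rewrite -{1}(sqrtr1 R) ltr_sqrt //; lra.
Qed.

(** The spare dilation is split as t = s^2: one factor damps the creator or annihilator, the other
    remains for the result. *)
Lemma nice_cre_ann u Phi : nice Phi -> nice (dual_cre u Phi) /\ nice (dual_ann u Phi).
Proof.
move=> [PA [t t1 [_ [M M0 PM]]]]; pose s := Num.sqrt t.
have s1 : 1 < s by exact: sqrt_gt1.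
have tE : t = s * s by rewrite -expr2 sqr_sqrtr //; lra.
have s0 : s != 0 by apply: lt0r_neq0; lra.
have hs : 0 < s^-1 < 1 by rewrite invr_gt0 invf_lt1 ?s1 ?andbT; lra.
have [b b0 hb] := dil_cre_ann_bounded u hs.
have sE x : dil s%:C%C x = dil t%:C%C (dil (s^-1)%:C%C x).
  by rewrite dilM -rmorphM /= tE mulfK.
have creA := dual_cre_antilin u PA; have annA := dual_ann_antilin u PA.
split; split=> //; exists s => //; split; try exact: dil_antilin.
- exists (s * M * b) => [|x]; first by rewrite !mulr_ge0 //; lra.
  rewrite /dual_cre ann_dil (antilinZ PA) conj_realC scaleoE cabsM cabs_real sE.
  rewrite ger0_norm; last lra.
  rewrite -!mulrA ler_wpM2l //; first lra.
  apply: le_trans (PM _) _; rewrite ler_wpM2l //.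
  by have [] := hb x.
- exists (t^-1 * M * b) => [|x]; first by rewrite !mulr_ge0 ?invr_ge0 //; lra.
  have -> : dual_ann u Phi (dil s%:C%C x) =
      (t^-1)%:C%C * Phi (dil t%:C%C (sym_gen u * dil (s^-1)%:C%C x)).
    rewrite dil_gen (antilinZ PA) conj_realC scaleoE mulrA -rmorphM /= mulVf ?mul1r.
      by rewrite -sE.
    by apply: lt0r_neq0; lra.
  rewrite cabsM cabs_real ger0_norm ?invr_ge0; last lra.
  rewrite -!mulrA ler_wpM2l ?invr_ge0 //; first lra.
  apply: le_trans (PM _) _; rewrite ler_wpM2l //.
  by have [] := hb x.
Qed.

Lemma nice_cre u Phi : nice Phi -> nice (dual_cre u Phi).
Proof. by case/(nice_cre_ann u). Qed.

Lemma nice_ann u Phi : nice Phi -> nice (dual_ann u Phi).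
Proof. by case/(nice_cre_ann u). Qed.

(** One vector serves all three functionals. It is t^-N y, where y approximates the dilated
    functional, so that the damping bounds apply to the error. *)
Lemma nice_approx u Phi : nice Phi -> exists2 b : R, 0 <= b & forall e, 0 < e ->
  exists x, [/\ approx e x Phi, approx (b * e) (sym_gen u * x) (dual_cre u Phi) &
    approx (b * e) (sym_ann u x) (dual_ann u Phi)].
Proof.
move=> [PA [t t1 Pt]].
have t0 : t != 0 by apply: lt0r_neq0; lra.
have ht : 0 < t^-1 < 1 by rewrite invr_gt0 invf_lt1 ?t1 ?andbT; lra.
have ht' : 0 <= t^-1 <= 1 by case/andP: ht => h1 h2; rewrite !ltW.
have [b b0 hb] := dil_cre_ann_bounded u ht.
exists b => // e e0; have [y hy] := bounded_approx Pt e0.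
pose s := t^-1; pose x := dil s%:C%C y; exists x.
have key z : Phi z - ip z x = Phi (dil t%:C%C (dil s%:C%C z)) - ip (dil s%:C%C z) y.
  by rewrite dilK // /x dil_selfadj.
split=> z.
- rewrite key; apply: le_trans (hy _) _; rewrite ler_wpM2l ?(ltW e0) //.
  exact: hnorm_dil_le.
- rewrite -ip_ann key; apply: le_trans (hy _) _.
  by rewrite [b * e]mulrC -mulrA ler_wpM2l ?(ltW e0) //; have [] := hb z.
- rewrite ip_conj ip_ann -ip_conj.
  rewrite key; apply: le_trans (hy _) _.
  rewrite [b * e]mulrC -mulrA ler_wpM2l ?(ltW e0) // dil_gen hnormZ cabs_real.
  rewrite ger0_norm ?(andP ht').1 //.
  apply: (@le_trans _ _ (hnorm (sym_gen u * dil s%:C%C z))); last by have [] := hb z.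
  by rewrite ler_piMl ?hnorm_ge0 //; case/andP: ht'.
Qed.

(** The adjunctions hold by definition when Phi is given by a vector; they pass to the limit because
    the same approximants serve Phi and its images. *)
Lemma fip_adj u Phi Psi : nice Phi -> nice Psi ->
  fip (dual_cre u Phi) Psi = fip Phi (dual_ann u Psi) /\
  fip (dual_ann u Phi) Psi = fip Phi (dual_cre u Psi).
Proof.
move=> hP hQ; have [b b0 hb] := nice_approx u hP.
have [bP bQ] := conj (nice_bounded hP) (nice_bounded hQ).
have b1 : 0 < b + 1 by lra.
have hW e : 0 < e -> exists x, [/\ approx e x Phi,
    approx ((b + 1) * e) (sym_gen u * x) (dual_cre u Phi) &
    approx ((b + 1) * e) (sym_ann u x) (dual_ann u Phi)].
  move=> e0; have [x [h1 h2 h3]] := hb e e0; exists x; split=> //;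
    apply: approxW (h2) || apply: approxW (h3); rewrite ler_wpM2r ?(ltW e0) //; lra.
split.
- have [K hK] := fipP (nice_bounded (nice_cre u hP)) bQ.
  have [L hL] := fipP bP (nice_bounded (nice_ann u hQ)).
  apply: (@ceq_eps _ _ _ (K * (b + 1) + L)) => e e0.
  have [x [h1 h2 _]] := hW e e0; have be : 0 < (b + 1) * e by rewrite mulr_gt0.
  have -> : fip (dual_cre u Phi) Psi - fip Phi (dual_ann u Psi) =
    (fip (dual_cre u Phi) Psi - Psi (sym_gen u * x)) -
    (fip Phi (dual_ann u Psi) - dual_ann u Psi x).
    by rewrite /dual_ann /sym_cre; ring.
  apply: le_trans (cabsD _ _) _; rewrite cabsN mulrDl -mulrA.
  by apply: lerD; [exact: hK | exact: hL].
- have [K hK] := fipP (nice_bounded (nice_ann u hP)) bQ.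
  have [L hL] := fipP bP (nice_bounded (nice_cre u hQ)).
  apply: (@ceq_eps _ _ _ (K * (b + 1) + L)) => e e0.
  have [x [h1 _ h2]] := hW e e0; have be : 0 < (b + 1) * e by rewrite mulr_gt0.
  have -> : fip (dual_ann u Phi) Psi - fip Phi (dual_cre u Psi) =
    (fip (dual_ann u Phi) Psi - Psi (sym_ann u x)) -
    (fip Phi (dual_cre u Psi) - dual_cre u Psi x).
    by rewrite /dual_cre; ring.
  apply: le_trans (cabsD _ _) _; rewrite cabsN mulrDl -mulrA.
  by apply: lerD; [exact: hK | exact: hL].
Qed.

Lemma gauss_nice (Z : W -> W) (r h : R) E : antilinear Z -> symmetric_map Z ->
  0 <= r -> r < 1 -> (forall w, nsq (Z w) <= r * nsq w) ->
  (forall f : seq W, onseq f -> \sum_(e <- f) nsq (Z e) <= h) ->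
  is_gauss Z E -> nice E.
Proof.
move=> ZA Zs r0 r1 Zr Zh [EA E1 EZ]; split=> //.
(* Dilation by t replaces Z by t^2 Z, hence r by t^4 r. As t^4 = q = 2/(1 + r), both t > 1 and q r <
   1 hold. *)
pose q := 2 / (1 + r); pose t := Num.sqrt (Num.sqrt q).
have r2 : 0 < 1 + r by lra.
have q1 : 1 < q by rewrite /q ltr_pdivlMr //; lra.
have t1 : 1 < t by apply/sqrt_gt1/sqrt_gt1.
have t4 : (t ^+ 2) ^+ 2 = q.
  by rewrite /t !sqr_sqrtr ?sqrtr_ge0 //; lra.
have qr : q * r < 1 by rewrite /q mulrAC ltr_pdivrMr //; lra.
exists t => //; split; first exact: dil_antilin.
pose Zt w := (t ^+ 2)%:C%C *: Z w.
apply: (@gauss_bounded _ _ Zt (q * r) (q * h)) => //.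
- by move=> a u v; rewrite /Zt ZA scalerDr !scalerA mulrC.
- by move=> x y; rewrite /Zt !ipZr Zs.
- by rewrite mulr_ge0 //; lra.
- move=> x; rewrite /Zt nsqZ cabs_real ger0_norm ?sqr_ge0 // t4 -(mulrA q r) ler_wpM2l //.
  by lra.
- move=> f onf; under eq_bigr do rewrite /Zt nsqZ cabs_real ger0_norm ?sqr_ge0 // t4.
  rewrite -mulr_sumr ler_wpM2l ?Zh //; lra.
split; first exact: dil_antilin.
- by rewrite rmorph1.
- move=> w x; rewrite dil_gen (antilinZ EA) EZ ann_dil (antilinZ EA) !conj_realC !scaleoE.
  have -> : sym_ann (Zt w) x = (t ^+ 2)%:C%C *: sym_ann (Z w) x.
    by rewrite -[Zt w]addr0 sym_ann_antilinear sym_ann0 addr0 conj_realC.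
  by rewrite linearZ /= (antilinZ EA) conj_realC scaleoE mulrA -rmorphM.
Qed.

Lemma ceq_eps_small (z w : R[i]) (k : R) :
  (forall e, 0 < e -> e <= 1 -> cabs (z - w) <= k * e) -> z = w.
Proof.
move=> hk; apply: (@ceq_eps _ _ _ `|k|) => e e0.
have m0 : 0 < Num.min e 1 by rewrite lt_min e0 ltr01.
apply: le_trans (hk _ m0 _) _; first by rewrite ge_min lexx orbT.
apply: (@le_trans _ _ (`|k| * Num.min e 1)).
  by rewrite ler_wpM2r ?ler_norm ?(ltW m0).
by rewrite ler_wpM2l // ge_min lexx.
Qed.

Lemma fip_self (H : preHilbertType R) (Phi : H -> R[i]^o) N : bounded Phi ->
  0 <= N -> bdd N Phi -> (forall M, 0 <= M -> bdd M Phi -> N <= M) ->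
  fip Phi Phi = (N ^+ 2)%:C%C.
Proof.
move=> hP N0 PN Nmin; have [K hK] := fipP hP hP.
(* Three errors for an approximant x, with e <= 1: K e from the definition of [fip], (N + 1) e
   between Phi(x) and |x|^2, and (2N + 1) e between |x|^2 and N^2, since |x| is within e of N. *)
apply: (@ceq_eps_small _ _ (K + (N + 1) + (2 * N + 1))) => e e0 e1.
have [x hx] := bounded_approx hP e0.
have h1 := hK _ _ e0 hx; have h2 := hx x.
have h3 := approx_norm N0 (ltW e0) PN hx.
have h4 : N <= hnorm x + e.
  by apply: Nmin (approx_bdd hx); rewrite addr_ge0 ?hnorm_ge0 ?ltW.
have -> : fip Phi Phi - (N ^+ 2)%:C%C = (fip Phi Phi - Phi x) + (Phi x - ip x x) +
    (nsq x - N ^+ 2)%:C%C by rewrite rmorphB /= -ip_sqr; ring.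
apply: le_trans (cabsD _ _) _; rewrite mulrDl lerD //.
  apply: le_trans (cabsD _ _) _; rewrite mulrDl lerD //.
  by apply: le_trans h2 _; rewrite mulrC ler_wpM2r ?(ltW e0) //; lra.
rewrite cabs_real -hnorm_sqr subr_sqr normrM mulrC ler_pM //.
  rewrite ger0_norm ?addr_ge0 ?hnorm_ge0 //; lra.
by rewrite ler_norml; apply/andP; split; lra.
Qed.

End NiceFunctionals.

(** * The norm of Fock space and polarization *)

Section FockNorm.
Context {R : realType} {W : preHilbertType R}.
Implicit Types (x y : Sym W) (Phi Psi : Sym W -> R[i]^o).

Lemma fock_spaceP Phi : fock_space Phi <-> bounded Phi.
Proof.
split=> [[PA [M hM]]|[PA [M M0 hM]]]; split=> //; last first.
  by exists M => x; rewrite cabs_le sym_normE.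
exists `|M| => // x; have := hM x; rewrite cabs_le sym_normE => /le_trans; apply.
by rewrite ler_wpM2r ?hnorm_ge0 ?ler_norm.
Qed.

Lemma fock_norm_le Phi M : 0 <= M -> bdd M Phi -> fock_norm Phi <= M.
Proof.
move=> M0 h; apply: ge_sup.
  exists (complex.Re `|Phi 0|), 0 => //=.
  by rewrite sym_normE hnorm0.
move=> _ [x /= x1 <-]; rewrite sym_normE in x1.
by apply: le_trans (h x) _; rewrite ler_piMr.
Qed.

Lemma fock_norm_bdd Phi : bounded Phi -> bdd (fock_norm Phi) Phi.
Proof.
move=> [PA [M M0 hM]] x; have [x0|x0] := eqVneq (hnorm x) 0.
  by rewrite x0 mulr0 (hnorm_eq0 x0) (antilin0 PA) cabs0.
have xp : 0 < hnorm x by rewrite lt_def x0 hnorm_ge0.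
have c0 : 0 <= (hnorm x)^-1 by rewrite invr_ge0 hnorm_ge0.
rewrite -ler_pdivrMr //.
have -> : cabs (Phi x) / hnorm x = cabs (Phi (((hnorm x)^-1)%:C%C *: x)).
  by rewrite (antilinZ PA) conj_realC scaleoE cabsM cabs_real ger0_norm // mulrC.
apply: ub_le_sup.
  exists M => _ [y /= y1 <-]; rewrite sym_normE in y1.
  by apply: le_trans (hM y) _; rewrite ler_piMr.
exists (((hnorm x)^-1)%:C%C *: x) => //=.
by rewrite sym_normE hnormZ cabs_real ger0_norm // mulVf.
Qed.

Lemma fock_norm_ge0 Phi : bounded Phi -> 0 <= fock_norm Phi.
Proof.
move=> hP; have := fock_norm_bdd hP 1; move/(le_trans (cabs_ge0 _)).
have -> : hnorm (1 : Sym W) = 1 by rewrite /hnorm -/(nsq _) nsq_one sqrtr1.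
by rewrite mulr1.
Qed.

Lemma fock_norm_emb x : fock_norm (fock_emb x) = hnorm x.
Proof.
apply/le_anti/andP; split; first by apply: fock_norm_le (hnorm_ge0 _) (bdd_ip x).
have := fock_norm_bdd (bounded_ip x) x.
rewrite ip_sqr cabs_real ger0_norm ?nsq_ge0 // -hnorm_sqr expr2.
have [->|x0] := eqVneq (hnorm x) 0.
  by move=> _; exact: fock_norm_ge0 (bounded_ip x).
by rewrite ler_pM2r // lt_def x0 hnorm_ge0.
Qed.

Lemma fip_fock_norm Phi : bounded Phi -> fip Phi Phi = (fock_norm Phi ^+ 2)%:C%C.
Proof.
move=> hP; apply: fip_self => //; [exact: fock_norm_ge0 | exact: fock_norm_bdd |].
by move=> M; exact: fock_norm_le.
Qed.

Lemma boundedZ a Phi : bounded Phi -> bounded (a *: Phi).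
Proof.
move=> [PA [M M0 hM]]; split.
  move=> b x y; rewrite -![(a *: Phi) _]/(a * Phi _) PA !scaleoE; ring.
exists (cabs a * M); first by rewrite mulr_ge0 ?cabs_ge0.
move=> x; rewrite -[(a *: Phi) x]/(a * Phi x) cabsM -mulrA.
by rewrite ler_wpM2l ?cabs_ge0.
Qed.

Lemma fock_normZ a Phi : bounded Phi -> fock_norm (a *: Phi) = cabs a * fock_norm Phi.
Proof.
have le b Psi : bounded Psi -> fock_norm (b *: Psi) <= cabs b * fock_norm Psi.
  move=> hQ; apply: fock_norm_le; first by rewrite mulr_ge0 ?cabs_ge0 ?fock_norm_ge0.
  move=> x; rewrite -[(b *: Psi) x]/(b * Psi x) cabsM -mulrA.
  by rewrite ler_wpM2l ?cabs_ge0 ?fock_norm_bdd.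
move=> hP; have [->|a0] := eqVneq a 0.
  rewrite cabs0 mul0r scale0r; apply/le_anti; rewrite fock_norm_le //=; last first.
    by move=> x; rewrite cabs0 mul0r.
  have := boundedZ 0 hP; rewrite scale0r; exact: fock_norm_ge0.
apply/le_anti; rewrite le //=.
have ca : 0 < cabs a by rewrite lt_def cabs_ge0 andbT; apply: contra_neq a0; exact: cabs_eq0.
have := le a^-1 _ (boundedZ a hP); rewrite scalerA mulVf // scale1r.
have -> : cabs a^-1 = (cabs a)^-1.
  by apply: (mulfI (lt0r_neq0 ca)); rewrite -cabsM !mulfV ?cabs1 // lt0r_neq0.
by rewrite ler_pdivlMl.
Qed.

Lemma sqr_Ci : 'i * 'i = -1 :> R[i]. Proof. by rewrite -expr2 sqrCi. Qed.

(** In the polarization sum the term k = 0 is 4|Phi|^2, the term k = 2 vanishes, and those for k = 1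
    and k = 3 cancel. *)
Lemma fock_ip_self Phi : bounded Phi -> fock_ip Phi Phi = (fock_norm Phi ^+ 2)%:C%C.
Proof.
move=> hP; have e (a : R[i]) : Phi + a *: Phi = (1 + a) *: Phi.
  by rewrite scalerDl scale1r.
rewrite /fock_ip; under eq_bigr do rewrite e fock_normZ // exprMn rmorphM /= -mul_conj_cabs.
rewrite !big_ord_recr big_ord0 /= add0r; set N := ((fock_norm Phi) ^+ 2)%:C%C.
have ci : ('i : R[i])^* = - 'i := conjCi _.
have s2 := sqr_Ci; set i : R[i] := 'i in s2 ci *.
have e2 : i ^+ 2 = -1 by rewrite expr2.
have e3 : i ^+ 3 = - i by rewrite exprS e2 mulrN1.
have n3 : (- i) ^+ 3 = i by rewrite exprS sqrrN e2 mulrN1 opprK.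
rewrite e2 e3 n3 !expr0 !expr1 subrr mul0r mul0r mulr0 addr0 !rmorphD rmorphN rmorph1 /= ci.
transitivity (4^-1 * 4 * N); first by ring.
by rewrite mulVf ?mul1r // pnatr_eq0.
Qed.

(* By polarization, since T Phi + i^k T Psi = T (Phi + (-i)^k Psi). *)
Lemma fock_ip_isometry (T : (Sym W -> R[i]^o) -> (Sym W -> R[i]^o)) Phi Psi :
  (forall a Phi Psi, bounded Phi -> bounded Psi ->
    T (a *: Phi + Psi) = a^* *: T Phi + T Psi) ->
  (forall Phi, bounded Phi -> fock_norm (T Phi) = fock_norm Phi) ->
  bounded Phi -> bounded Psi -> fock_ip (T Phi) (T Psi) = fock_ip Psi Phi.
Proof.
move=> TA TN hP hQ; rewrite /fock_ip; congr (_ * _); apply: eq_bigr => k _.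
congr (_ * (_ ^+ 2)%:C%C).
have ik : (- 'i) ^+ k * 'i ^+ k = 1 :> R[i].
  by rewrite -exprMn mulNr sqr_Ci opprK expr1n.
have kc : ((- 'i : R[i]) ^+ k)^* = 'i ^+ k by rewrite rmorphXn /= rmorphN /= conjCi opprK.
rewrite addrC -kc -TA // TN; last exact: boundedP.
have -> : (- 'i) ^+ k *: Psi + Phi = (- 'i) ^+ k *: (Psi + 'i ^+ k *: Phi).
  by rewrite scalerDr scalerA ik scale1r.
have c1 : cabs ((- 'i : R[i]) ^+ k) = 1.
  rewrite /cabs normrX normrN normCi expr1n //.
rewrite kc fock_normZ ?c1 ?mul1r //.
by rewrite addrC; apply: boundedP.
Qed.

End FockNorm.

(** * The Hilbert-Schmidt criterion *)

Section HilbertSchmidtBounds.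
Context {R : realType} {V : hilbertType R}.

Lemma ip_sym_gen (u v : V) : ip (sym_gen u) (sym_gen v) = ip u v.
Proof.
by rewrite -[sym_gen u]mulr1 ip_cre sym_ann_gen ipZr ip_sqr nsq_one mulr1.
Qed.

(* The test vector sum_e e.(Ze) detects the Hilbert-Schmidt norm of Z. *)
Lemma gauss_hs (Z : V -> V) E M : antilinear Z -> symmetric_map Z ->
  is_gauss Z E -> 0 <= M -> bdd M E ->
  forall f : seq V, onseq f -> \sum_(e <- f) nsq (Z e) <= 2 * M ^+ 2.
Proof.
move=> ZA Zs [EA E1 EZ] M0 EM f onf; set s := \sum_(e <- f) nsq (Z e).
pose x := \sum_(e <- f) sym_gen e * sym_gen (Z e).
have Ex : E x = s%:C%C.
  rewrite (antilin_sum EA) -sum_realC; apply: eq_bigr => e _.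
  by rewrite EZ sym_ann_gen (antilinZ EA) E1 -ip_sqr -ip_conj; exact: mulr1.
(* Pairing e.(Ze) with x leaves two terms: |Ze|^2, and a sum of squared coefficients of Ze that is
   at most |Ze|^2 by Bessel's inequality. *)
have nx : nsq x <= 2 * s.
  rewrite /nsq ip_suml Re_sum mulr_sumr !big_seq; apply: ler_sum => e ef.
  have -> : ip (sym_gen e * sym_gen (Z e)) x = ip (Z e) (Z (oproj f e)) +
      (\sum_(e' <- f) cabs (ip e' (Z e)) ^+ 2)%:C%C.
    rewrite ip_sumr -sum_realC (antilin_sum ZA) ip_sumr -big_split; apply: eq_bigr => e' _ /=.
    rewrite ip_cre annM_gen sym_ann_gen ipDr ipZr [X in _ + ip _ X]mulrC mulr_algl ipZr.
    rewrite !ip_sym_gen (antilinZ ZA) ipZr -ip_conj.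
    by congr (_ + _); rewrite Zs -mul_conj_cabs -ip_conj.
  have -> : ip (Z e) (Z (oproj f e)) = ip (Z e) (Z e).
    by rewrite oproj_in.
  rewrite raddfD /=; have := bessel (Z e) onf; rewrite -/(nsq (Z e)); lra.
have s0 : 0 <= s by apply: sumr_ge0 => e _; exact: nsq_ge0.
have := EM x; rewrite Ex cabs_real ger0_norm // => h.
have h2 : s ^+ 2 <= M ^+ 2 * (2 * s).
  apply: (@le_trans _ _ ((M * hnorm x) ^+ 2)); first by rewrite ler_pXn2r ?nnegrE // mulr_ge0 ?hnorm_ge0.
  by rewrite exprMn hnorm_sqr ler_wpM2l ?sqr_ge0.
have [->|sn] := eqVneq s 0; first by rewrite mulr_ge0 ?sqr_ge0.
have sp : 0 < s by rewrite lt_def sn.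
by rewrite -(ler_pM2r sp) -expr2; apply: le_trans h2 _; rewrite mulrCA mulrA.
Qed.

Lemma ler_sum_uniq (s t : seq V) (a : V -> R) : (forall x, 0 <= a x) ->
  uniq s -> uniq t -> {subset s <= t} -> \sum_(x <- s) a x <= \sum_(x <- t) a x.
Proof.
move=> a0; elim: s t => [|x s IH] t; first by move=> *; rewrite big_nil sumr_ge0.
move=> /= /andP[xs us] ut st; have xt : x \in t by apply: st; rewrite inE eqxx.
rewrite big_cons (perm_big _ (perm_to_rem xt)) big_cons.
rewrite lerD2l; apply: IH => //; first exact: rem_uniq.
move=> y ys; rewrite mem_rem_uniq // !inE st ?inE ?ys ?orbT // andbT.
by apply: contraNneq xs => <-.
Qed.

Lemma parseval_approx_seq E (s : seq V) (eta : R) : orthonormal_basis E -> 0 < eta ->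
  exists f, [/\ uniq f, forall e, e \in f -> E e &
    \sum_(v <- s) nsq v <= \sum_(v <- s) \sum_(e <- f) cabs (ip e v) ^+ 2 + eta].
Proof.
move=> onb; elim: s eta => [|v s IH] eta eta0.
  by exists [::]; split=> //; rewrite !big_nil add0r ltW.
have e2 : 0 < eta / 2 by rewrite divr_gt0.
have [f [uf fE hf]] := IH _ e2; have [g [ug gE hg]] := parseval_approx v onb e2.
exists (undup (f ++ g)); split; first exact: undup_uniq.
  by move=> e; rewrite mem_undup mem_cat => /orP[/fE|/gE].
have mono h w : uniq h -> {subset h <= f ++ g} ->
   \sum_(e <- h) cabs (ip e w) ^+ 2 <= \sum_(e <- undup (f ++ g)) cabs (ip e w) ^+ 2.
  move=> uh hh; apply: ler_sum_uniq => // [x||x /hh]; rewrite ?sqr_ge0 ?undup_uniq //.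
  by rewrite mem_undup.
rewrite !big_cons.
have m2 : \sum_(v <- s) \sum_(e <- f) cabs (ip e v) ^+ 2 <=
    \sum_(v <- s) \sum_(e <- undup (f ++ g)) cabs (ip e v) ^+ 2.
  by apply: ler_sum => w _; apply: mono => // x xf; rewrite mem_cat xf.
have m3 : \sum_(e <- g) cabs (ip e v) ^+ 2 <= \sum_(e <- undup (f ++ g)) cabs (ip e v) ^+ 2.
  by apply: mono => // x xf; rewrite mem_cat xf orbT.
lra.
Qed.

(** The squared matrix coefficients of C and of its adjoint are the same double sum, read in the two
    orders. It also frees the bound from the basis: applied twice, it gives C itself on arbitrary
    orthonormal lists. *)
Lemma hs_adjoint (C C' : V -> V) E (h : R) : orthonormal_basis E ->
  (forall x y, ip (C x) y = - ip x (C' y)) ->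
  (forall f, uniq f -> (forall e, e \in f -> E e) -> \sum_(e <- f) nsq (C e) <= h) ->
  forall f, onseq f -> \sum_(e <- f) nsq (C' e) <= h.
Proof.
move=> onb adj hC f onf; apply: (@le_eps _ _ _ 1) => eta eta0; rewrite mul1r.
have [g [ug gE]] := parseval_approx_seq (map C' f) onb eta0.
rewrite !big_map => /le_trans; apply; rewrite lerD2r exchange_big /=.
apply: le_trans (hC g ug gE); apply: ler_sum => x _.
apply: le_trans (bessel (C x) onf); apply: ler_sum => e _.
by rewrite -[ip x _]opprK -adj cabsN [ip e _]ip_conj cabs_conj.
Qed.

Lemma hs_bounded (T : V -> V) (h : R) : (forall a v, T (a *: v) = a *: T v) ->
  (forall f, onseq f -> \sum_(e <- f) nsq (T e) <= h) ->
  forall x, nsq (T x) <= h * nsq x.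
Proof.
move=> TZ hT x; have [x0|x0] := eqVneq (hnorm x) 0.
  have T0 : T 0 = 0 by rewrite -(scale0r (0 : V)) TZ !scale0r.
  by rewrite (hnorm_eq0 x0) T0 nsq0 mulr0.
pose e := ((hnorm x)^-1)%:C%C *: x.
have nn : (hnorm x)^-1 ^+ 2 * nsq x = 1 by rewrite -hnorm_sqr -exprMn mulVf // expr1n.
have ee : ip e e = 1.
  by rewrite ip_sqr nsqZ cabs_real ger0_norm ?invr_ge0 ?hnorm_ge0 // nn.
have := hT [:: e]; rewrite big_seq1 /e TZ nsqZ cabs_real ger0_norm ?invr_ge0 ?hnorm_ge0 //.
move=> /(_ _) h1; have {}h1 : (hnorm x)^-1 ^+ 2 * nsq (T x) <= h by apply: h1; split.
have xp : 0 < nsq x by rewrite -hnorm_sqr exprn_gt0 // lt_def x0 hnorm_ge0.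
rewrite -ler_pdivrMr // mulrC; apply: le_trans h1.
by rewrite -hnorm_sqr exprVn.
Qed.

End HilbertSchmidtBounds.

(** * From exchange rules to an antiunitary operator *)

Section MetaIsometry.
Context {R : realType} {V : hilbertType R}.
Implicit Types (x y : Sym V) (Phi Psi : Sym V -> R[i]^o).

Section Isometry.
Variables (C A C' A' : V -> V) (U : Sym V -> Sym V -> R[i]^o).
Hypotheses (B : bogoliubov C A C' A') (hU : meta_map C A C' A' U) (nU : nice (U 1)).

Let UD x y : U (x + y) = U x + U y.
Proof. by apply/funext => z; exact: (antilinD (metaL_antilin hU z)). Qed.

Let UZ a x : U (a *: x) = a^* *: U x.
Proof. by apply/funext => z; exact: (antilinZ (metaL_antilin hU z)). Qed.

Lemma meta_nice x : nice (U x).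
Proof.
move: x; apply: sym_cre_ind => [a|x y hx hy|w x hx].
- by rewrite UZ; apply: niceZ.
- by rewrite UD; apply: niceD.
- by rewrite (meta_cre B hU); apply: niceD; [exact: nice_ann | exact: nice_cre].
Qed.

Let bU x := nice_bounded (meta_nice x).
Let fipDl Phi Phi' Psi : bounded Phi -> bounded Phi' -> bounded Psi ->
  fip (Phi + Phi') Psi = fip Phi Psi + fip Phi' Psi.
Proof. by move=> h1 h2 h3; rewrite -{1}[Phi]scale1r fipPl // rmorph1 mul1r. Qed.
Let fipDr Phi Psi Psi' : bounded Phi -> bounded Psi -> bounded Psi' ->
  fip Phi (Psi + Psi') = fip Phi Psi + fip Phi Psi'.
Proof. by move=> h1 h2 h3; rewrite -{1}[Psi]scale1r fipPr // mul1r. Qed.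
Let b0 : bounded (0 : Sym V -> R[i]^o).
Proof. exact/nice_bounded/nice0. Qed.
Let fip0r Phi : bounded Phi -> fip Phi 0 = 0.
Proof.
move=> hP; have := fipDr hP b0 b0; rewrite addr0 => h.
by apply: (addrI (fip Phi 0)); rewrite addr0 -h.
Qed.
Let fip0l Psi : bounded Psi -> fip 0 Psi = 0.
Proof.
move=> hP; have := fipDl b0 b0 hP; rewrite addr0 => h.
by apply: (addrI (fip 0 Psi)); rewrite addr0 -h.
Qed.
Let fipZr a Phi Psi : bounded Phi -> bounded Psi -> fip Phi (a *: Psi) = a * fip Phi Psi.
Proof. by move=> h1 h2; rewrite -[a *: Psi]addr0 fipPr // fip0r // addr0. Qed.
Let fipZl a Phi Psi : bounded Phi -> bounded Psi -> fip (a *: Phi) Psi = a^* * fip Phi Psi.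
Proof. by move=> h1 h2; rewrite -[a *: Phi]addr0 fipPl // fip0l // addr0. Qed.

(** On nice functionals the adjoint of a(Cw) + c(Aw) is c(Cw) + a(Aw), which is how U carries a(w);
    so creator and annihilator stay adjoint after applying U. *)
Lemma meta_fip_adj w x y :
  fip (U (sym_gen w * x)) (U y) = fip (U x) (U (sym_ann w y)).
Proof.
have nx := meta_nice x; have ny := meta_nice y.
rewrite (meta_cre B hU) (meta_ann B hU).
have [n1 n2] := conj (nice_bounded (nice_ann (C w) nx)) (nice_bounded (nice_cre (A w) nx)).
have [n3 n4] := conj (nice_bounded (nice_ann (A w) ny)) (nice_bounded (nice_cre (C w) ny)).
rewrite fipDl // fipDr // addrC.
by have [-> _] := fip_adj (A w) nx ny; have [_ ->] := fip_adj (C w) nx ny.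
Qed.

Lemma meta_fip_adjr w x y :
  fip (U x) (U (sym_gen w * y)) = fip (U (sym_ann w x)) (U y).
Proof.
have nx := meta_nice x; have ny := meta_nice y.
rewrite (meta_cre B hU) (meta_ann B hU).
have [n1 n2] := conj (nice_bounded (nice_ann (C w) ny)) (nice_bounded (nice_cre (A w) ny)).
have [n3 n4] := conj (nice_bounded (nice_ann (A w) nx)) (nice_bounded (nice_cre (C w) nx)).
rewrite fipDl // fipDr // addrC.
by have [_ <-] := fip_adj (A w) nx ny; have [<- _] := fip_adj (C w) nx ny.
Qed.

Let k := fip (U 1) (U 1).

(** Creators are moved across until one argument is a constant; the arguments appear exchanged on
    the right because U is antilinear. *)
Lemma meta_fip x y : fip (U x) (U y) = k * ip y x.
Proof.
have base z : fip (U 1) (U z) = k * ip z 1.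
  move: z; apply: sym_cre_ind => [a|z z' hz hz'|w z _].
  - by rewrite UZ fipZr // ipZl ip_sqr nsq_one mulr1 mulrC.
  - by rewrite UD fipDr // hz hz' ipDl mulrDr.
  - rewrite meta_fip_adjr sym_ann1 ip_cre sym_ann1 ip0r mulr0.
    have -> : U 0 = 0 by rewrite -(scale0r (0 : Sym V)) UZ rmorph0 scale0r.
    exact: fip0l.
move: x y; apply: sym_cre_ind => [a|x x' hx hx'|w x hx] y.
- by rewrite UZ fipZl // conjCK base ipZr; ring.
- by rewrite UD fipDl // hx hx' ipDr mulrDr.
- by rewrite meta_fip_adj hx ip_ann.
Qed.

Hypothesis U1 : U 1 1 = 1.

Let c := fock_norm (U 1).

Lemma meta_norm_gt0 : 0 < c.
Proof.
rewrite lt_def fock_norm_ge0 // andbT; apply/eqP => c0.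
have := fock_norm_bdd (bU 1) 1; rewrite -/c c0 mul0r U1 cabs1.
by rewrite ler10.
Qed.

Lemma meta_k : k = (c ^+ 2)%:C%C.
Proof. exact: fip_fock_norm. Qed.

Lemma meta_fock_norm x : fock_norm (U x) = c * hnorm x.
Proof.
have := fip_fock_norm (bU x); rewrite meta_fip meta_k ip_sqr -rmorphM => /complexI e.
apply/eqP; rewrite -(eqrXn2 (n := 2)) ?mulr_ge0 ?hnorm_ge0 ?fock_norm_ge0 //.
by rewrite exprMn hnorm_sqr -e.
Qed.

Lemma meta_bounded x : bounded (U x) /\ bdd (c * hnorm x) (U x).
Proof. by split=> //; rewrite -meta_fock_norm; apply: fock_norm_bdd. Qed.

End Isometry.

Section Extension.
Variables (C A C' A' : V -> V) (U : Sym V -> Sym V -> R[i]^o).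
Hypotheses (B : bogoliubov C A C' A') (hU : meta_map C A C' A' U).
Hypotheses (nU : nice (U 1)) (nU' : nice (U^~ 1)) (U1 : U 1 1 = 1).
Let B' := bogo_sym B.
Let hU' := meta_sym hU.
Let U' y := U^~ y.
Let c := fock_norm (U 1).
Let c' := fock_norm (U^~ 1).

Let bU x := (meta_bounded B hU nU x).1.
Let bU' y : bounded (U' y) := (meta_bounded B' hU' nU' y).1.
Let c0 : 0 < c := meta_norm_gt0 B hU nU U1.
Let c'0 : 0 < c' := meta_norm_gt0 B' hU' nU' U1.

(* Since U^T is a metaplectic kernel for g^-1, each U^T y is bounded and
   <Phi | U^T y> is defined for every Phi in Fock space. *)
Definition meta_ext Phi : Sym V -> R[i]^o := fun y => fip Phi (U^~ y).

Lemma meta_ext_emb x : meta_ext (fock_emb x) = U x.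
Proof. by apply/funext => y; rewrite /meta_ext fipl //; exact: bU'. Qed.

Lemma meta_ext_antilin a Phi Psi : bounded Phi -> bounded Psi ->
  meta_ext (a *: Phi + Psi) = a^* *: meta_ext Phi + meta_ext Psi.
Proof. by move=> hP hQ; apply/funext => y; rewrite /meta_ext fipPl //; exact: bU'. Qed.

Lemma meta_ext_bdd Phi M : bounded Phi -> 0 <= M -> bdd M Phi ->
  bounded (meta_ext Phi) /\ bdd (M * c') (meta_ext Phi).
Proof.
move=> hP M0 PM; have hb : bdd (M * c') (meta_ext Phi).
  move=> y; have [_ hy] := meta_bounded B' hU' nU' y.
  have cy : 0 <= c' * hnorm y by rewrite mulr_ge0 ?hnorm_ge0 ?ltW.
  by have := fip_le hP (bU' y) M0 cy PM hy; rewrite mulrA.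
split=> //; split; last by exists (M * c') => //; rewrite mulr_ge0 // ltW.
move=> a y y'; rewrite /meta_ext -fipPr //; try exact: bU'.
congr (fip _ _); apply/funext => x; exact: (metaR hU).
Qed.

Lemma meta_ext_bounded Phi : bounded Phi -> bounded (meta_ext Phi).
Proof.
by move=> hP; have [] := meta_ext_bdd hP (fock_norm_ge0 hP) (fock_norm_bdd hP).
Qed.

Lemma meta_ext_approx Phi e x : bounded Phi -> 0 < e -> approx e x Phi ->
  forall y, cabs (meta_ext Phi y - U x y) <= e * c' * hnorm y.
Proof.
move=> hP e0 hx y.
have hD : bounded (Phi - fock_emb x).
  by rewrite addrC -scaleN1r; apply: boundedP (bounded_ip x) hP.
have [_ /(_ y)] := meta_ext_bdd hD (ltW e0) hx.
suff -> : meta_ext (Phi - fock_emb x) y = meta_ext Phi y - U x y by [].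
rewrite -meta_ext_emb addrC -scaleN1r meta_ext_antilin //; last exact: bounded_ip.
rewrite rmorphN rmorph1 -[LHS]/(-1 * meta_ext (fock_emb x) y + meta_ext Phi y).
by rewrite mulN1r addrC.
Qed.

(** The scaling is known on vectors of SV, and an e-approximant of Phi changes either side by at
    most a multiple of e. *)
Lemma meta_ext_norm Phi : bounded Phi -> fock_norm (meta_ext Phi) = c * fock_norm Phi.
Proof.
move=> hP; have hT := meta_ext_bounded hP.
have nP := fock_norm_ge0 hP; have nT := fock_norm_ge0 hT.
have key e : 0 < e -> exists x, [/\ approx e x Phi,
    fock_norm (meta_ext Phi) <= c * hnorm x + e * c' &
    c * hnorm x <= fock_norm (meta_ext Phi) + e * c'].
  move=> e0; have [x hx] := bounded_approx hP e0; exists x.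
  have ha := meta_ext_approx hP e0 hx.
  have hn := meta_fock_norm B hU nU x; rewrite -/c in hn.
  split=> //.
  - apply: fock_norm_le => [|y]; first by rewrite addr_ge0 // mulr_ge0 ?hnorm_ge0 ?ltW.
    rewrite -[meta_ext Phi y](subrK (U x y)); apply: le_trans (cabsD _ _) _.
    rewrite mulrDl [leRHS]addrC; apply: lerD; first exact: ha.
    by rewrite -hn; apply: fock_norm_bdd.
  - rewrite -hn; apply: fock_norm_le => [|y]; first by rewrite addr_ge0 // mulr_ge0 ?ltW.
    have -> : U x y = meta_ext Phi y - (meta_ext Phi y - U x y) by rewrite opprB addrC subrK.
    apply: le_trans (cabsD _ _) _; rewrite cabsN mulrDl lerD //.
    exact: fock_norm_bdd.
apply/le_anti/andP; split; apply: (@le_eps _ _ _ (c + c')) => e e0.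
- have [x [hx h1 _]] := key e e0.
  have := approx_norm nP (ltW e0) (fock_norm_bdd hP) hx.
  by move=> /(ler_wpM2l (ltW c0)); lra.
- have [x [hx _ h2]] := key e e0.
  have : fock_norm Phi <= hnorm x + e.
    by apply: fock_norm_le (approx_bdd hx); rewrite addr_ge0 ?hnorm_ge0 ?ltW.
  by move=> /(ler_wpM2l (ltW c0)); lra.
Qed.

End Extension.

(** If y approximates Psi, the left side at z is close to the inner product of the transposed kernel
    at y and z, which is c'^2 <z|y> by [meta_fip] for g^-1. The extension for g^-1 thus yields
    explicit preimages. *)
Lemma meta_ext_surj (C A C' A' : V -> V) U : bogoliubov C A C' A' ->
  meta_map C A C' A' U -> nice (U 1) -> nice (U^~ 1) -> U 1 1 = 1 ->
  forall Psi, bounded Psi -> meta_ext U (meta_ext (fun y x => U x y) Psi) =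
    (fock_norm (U^~ 1) ^+ 2)%:C%C *: Psi.
Proof.
move=> B hU nU nU' U1 Psi hP; have [B' hU'] := conj (bogo_sym B) (meta_sym hU).
pose U' y x := U x y; rewrite -/U'; set k' := (_ ^+ 2)%:C%C.
have hT := meta_ext_bounded (U := U') B' hU' nU U1.
pose c := fock_norm (U 1); pose c' := fock_norm (U^~ 1).
have c0 : 0 < c := meta_norm_gt0 B hU nU U1.
have c'0 : 0 < c' := meta_norm_gt0 B' hU' nU' U1.
apply/funext => z.
apply: (@ceq_eps _ _ _ (c * c' * hnorm z + cabs k' * hnorm z)) => e e0.
have [y hy] := bounded_approx hP e0.
have bz := (meta_bounded B' hU' nU' z); have [b1 b2] := bz.
have hk : fip (U' y) (U' z) = k' * ip z y.
  rewrite (meta_fip B' hU' nU'); congr (_ * _).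
  exact: (meta_k B' hU' nU').
have hd := meta_ext_approx (U := U') B' hU' nU U1 hP e0 hy.
pose D := meta_ext U' Psi - U' y.
have bD : bounded D.
  rewrite /D addrC -scaleN1r; apply: boundedP; last exact: hT.
  by have [] := meta_bounded B' hU' nU' y.
have e1 : meta_ext U (meta_ext U' Psi) z = fip D (U' z) + fip (U' y) (U' z).
  have by_ : bounded (U' y) by have [] := meta_bounded B' hU' nU' y.
  rewrite -[in RHS](mul1r (fip D _)) -[X in X * _](rmorph1 (Num.conj : {rmorphism R[i] -> R[i]})).
  rewrite -fipPl // scale1r /D subrK.
  by [].
rewrite e1 hk -[(k' *: Psi) z]/(k' * Psi z).
have -> : fip D (U' z) + k' * ip z y - k' * Psi z =
  fip D (U' z) - k' * (Psi z - ip z y) by ring.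
apply: le_trans (cabsD _ _) _; rewrite cabsN cabsM mulrDl lerD //.
  have ce : 0 <= e * c by rewrite mulr_ge0 ?ltW.
  have cz : 0 <= c' * hnorm z by rewrite mulr_ge0 ?hnorm_ge0 ?ltW.
  apply: le_trans (fip_le bD b1 ce cz hd b2) _.
  by rewrite le_eqVlt; apply/orP; left; apply/eqP; rewrite /c'; ring.
by rewrite -mulrA [hnorm z * e]mulrC ler_wpM2l ?cabs_ge0 //; exact: hy.
Qed.

Lemma meta_antiunitary (C A C' A' : V -> V) U : bogoliubov C A C' A' ->
  meta_map C A C' A' U -> nice (U 1) -> nice (U^~ 1) -> U 1 1 = 1 ->
  rescalable_to_antiunitary U.
Proof.
move=> B hU nU nU' U1; have [B' hU'] := conj (bogo_sym B) (meta_sym hU).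
pose c := fock_norm (U 1); pose c' := fock_norm (U^~ 1).
have c0 : 0 < c := meta_norm_gt0 B hU nU U1.
have c'0 : 0 < c' := meta_norm_gt0 B' hU' nU' U1.
pose T Phi := (c^-1)%:C%C *: meta_ext U Phi.
have TA a Phi Psi : bounded Phi -> bounded Psi -> T (a *: Phi + Psi) = a^* *: T Phi + T Psi.
  move=> hP hQ; rewrite /T (meta_ext_antilin B hU nU') // scalerDr !scalerA.
  by rewrite mulrC.
have bE Phi : bounded Phi -> bounded (meta_ext U Phi).
  exact: (meta_ext_bounded B hU nU' U1).
have TN Phi : bounded Phi -> fock_norm (T Phi) = fock_norm Phi.
  move=> hP; rewrite /T fock_normZ; last exact: bE.
  rewrite (meta_ext_norm B hU nU nU' U1) // cabs_real ger0_norm ?invr_ge0 ?ltW //.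
  by rewrite mulrA mulVf ?mul1r // lt0r_neq0.
split; first by move=> x; apply/fock_spaceP; have [] := meta_bounded B hU nU x.
exists (c^-1)%:C%C.
  by apply/eqP => /complexI /eqP; rewrite invr_eq0 (negPf (lt0r_neq0 c0)).
exists T; last by move=> x; rewrite /T (meta_ext_emb B hU nU').
split.
- by move=> Phi /fock_spaceP hP; apply/fock_spaceP/boundedZ/bE.
- by move=> a Phi Psi /fock_spaceP hP /fock_spaceP hQ; apply: TA.
(* The factor l cancels the c^-1 in T and the c'^2 produced by [meta_ext_surj]; it is real, so
   antilinearity of T leaves it unchanged. *)
- move=> Psi /fock_spaceP hP; pose l := c / c' ^+ 2.
  have hT := meta_ext_bounded B' hU' nU U1 hP.
  exists (l%:C%C *: meta_ext (fun y x => U x y) Psi); first exact/fock_spaceP/boundedZ.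
  have -> : T (l%:C%C *: meta_ext (fun y x => U x y) Psi) =
     l%:C%C *: T (meta_ext (fun y x => U x y) Psi).
    rewrite -[X in T X]addr0 TA //; last exact/nice_bounded/nice0.
    have -> : T 0 = 0.
      have b0 := nice_bounded (@nice0 R V).
      have := TA 1 _ _ b0 b0; rewrite rmorph1 !scale1r addr0 => h.
      by apply: (addrI (T 0)); rewrite addr0 -h.
    by rewrite addr0 conj_realC.
  rewrite /T (meta_ext_surj B hU nU nU' U1) // !scalerA -!rmorphM /=.
  have e : l * c^-1 * c' ^+ 2 = 1 by rewrite /l; field; rewrite !lt0r_neq0.
  by rewrite -/c' e scale1r.
- by move=> Phi Psi /fock_spaceP hP /fock_spaceP hQ; apply: fock_ip_isometry.
Qed.

(** Evaluating the functional U x at 1 costs at most its norm, which is |x|/|a| by isometry. For U_g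
    the functional so bounded is e^{Z_g}. *)
Lemma rescalable_transpose_bounded (U : Sym V -> Sym V -> R[i]^o) :
  (forall y, antilinear (U^~ y)) -> rescalable_to_antiunitary U ->
  exists2 M, 0 <= M & bdd M (U^~ 1).
Proof.
move=> UL [UF [a a0 [T [TF TA _ TI] TE]]].
have bU x : bounded (U x) by apply/fock_spaceP.
have ca : 0 < cabs a by rewrite lt_def cabs_ge0 andbT; apply: contra_neq a0; exact: cabs_eq0.
have bE x : bounded (fock_emb x) := bounded_ip x.
have Un x : fock_norm (U x) = (cabs a)^-1 * hnorm x.
  have e : fock_norm (a *: U x) = hnorm x.
    rewrite -TE -fock_norm_emb.
    have bT : bounded (T (fock_emb x)) by apply/fock_spaceP/TF/fock_spaceP.
    have := TI _ _ ((fock_spaceP _).2 (bE x)) ((fock_spaceP _).2 (bE x)).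
    rewrite !fock_ip_self // => /complexI h.
    by apply/eqP; rewrite -(eqrXn2 (n := 2)) ?fock_norm_ge0 // h.
  by rewrite -e fock_normZ // mulKf // lt0r_neq0.
exists (cabs a)^-1; first by rewrite invr_ge0 ltW.
move=> x; apply: le_trans (fock_norm_bdd (bU x) 1) _; rewrite Un.
have -> : hnorm (1 : Sym V) = 1 by rewrite /hnorm -/(nsq _) nsq_one sqrtr1.
by rewrite mulr1.
Qed.

End MetaIsometry.

(** * The equivalence with the Hilbert-Schmidt condition *)

Section HilbertSchmidtCriterion.
Context {R : realType} {V : hilbertType R}.

(** U 1 is the Gaussian of Z_{g^-1} = A'^-1 C'. Its strict contraction constant comes from C through
    [bogo_Z'_le], its Hilbert-Schmidt bound from C' because A'^-1 is a contraction. *)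
Lemma bogo_hs_nice (C A C' A' : V -> V) U (h h' : R) : bogoliubov C A C' A' ->
  meta_map C A C' A' U -> U 1 1 = 1 ->
  (forall f, onseq f -> \sum_(e <- f) nsq (C e) <= h) ->
  (forall f, onseq f -> \sum_(e <- f) nsq (C' e) <= h') -> nice (U 1).
Proof.
move=> B hU U1 hC hC'; have B' := bogo_sym B.
have h0 : 0 <= h by have := hC [::] I; rewrite big_nil.
have CZ a v : C (a *: v) = a *: C v.
  by have := bogo_lin B a v 0; rewrite (bogo_lin0 B) !addr0.
apply: (gauss_nice (r := h / (h + 1)) (h := h')) (meta_gauss_right hU U1).
- exact: bogo_Z_antilin B'.
- exact: bogo_Z_sym B'.
- by rewrite divr_ge0 //; lra.
- by rewrite ltr_pdivrMr; lra.
- by move=> x; apply: (bogo_Z'_le B) => //; apply: hs_bounded.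
- move=> f onf; apply: le_trans (hC' f onf); apply: ler_sum => e _.
  exact: (bogo_inv_le B').
Qed.

Lemma bogo_rescalable_hs (C A C' A' : V -> V) U : bogoliubov C A C' A' ->
  meta_map C A C' A' U -> U 1 1 = 1 ->
  rescalable_to_antiunitary U <-> hilbert_schmidt C.
Proof.
move=> B hU U1; have B' := bogo_sym B; have hU' := meta_sym hU; split.
  move=> hr; have [M M0 hM] := rescalable_transpose_bounded (metaL_antilin hU) hr.
  have hZ := gauss_hs (bogo_Z_antilin B) (bogo_Z_sym B) (meta_gauss_left hU U1) M0 hM.
  (* The bound obtained so far is for Z_g; writing C = A Z_g, boundedness of A transfers it to C. *)
  have [K K0 hK] := adjoint_bounded (bogo_antilin B) (bogo_antilin_adj B).
  have [E onb] := @orthonormal_basis_ex R V; exists E => //.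
  apply/(hilbert_schmidtP _ onb); exists (K * (2 * M ^+ 2)) => f uf fE.
  apply: le_trans (ler_wpM2l K0 (hZ f (onseq_basis onb uf fE))).
  rewrite mulr_sumr; apply: ler_sum => e _ /=.
  by rewrite -{1}[C e](bogo_AKi B); exact: hK.
case=> E onb /(hilbert_schmidtP _ onb) [h hh].
have hC' := hs_adjoint onb (bogo_lin_adj B) hh.
have hC : forall f, onseq f -> \sum_(e <- f) nsq (C e) <= h.
  apply: (hs_adjoint onb (bogo_lin_adj B')) => f uf fE.
  exact/hC'/(onseq_basis onb uf fE).
apply: (meta_antiunitary B hU) => //; first exact: (bogo_hs_nice B hU U1 hC hC').
exact: (bogo_hs_nice B' hU' U1 hC' hC).
Qed.

End HilbertSchmidtCriterion.

Theorem mainTheorem5 (R : realType) (V : hilbertType R) (g : V -> V)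
    (hg : antisymplectic g) :
  [/\ antilinear (metaZ g) /\ symmetric_map (metaZ g),
      weak_metaplectic g (metaU g),
      (forall U : Sym V -> (Sym V -> R[i]^o), weak_metaplectic g U ->
        exists c, U = c *: metaU g)
    & rescalable_to_antiunitary (metaU g) <-> hilbert_schmidt (lin_part g)].
Proof.
have B := antisymplectic_bogo hg.
have ZA : antilinear (metaZ g) := bogoZ_antilin B.
have Zs : symmetric_map (metaZ g) := bogoZ_sym B.
have hU := gauss_meta B (gaussianP Zs).
rewrite -/(metaU g) in hU.
have U1 : metaU g 1 1 = 1.
  by rewrite /metaU /sym1 /sym2 !rmorph1 mulr1; have [] := gaussianP Zs.
split; first by split.
- split.
  + exact: metaR hU.
  + by move=> a x y; apply/funext => z; exact: (metaL hU).
  + by exists 1, 1; rewrite U1 oner_eq0.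
  + exact: (meta_cre B hU).
  + exact: (meta_ann B hU).
(* The scalar is forced by evaluation at (1, 1), where U_g has the value 1. *)
- move=> U [UR UL _ h1 h2]; exists (U 1 1).
  apply: (meta_uniq (weak_meta B UR UL h1 h2) (meta_scale _ hU)).
  by rewrite -[RHS]/(U 1 1 * metaU g 1 1) U1 mulr1.
- exact: (bogo_rescalable_hs B hU U1).
Qed.
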